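(* Let $g$ be a distortion function satisfying (A1), (A2) and (A4), and let $\mu,\sigma,\varepsilon$ satisfy (A3). Put $$c_0=\lim_{\lambda\searrow0}\operatorname{corr}\big(F^{-1}(U),k^\uparrow_\lambda(U)\big).$$ 1. Suppose $(\mu_F-\mu)^2+(\sigma_F-\sigma)^2<\varepsilon<(\mu_F-\mu)^2+(\sigma_F-\sigma)^2+2\sigma\sigma_F(1-c_0)$. Then the equation $d_W(F^{-1},h^\uparrow_\lambda)=\sqrt\varepsilon$ has a unique positive solution $\lambda$. For this $\lambda$, the problem $\sup_{G\in\mathcal M_\varepsilon(\mu,\sigma)}H_g(G)$ has a unique maximiser, whose quantile function is $h^\uparrow_\lambda$. The supremum equals $$H_g(h^\uparrow_\lambda)=\mu+\sigma\operatorname{std}(\gamma(U))\operatorname{corr}\big(\gamma(U),k^\uparrow_\lambda(U)\big),$$ and it is continuous in $\varepsilon$. 2. Suppose $\varepsilon\ge(\mu_F-\mu)^2+(\sigma_F-\sigma)^2+2\sigma\sigma_F(1-c_0)$. - If $\gamma^\uparrow$ is not constant, then the conclusion of part 1 holds with $\lambda=0$: the unique maximiser has quantile function $h^\uparrow_0$, and the supremum is $\mu+\sigma\operatorname{std}(\gamma(U))\operatorname{corr}(\gamma(U),\gamma^\uparrow(U))$. - If $\gamma^\uparrow$ is constant, then $\sup_{G\in\mathcal M_\varepsilon(\mu,\sigma)}H_g(G)=\mu$, and this supremum need not be attained.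
   Context: Let $(\Omega,\mathcal A,\mathbb P)$ be an atomless probability space and $U\sim\mathcal U(0,1)$. $\mathcal M^2$ denotes the distribution functions on $\mathbb R$ with finite second moment, and $G^{-1}(u)=\inf\{y:G(y)\ge u\}$. A distortion function is a non-decreasing $g:[0,1]\to[0,1]$ with $g(0)=0$, $g(1)=1$. For absolutely continuous $g$, $\gamma(u)=\partial_-g(x)|_{x=1-u}$ (left derivative), $0<u<1$, and $H_g(G)=\int_0^1\gamma(u)G^{-1}(u)\,du$ (also written $H_g(G^{-1})$). Standing assumptions: - (A1) $g$ is absolutely continuous and $\int_0^1\gamma^2<\infty$; - (A2) $\gamma$ is not a.e. equal to $1$. $d_W(G_1,G_2)=\big(\int_0^1(G_1^{-1}-G_2^{-1})^2\big)^{1/2}$. A reference $F\in\mathcal M^2$ is fixed, with mean $\mu_F$ and standard deviation $\sigma_F>0$. Also $$\mathcal M_\varepsilon(\mu,\sigma)=\Big\{G\in\mathcal M^2:\text{mean }\mu,\ \text{second moment }\mu^2+\sigma^2,\ d_W(F,G)\le\sqrt\varepsilon\Big\},$$ for $\mu\in\mathbb R$, $\sigma>0$, $0\le\varepsilon\le\infty$. - (A3) $\varepsilon>(\mu_F-\mu)^2+(\sigma_F-\sigma)^2$. Isotonic projection. Let $\mathcal K$ be the set of square-integrable, non-decreasing, left-continuous functions $(0,1)\to\mathbb R$. For $\lambda\ge0$, $$k^\uparrow_\lambda=\arg\min_{k\in\mathcal K}\|\gamma+\lambda F^{-1}-k\|^2_{L^2(0,1)},$$ and $\gamma^\uparrow:=k^\uparrow_0$.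 Let $\lambda^\uparrow=\inf\{\lambda\ge0:k^\uparrow_\lambda\text{ is not constant}\}$ (with $\inf\emptyset=+\infty$). - (A4) $\lambda^\uparrow=0$. When $k^\uparrow_\lambda$ is non-constant, $$h^\uparrow_\lambda(u)=\mu+\sigma\,\frac{k^\uparrow_\lambda(u)-a_\lambda}{b_\lambda},$$ with $a_\lambda=\mathbb E(k^\uparrow_\lambda(U))$ and $b_\lambda=\operatorname{std}(k^\uparrow_\lambda(U))$. Uniqueness of optimisers refers to quantile functions. *)

(* Defs.v *)
From HB Require Import structures.
From mathcomp Require Import all_boot all_order all_algebra.
From mathcomp Require Import all_classical all_reals all_analysis.
Import Order.TTheory GRing.Theory Num.Theory.
Import numFieldNormedType.Exports.

Set Implicit Arguments.
Unset Strict Implicit.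
Unset Printing Implicit Defensive.

Local Open Scope classical_set_scope.
Local Open Scope ring_scope.

Section defs.
Variable R : realType.

Definition I01 : set R := `]0, 1[%classic.

(** E f(U) for U ~ U(0,1): Lebesgue integral over (0,1). *)
Definition EU (f : R -> R) : R :=
  fine (\int[@lebesgue_measure R]_(u in I01) (f u)%:E)%E.

Definition L2 (f : R -> R) : Prop :=
  measurable_fun I01 f /\
  (\int[@lebesgue_measure R]_(u in I01) ((f u) ^+ 2)%:E < +oo)%E.

Definition varU (f : R -> R) : R := EU (fun u => (f u - EU f) ^+ 2).
Definition stdU (f : R -> R) : R := Num.sqrt (varU f).
Definition covU (f h : R -> R) : R :=
  EU (fun u => (f u - EU f) * (h u - EU h)).
Definition corrU (f h : R -> R) : R := covU f h / (stdU f * stdU h).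

(** f is constant on (0,1) (i.e. f(U) is a.s. constant for monotone f). *)
Definition constant01 (f : R -> R) : Prop :=
  exists c : R, forall u, I01 u -> f u = c.

Definition distr_fun (G : R -> R) : Prop :=
  [/\ {homo G : x y / x <= y},
      (forall x : R, G x @[x --> x^'+] --> G x),
      G @ -oo --> (0 : R) &
      G @ +oo --> (1 : R)].

Definition quantile (G : R -> R) (u : R) : R := inf [set y | u <= G y].

(** M^2 : distribution functions with finite second moment
    (the law G is that of G^{-1}(U)). *)
Definition M2 (G : R -> R) : Prop := distr_fun G /\ L2 (quantile G).

Definition meanD (G : R -> R) : R := EU (quantile G).
Definition secmomD (G : R -> R) : R := EU (fun u => (quantile G u) ^+ 2).
Definition stdD (G : R -> R) : R := stdU (quantile G).

Definition distortion (g : R -> R) : Prop :=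
  [/\ {in `[0, 1] &, {homo g : x y / x <= y}},
      (forall x, 0 <= x <= 1 -> 0 <= g x <= 1),
      g 0 = 0 & g 1 = 1].

Definition abs_continuous01 (g : R -> R) : Prop :=
  forall e : R, 0 < e -> exists2 d : R, 0 < d &
    forall (n : nat) (a b : nat -> R),
      (forall i, (i < n)%N -> 0 <= a i /\ a i <= b i /\ b i <= 1) ->
      (forall i j, (i < n)%N -> (j < n)%N -> i <> j ->
         b i <= a j \/ b j <= a i) ->
      \sum_(i < n) (b i - a i) < d ->
      \sum_(i < n) `|g (b i) - g (a i)| < e.

Definition gam (g : R -> R) (u : R) : R :=
  lim ((fun h => (g (1 - u) - g (1 - u - h)) / h) @ 0^'+).

Definition A1 (g : R -> R) : Prop := abs_continuous01 g /\ L2 (gam g).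
Definition A2 (g : R -> R) : Prop :=
  ~ {ae @lebesgue_measure R, forall u, I01 u -> gam g u = 1}.

Definition HgQ (g : R -> R) (q : R -> R) : R := EU (fun u => gam g u * q u).
Definition Hg (g G : R -> R) : R := HgQ g (quantile G).

Definition dWq (q1 q2 : R -> R) : R :=
  Num.sqrt (EU (fun u => (q1 u - q2 u) ^+ 2)).
Definition dW (G1 G2 : R -> R) : R := dWq (quantile G1) (quantile G2).

Definition dW_le (F G : R -> R) (eps : \bar R) : Prop :=
  match eps with
  | +oo%E => True
  | r%:E => dW F G <= Num.sqrt r
  | -oo%E => False
  end.

Definition Mset (F : R -> R) (mu sigma : R) (eps : \bar R) : set (R -> R) :=
  [set G | [/\ M2 G, meanD G = mu, secmomD G = mu ^+ 2 + sigma ^+ 2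
             & dW_le F G eps]].

Definition supH (g F : R -> R) (mu sigma : R) (eps : \bar R) : \bar R :=
  ereal_sup [set (Hg g G)%:E | G in Mset F mu sigma eps].

Definition unique_maximiser (g F : R -> R) (mu sigma : R) (eps : \bar R)
    (h : R -> R) : Prop :=
  (exists G, [/\ Mset F mu sigma eps G,
                 (Hg g G)%:E = supH g F mu sigma eps &
                 {in I01, quantile G =1 h}]) /\
  (forall G, Mset F mu sigma eps G ->
     (Hg g G)%:E = supH g F mu sigma eps -> {in I01, quantile G =1 h}).

Definition Kcone (k : R -> R) : Prop :=
  [/\ L2 k, {in I01 &, {homo k : x y / x <= y}} &
      (forall u, I01 u -> k x @[x --> u^'-] --> k u)].

Definition sqdist (f k : R -> R) : \bar R :=
  (\int[@lebesgue_measure R]_(u in I01) ((f u - k u) ^+ 2)%:E)%E.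

Definition isoproj (f k : R -> R) : Prop :=
  Kcone k /\ (forall k', Kcone k' -> (sqdist f k <= sqdist f k')%E).

Definition kup (g F : R -> R) (lam : R) : R -> R :=
  xget (fun _ => 0) (isoproj (fun u => gam g u + lam * quantile F u)).

Definition gamup (g F : R -> R) : R -> R := kup g F 0.

(** (A4): lambda^up = inf {lambda >= 0 : k^up_lambda not constant} = 0
    (with inf of the empty set = +oo, so the set must be nonempty). *)
Definition A4 (g F : R -> R) : Prop :=
  let S := [set lam : R | 0 <= lam /\ ~ constant01 (kup g F lam)] in
  S !=set0 /\ inf S = 0.

Definition hup (g F : R -> R) (mu sigma lam : R) (u : R) : R :=
  mu + sigma * (kup g F lam u - EU (kup g F lam)) / stdU (kup g F lam).

Definition c0 (g F : R -> R) : R :=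
  lim ((fun lam => corrU (quantile F) (kup g F lam)) @ 0^'+).

End defs.

(* Main.v *)
(** Write [q = F^{-1}], [f_l = gamma + l q] and let [k_l] be the isotonic
    projection of [f_l].  Since the cone is stable under adding constants,
    [k_l] is characterised by [cov (f_l - k_l, k) <= 0] on the cone with
    equality at [k_l]; hence by Cauchy-Schwarz
    [cov (gamma, h) + l cov (q, h) <= std k_l * std h] on the cone, with
    equality only for the normalisation [h_l] of [k_l].  Given the first two
    moments, the Wasserstein ball is a lower bound on [cov (q, h)], so this is
    Lagrangian duality, and [h_l] is optimal as soon as [corr (q, k_l)] matches
    the radius.

    The function [l |-> corr (q, k_l)] is non-decreasing by optimality,
    continuous because the projection is non-expansive, and tends to 1.  It is
    injective above its limit at 0: if [h_l1 = h_l2] with [l1 < l2], then the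
    residuals at [l1] and [l2] are both orthogonal to every level set of
    [k_l1], their difference is non-decreasing on each level set, and it
    therefore pairs non-negatively with the cone; this forces [h_l = h_l1] for
    all [l < l1].

    The normalisation [E gamma = 1] holds because the Stieltjes measure of an
    absolutely continuous distortion has a density, identified with [gamma] by
    Lebesgue differentiation.  The projection is the [liminf] of a minimising
    sequence: the squared distance is modular on the lattice of monotone
    functions, so running minima still minimise.  For [g = x - x^2 + x^3] and
    uniform [F] every tail covariance of [gamma] is negative, whence the
    supremum [mu] is not attained. *)
Require Import Defs.
From HB Require Import structures.
From mathcomp Require Import all_boot all_order all_algebra.
From mathcomp Require Import all_classical all_reals all_analysis.
From mathcomp Require Import measurable_realfun.
From mathcomp Require Import ring lra.
Import Order.TTheory GRing.Theory Num.Theory.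
Import numFieldNormedType.Exports.
Local Open Scope classical_set_scope.
Local Open Scope ring_scope.

Set Implicit Arguments.
Unset Strict Implicit.
Unset Printing Implicit Defensive.

(** * Square-integrable functions on (0,1) *)

(* Abstracting the integrals first keeps [lra] from comparing them up to conversion. *)
Ltac gen_lra :=
  repeat match goal with
  | |- context [covU ?f ?h] => generalize (covU f h); intro
  | |- context [stdU ?f] => generalize (stdU f); intro
  | |- context [EU ?f] => generalize (EU f); intro
  end;
  repeat match goal with
  | H : is_true _ |- _ => clear H
  | H : _ = _ |- _ => clear H
  end; lra.

(** The ray is best pictured in the plane. Let [h] run over the cone with standard deviation 1 and
    plot the points (cov (gamma, h), cov (q, h)). The duality inequality says that [stdU (k l)]
    bounds this set in the direction (1, l), and the normalised [k l] touches the bounding line at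
    (t, r), the two values of [slope_c]; so t + l r = [stdU (k l)]. Testing each of two multipliers
    l < l' at the touching point of the other gives l (r' - r) <= t - t' <= l' (r' - r). Since [eps]
    is affine in r and the value affine in t, this chain yields both the monotonicity of the
    correlation and a Lipschitz bound, proportional to the multiplier, for the supremum as a
    function of [eps]. Strict monotonicity is the hard point: an affine piece of the support
    function must be shown to extend down to 0. No formula for the projection is available there,
    only its polar inequality, which is why level sets are reached through monotone functions of
    [k l]. (A4) supplies the touching points: it makes [k l] non-constant for every positive l. *)

Section L2_theory.
Variable R : realType.
Implicit Types f h k : R -> R.
Local Notation mu := (@lebesgue_measure R).
Local Notation I01 := (@I01 R).

Definition L1 f : Prop := mu.-integrable I01 (EFin \o f).

Lemma measurable_I01 : measurable I01.
Proof. exact: measurable_itv. Qed.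
Hint Resolve measurable_I01 : core.

Lemma I01P (u : R) : I01 u <-> 0 < u < 1.
Proof. by rewrite /I01 /= in_itv. Qed.

Lemma mu_I01 : mu I01 = 1%E.
Proof. by rewrite /I01 lebesgue_measure_itv /= lte01 oppr0 adde0. Qed.

Lemma L1_cst (c : R) : L1 (fun _ => c).
Proof.
apply/integrableP; split; first exact/measurable_EFinP.
by rewrite integral_cst//= mu_I01 mule1 ltry.
Qed.

Lemma L1D f h : L1 f -> L1 h -> L1 (fun u => f u + h u).
Proof. by move=> f1 h1; have := @integrableD _ _ _ mu _ measurable_I01 _ _ f1 h1. Qed.

Lemma L1Z (a : R) f : L1 f -> L1 (fun u => a * f u).
Proof. by move=> f1; have := @integrableZl _ _ _ mu _ measurable_I01 a _ f1. Qed.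

Lemma L1_eq f h : (forall u, I01 u -> f u = h u) -> L1 f -> L1 h.
Proof.
move=> fh; apply: eq_integrable => // u; rewrite inE => uI.
by rewrite /= fh.
Qed.

Lemma L1_meas f : L1 f -> measurable_fun I01 f.
Proof. by move=> /measurable_int/measurable_EFinP. Qed.

Lemma L2_meas f : L2 f -> measurable_fun I01 f.
Proof. by case. Qed.

Lemma L1_le f h : measurable_fun I01 f -> (forall u, I01 u -> `|f u| <= h u) ->
  L1 h -> L1 f.
Proof.
move=> mf fh h1; apply: (le_integrable _ _ _ h1) => //; first exact/measurable_EFinP.
move=> u uI /=; rewrite lee_fin; apply: (le_trans (fh u uI)).
by rewrite ler_norm.
Qed.

Lemma L2_sqr f : L2 f -> L1 (fun u => f u ^+ 2).
Proof.
move=> [mf f2]; apply/integrableP; split.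
  by apply/measurable_EFinP; apply: measurable_funX.
apply: le_lt_trans f2; rewrite le_eqVlt; apply/orP; left; apply/eqP.
by apply: eq_integral => u _ /=; rewrite ger0_norm // sqr_ge0.
Qed.

Lemma L2I f : measurable_fun I01 f -> L1 (fun u => f u ^+ 2) -> L2 f.
Proof.
move=> mf /integrableP[_ f2]; split=> //; apply: le_lt_trans f2.
apply: ge0_le_integral => //.
- by move=> u _; rewrite lee_fin sqr_ge0.
- by apply/measurable_EFinP; apply: measurable_funX.
- by apply: measurableT_comp => //; apply/measurable_EFinP; apply: measurable_funX.
- by move=> u _; rewrite /= lee_fin ler_norm.
Qed.

Lemma L1_mul f h : L2 f -> L2 h -> L1 (fun u => f u * h u).
Proof.
move=> f2 h2.
apply: (@L1_le _ (fun u => f u ^+ 2 + h u ^+ 2)).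
- by apply: measurable_funM; [case: f2|case: h2].
- move=> u _; rewrite ler_norml.
  have := sqr_ge0 (f u + h u); have := sqr_ge0 (f u - h u).
  by have := sqr_ge0 (f u); have := sqr_ge0 (h u); rewrite !expr2 => *; lra.
- by apply: L1D; exact: L2_sqr.
Qed.

Lemma L2_cst (c : R) : L2 (fun _ => c).
Proof. by apply: L2I => //; exact: L1_cst. Qed.

Lemma L2_L1 f : L2 f -> L1 f.
Proof.
move=> f2; apply: L1_eq (L1_mul f2 (L2_cst 1)) => u _.
by rewrite mulr1.
Qed.

Lemma L2D f h : L2 f -> L2 h -> L2 (fun u => f u + h u).
Proof.
move=> f2 h2; apply: L2I.
  by apply: measurable_funD; exact: L2_meas.
apply: (@L1_eq (fun u => f u ^+ 2 + (2 * (f u * h u) + h u ^+ 2))).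
  by move=> u _; ring.
by apply: L1D; [exact: L2_sqr|apply: L1D; [apply: L1Z; exact: L1_mul|exact: L2_sqr]].
Qed.

Lemma L2Z (a : R) f : L2 f -> L2 (fun u => a * f u).
Proof.
move=> f2; apply: L2I.
  by apply: measurable_funM => //; exact: L2_meas.
apply: (@L1_eq (fun u => a ^+ 2 * f u ^+ 2)).
  by move=> u _; ring.
by apply: L1Z; exact: L2_sqr.
Qed.

Lemma L2_eq f h : (forall u, I01 u -> f u = h u) -> L2 f -> L2 h.
Proof.
move=> fh f2; apply: L2I.
  apply: eq_measurable_fun (L2_meas f2) => u; rewrite inE; exact: fh.
by apply: L1_eq (L2_sqr f2) => u uI; rewrite fh.
Qed.

Lemma L2B f h : L2 f -> L2 h -> L2 (fun u => f u - h u).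
Proof.
move=> f2 h2; apply: (L2_eq _ (L2D f2 (L2Z (-1) h2))) => u _.
by rewrite mulN1r.
Qed.

Lemma L2_bounded f (c : R) : measurable_fun I01 f ->
  (forall u, I01 u -> `|f u| <= c) -> L2 f.
Proof.
move=> mf fc; apply: L2I => //.
apply: (@L1_le _ (fun _ => c ^+ 2)); first exact: measurable_funX.
  move=> u uI; rewrite normrX ler_sqr ?nnegrE//; first exact: fc.
  exact: le_trans (fc u uI).
exact: L1_cst.
Qed.

Lemma EU_eq f h : (forall u, I01 u -> f u = h u) -> EU f = EU h.
Proof.
move=> fh; congr fine; apply: eq_integral => u; rewrite inE => uI.
by rewrite fh.
Qed.

Lemma EUE f : L1 f -> (\int[mu]_(u in I01) (f u)%:E)%E = (EU f)%:E.
Proof. by move=> f1; rewrite /EU fineK //; apply: integrable_fin_num. Qed.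

Lemma EUD f h : L1 f -> L1 h -> EU (fun u => f u + h u) = EU f + EU h.
Proof.
move=> f1 h1; apply: EFin_inj; rewrite EFinD -!EUE//; last exact: L1D.
by rewrite -integralD_EFin.
Qed.

Lemma EUZ (a : R) f : L1 f -> EU (fun u => a * f u) = a * EU f.
Proof.
move=> f1; apply: EFin_inj; rewrite EFinM -!EUE//; last exact: L1Z.
by rewrite -integralZl.
Qed.

Lemma EU_cst (c : R) : EU (fun _ => c) = c.
Proof.
apply: EFin_inj; rewrite -EUE; last exact: L1_cst.
by rewrite integral_cst//= mu_I01 mule1.
Qed.

Lemma EUB f h : L1 f -> L1 h -> EU (fun u => f u - h u) = EU f - EU h.
Proof.
move=> f1 h1; have -> : EU (fun u => f u - h u) = EU (fun u => f u + -1 * h u).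
  by apply: EU_eq => u _; rewrite mulN1r.
by rewrite EUD ?EUZ ?mulN1r//; exact: L1Z.
Qed.

Lemma EU_ge0 f : (forall u, I01 u -> 0 <= f u) -> 0 <= EU f.
Proof.
by move=> f0; apply: fine_ge0; apply: integral_ge0 => u uI; rewrite lee_fin f0.
Qed.

Lemma le_EU f h : L1 f -> L1 h -> (forall u, I01 u -> f u <= h u) -> EU f <= EU h.
Proof.
move=> f1 h1 fh; rewrite -subr_ge0 -EUB//.
by apply: EU_ge0 => u uI; rewrite subr_ge0 fh.
Qed.

Lemma L1B f h : L1 f -> L1 h -> L1 (fun u => f u - h u).
Proof.
move=> f1 h1; apply: (L1_eq _ (L1D f1 (L1Z (-1) h1))) => u _.
by rewrite mulN1r.
Qed.

Lemma covE f h : L2 f -> L2 h -> covU f h = EU (fun u => f u * h u) - EU f * EU h.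
Proof.
move=> f2 h2; rewrite /covU.
have -> : EU (fun u => (f u - EU f) * (h u - EU h)) =
   EU (fun u => f u * h u + (- EU h * f u + (- EU f * h u + EU f * EU h))).
  by apply: EU_eq => u _; ring.
have f1 := L2_L1 f2; have h1 := L2_L1 h2.
have L1a := L1Z (- EU h) f1; have L1b := L1Z (- EU f) h1.
have L1c := L1_cst (EU f * EU h).
rewrite EUD//; [|exact: L1_mul|by apply: L1D => //; exact: L1D].
rewrite EUD//; last exact: L1D.
by rewrite EUD// EU_cst !EUZ//; ring.
Qed.

Lemma varE f : varU f = covU f f.
Proof. by apply: EU_eq => u _; rewrite expr2. Qed.

Lemma covC f h : covU f h = covU h f.
Proof. by apply: EU_eq => u _; rewrite mulrC. Qed.

Lemma cov_eq f f' h h' : (forall u, I01 u -> f u = f' u) ->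
  (forall u, I01 u -> h u = h' u) -> covU f h = covU f' h'.
Proof.
move=> ff hh; rewrite /covU (EU_eq ff) (EU_eq hh).
by apply: EU_eq => u uI; rewrite ff // hh.
Qed.

Lemma covDl f f' h : L2 f -> L2 f' -> L2 h ->
  covU (fun u => f u + f' u) h = covU f h + covU f' h.
Proof.
move=> f2 f'2 h2; rewrite !covE//; last exact: L2D.
rewrite EUD; [|exact: L2_L1|exact: L2_L1].
rewrite (EU_eq (h := fun u => f u * h u + f' u * h u)); last by move=> u _; ring.
by rewrite EUD; [ring|exact: L1_mul|exact: L1_mul].
Qed.

Lemma covZl (a : R) f h : L2 f -> L2 h ->
  covU (fun u => a * f u) h = a * covU f h.
Proof.
move=> f2 h2; rewrite !covE//; last exact: L2Z.
rewrite EUZ; last exact: L2_L1.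
rewrite (EU_eq (h := fun u => a * (f u * h u))); last by move=> u _; ring.
by rewrite EUZ; [ring|exact: L1_mul].
Qed.

Lemma cov_cstl (c : R) h : L2 h -> covU (fun _ => c) h = 0.
Proof.
move=> h2; rewrite covE//; last exact: L2_cst.
by rewrite EU_cst EUZ ?subrr//; exact: L2_L1.
Qed.

Lemma covBl f f' h : L2 f -> L2 f' -> L2 h ->
  covU (fun u => f u - f' u) h = covU f h - covU f' h.
Proof.
move=> f2 f'2 h2.
rewrite -mulN1r -(covZl (-1) f'2 h2) -(covDl f2 (L2Z (-1) f'2) h2).
by apply: cov_eq => u _; [rewrite mulN1r|].
Qed.

Lemma covZr (a : R) f h : L2 f -> L2 h ->
  covU f (fun u => a * h u) = a * covU f h.
Proof. by move=> f2 h2; rewrite covC (covZl a h2 f2) (covC h f). Qed.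

Lemma covBr f h h' : L2 f -> L2 h -> L2 h' ->
  covU f (fun u => h u - h' u) = covU f h - covU f h'.
Proof. by move=> f2 h2 h'2; rewrite covC (covBl h2 h'2 f2) (covC h f) (covC h' f). Qed.

Lemma cov_cstr (c : R) f : L2 f -> covU f (fun _ => c) = 0.
Proof. by move=> *; rewrite covC cov_cstl. Qed.

Lemma L2_affine (a b : R) f : L2 f -> L2 (fun u => a * f u + b).
Proof. by move=> f2; apply: L2D; [exact: L2Z|exact: L2_cst]. Qed.

Lemma cov_affinel (a b : R) f h : L2 f -> L2 h ->
  covU (fun u => a * f u + b) h = a * covU f h.
Proof.
move=> f2 h2; rewrite covDl ?cov_cstl ?covZl ?addr0//; [exact: L2Z|exact: L2_cst].
Qed.

Lemma cov_affiner (a b : R) f h : L2 f -> L2 h ->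
  covU h (fun u => a * f u + b) = a * covU h f.
Proof. by move=> f2 h2; rewrite covC (cov_affinel a b f2 h2) (covC f h). Qed.

Lemma var_ge0 f : 0 <= covU f f.
Proof. by apply: EU_ge0 => u _; rewrite -expr2 sqr_ge0. Qed.

Lemma varBE f h : L2 f -> L2 h ->
  covU (fun u => f u - h u) (fun u => f u - h u) =
  covU f f - 2 * covU f h + covU h h.
Proof.
move=> f2 h2; have fh2 := L2B f2 h2.
rewrite (covBl f2 h2 fh2) (covBr f2 f2 h2) (covBr h2 f2 h2) (covC h f).
by move: (covU f f) (covU f h) (covU h h) => x y z; ring.
Qed.

Lemma cov_sqr_le f h : L2 f -> L2 h -> covU f h ^+ 2 <= covU f f * covU h h.
Proof.
move=> f2 h2; set a := covU f f; set b := covU f h; set c := covU h h.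
have quad (t : R) : 0 <= a - 2 * t * b + t ^+ 2 * c.
  have := var_ge0 (fun u => f u - t * h u).
  rewrite varBE//; last exact: L2Z.
  have th2 := L2Z t h2.
  rewrite (covZl t h2 th2) (covZr t f2 h2) (covZr t h2 h2) -/a -/b -/c.
  by congr (0 <= _); ring.
have a0 : 0 <= a by exact: var_ge0.
have c0 : 0 <= c by exact: var_ge0.
have [c00|cn0] := eqVneq c 0.
  rewrite c00 mulr0; have [->|b0] := eqVneq b 0; first by rewrite expr0n.
  (* With [c = 0] the quadratic is affine in [t], and this [t] would give it the value -1. *)
  have := quad ((a + 1) / (2 * b)); rewrite c00 mulr0 addr0.
  suff -> : 2 * ((a + 1) / (2 * b)) * b = a + 1 by lra.
  by field.
have := quad (b / c); have cp : 0 < c by rewrite lt_def cn0.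
rewrite -(pmulr_rge0 _ cp).
suff -> : c * (a - 2 * (b / c) * b + (b / c) ^+ 2 * c) = a * c - b ^+ 2.
  by rewrite subr_ge0.
by field.
Qed.

Lemma stdU_ge0 f : 0 <= stdU f.
Proof. exact: sqrtr_ge0. Qed.

Lemma sqr_stdU f : stdU f ^+ 2 = covU f f.
Proof. by rewrite /stdU sqr_sqrtr varE// var_ge0. Qed.

Lemma norm_cov_le f h : L2 f -> L2 h -> `|covU f h| <= stdU f * stdU h.
Proof.
move=> f2 h2; have := cov_sqr_le f2 h2.
rewrite -!sqr_stdU -exprMn -[X in X <= _ -> _]real_normK ?num_real//.
by rewrite ler_sqr ?nnegrE// mulr_ge0// stdU_ge0.
Qed.

Lemma cov_le f h : L2 f -> L2 h -> covU f h <= stdU f * stdU h.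
Proof. by move=> f2 h2; apply: le_trans (norm_cov_le f2 h2); exact: ler_norm. Qed.

Lemma var_eq0_cov f h : L2 f -> L2 h -> covU f f = 0 -> covU f h = 0.
Proof.
move=> f2 h2 f0; have := cov_sqr_le f2 h2; rewrite f0 mul0r => H.
by apply/eqP; rewrite -sqrf_eq0 eq_le H sqr_ge0.
Qed.

Lemma EU_sqr_decomp f : L2 f -> EU (fun u => f u ^+ 2) = covU f f + EU f ^+ 2.
Proof.
move=> f2; rewrite covE//.
rewrite (EU_eq (h := fun u => f u * f u)); last by move=> u _; rewrite expr2.
by rewrite subrK.
Qed.

Lemma EU_mul f h : L2 f -> L2 h -> EU (fun u => f u * h u) = covU f h + EU f * EU h.
Proof. by move=> f2 h2; rewrite covE// subrK. Qed.

Lemma EU_eq0_ae f : L1 f -> (forall u, I01 u -> 0 <= f u) -> EU f = 0 ->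
  {ae mu, forall u, I01 u -> f u = 0}.
Proof.
move=> f1 f0 Ef; have := EUE f1; rewrite Ef => H.
have mf : measurable_fun I01 (EFin \o f) by exact: measurable_int f1.
have : (\int[mu]_(u in I01) `|(EFin \o f) u| = 0)%E.
  rewrite -[RHS]H; apply: eq_integral => u; rewrite inE => uI.
  by rewrite gee0_abs// lee_fin f0.
move/(ae_eq_integral_abs mu measurable_I01 mf).
by apply: filterS => u H' /H' /= -[].
Qed.

End L2_theory.

(** * The cone of non-decreasing left-continuous functions *)

Section cone.
Variable R : realType.
Implicit Types f h k : R -> R.
Local Notation mu := (@lebesgue_measure R).
Local Notation I01 := (@I01 R).
Hint Resolve measurable_I01 : core.

Definition mono01 k : Prop :=
  forall x y, I01 x -> I01 y -> x <= y -> k x <= k y.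

Lemma mono01P k : mono01 k <-> {in I01 &, {homo k : x y / x <= y}}.
Proof.
split=> [kh x y|kh x y xI yI]; first by rewrite !inE; exact: kh.
by apply: kh; rewrite inE.
Qed.

Lemma K_mono k : Kcone k -> mono01 k.
Proof. by case=> _ /mono01P. Qed.

Lemma K_L2 k : Kcone k -> L2 k.
Proof. by case. Qed.

Lemma K_lc k u : Kcone k -> I01 u -> k x @[x --> u^'-] --> k u.
Proof. by case=> _ _; exact. Qed.

(** Preimages of half-lines under a monotone function are intervals. *)
Lemma mono01_meas k : mono01 k -> measurable_fun I01 k.
Proof.
move=> kh; apply: (measurability (@RGenCInfty.G R)) => [|/= _ [_] [r] -> <-].
  exact: RGenCInfty.measurableE.
apply: is_interval_measurable => s t/=.
rewrite !in_itv/= !andbT => -[sI fs] [tI ft] u /andP[su ut].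
have uI : I01 u.
  apply/I01P; move/I01P: sI => /andP[s0 _]; move/I01P: tI => /andP[_ t1].
  by rewrite (lt_le_trans s0)//= (le_lt_trans ut).
by split=> //; rewrite in_itv/= andbT (le_trans fs)// kh.
Qed.

Lemma near_left_I01 (u : R) : I01 u -> \forall v \near u^'-, I01 v /\ v < u.
Proof.
move=> /I01P/andP[u0 u1]; near=> v.
have vu : v < u by near: v; exact: nbhs_left_lt.
split=> //; apply/I01P; rewrite (lt_trans vu)// andbT.
by near: v; exact: nbhs_left_gt.
Unshelve. all: by end_near. Qed.

Lemma K_cst (c : R) : Kcone (fun _ => c).
Proof.
split; [exact: L2_cst|by move=> *|move=> u _; exact: cvg_cst].
Qed.

Lemma KD k h : Kcone k -> Kcone h -> Kcone (fun u => k u + h u).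
Proof.
move=> kK hK; split; first by apply: L2D; exact: K_L2.
- by apply/mono01P => x y xI yI xy; apply: lerD; apply: K_mono.
- by move=> u uI; apply: cvgD; exact: K_lc.
Qed.

Lemma KZ (a : R) k : 0 <= a -> Kcone k -> Kcone (fun u => a * k u).
Proof.
move=> a0 kK; split; first by apply: L2Z; exact: K_L2.
- by apply/mono01P => x y xI yI xy; apply: ler_wpM2l => //; apply: K_mono.
- by move=> u uI; apply: cvgM; [exact: cvg_cst|exact: K_lc].
Qed.

Lemma K_affine (a b : R) k : 0 <= a -> Kcone k -> Kcone (fun u => a * k u + b).
Proof. by move=> a0 kK; apply: KD; [exact: KZ|exact: K_cst]. Qed.

Lemma mono01_indic_L2 (P : R -> bool) :
  (forall x y, I01 x -> I01 y -> x <= y -> P x -> P y) ->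
  L2 (fun u => (P u)%:R) /\ mono01 (fun u => (P u)%:R).
Proof.
move=> Pm; have mP : mono01 (fun u => (P u)%:R).
  move=> x y xI yI xy; rewrite ler_nat.
  by case: (P x) (Pm _ _ xI yI xy) => // ->.
split=> //; apply: (@L2_bounded _ _ 1); first exact: mono01_meas.
by move=> u _; case: (P u); rewrite ?normr1 ?normr0.
Qed.

(** The strict inequality is what preserves left continuity. The set [c <= k u] can be closed on the
    left, so [L2_indic_ge] claims square integrability alone. *)
Lemma K_indic_gt k (c : R) : Kcone k -> Kcone (fun u => (c < k u)%R%:R).
Proof.
move=> kK; have [kL km] : L2 (fun u => (c < k u)%R%:R) /\ mono01 (fun u => (c < k u)%R%:R).
  apply: mono01_indic_L2 => x y xI yI xy ckx.
  exact: lt_le_trans ckx (K_mono kK xI yI xy).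
split=> //; first exact/mono01P.
move=> u uI; apply: cvg_near_cst; have [cku|kuc] := ltP c (k u).
- by apply: filterS (cvgr_gt _ (K_lc kK uI) _ cku) => v ->.
- apply: filterS (near_left_I01 uI) => v [vI vu].
  by rewrite ltNge (le_trans _ kuc)//; apply: K_mono => //; exact: ltW.
Qed.

Lemma L2_indic_ge k (c : R) : Kcone k -> L2 (fun u => (c <= k u)%R%:R).
Proof.
move=> kK; apply: (proj1 (mono01_indic_L2 _)) => x y xI yI xy ckx.
exact: le_trans ckx (K_mono kK xI yI xy).
Qed.

Lemma K_comp (phi : R -> R) k : {homo phi : x y / x <= y} -> continuous phi ->
  Kcone k -> L2 (phi \o k) -> Kcone (phi \o k).
Proof.
move=> ph pc kK pk; split=> //.
  by apply/mono01P => x y xI yI xy /=; apply/ph/K_mono.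
by move=> u uI; apply: (cvg_comp _ _ (K_lc kK uI)); exact: pc.
Qed.

Lemma K_id : Kcone (fun u : R => u).
Proof.
have m : mono01 (fun u : R => u) by move=> x y.
split; last 2 first.
- exact/mono01P.
- by move=> u _; exact: cvg_at_left_filter.
- apply: (@L2_bounded _ _ 1); first exact: mono01_meas.
  by move=> u /I01P/andP[u0 u1]; rewrite gtr0_norm// ltW.
Qed.

Lemma K_indic_itv (s : R) : Kcone (fun u => (s < u)%R%:R).
Proof. exact: K_indic_gt K_id. Qed.

Lemma ae_I01_imp (P Q : R -> Prop) : (forall u, I01 u -> P u -> Q u) ->
  {ae mu, forall u, I01 u -> P u} -> {ae mu, forall u, I01 u -> Q u}.
Proof.
move=> PQ [N [mN N0 PN]]; exists N; split=> // u /= NQ; apply: PN => /= NP.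
by apply: NQ => uI; apply: PQ => //; exact: NP.
Qed.

Lemma ae_I01_dense (P : R -> Prop) (a b : R) : 0 <= a -> a < b -> b <= 1 ->
  {ae mu, forall u, I01 u -> P u} -> exists v, [/\ a < v, v < b & P v].
Proof.
move=> a0 ab b1 [N [mN N0 PN]]; apply: contrapT => /forallNP H.
have : (mu `]a, b[%classic <= mu N)%E.
  apply: (@le_measure _ _ _ mu); rewrite ?inE//.
  move=> v /=; rewrite in_itv/= => /andP[av vb]; apply: PN => /= Pv.
  apply: (H v); split=> //; apply: Pv; apply/I01P.
  by rewrite (le_lt_trans a0)//= (lt_le_trans vb).
rewrite N0 lebesgue_measure_itv/= lte_fin ab -EFinB lee_fin.
by rewrite leNgt subr_gt0 ab.
Qed.

(** If [h u < k u], then [k] still exceeds [h u] just to the left of [u]; a point [v] there with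
    [k v = h v] contradicts [h v <= h u]. *)
Lemma K_ae_le k h : Kcone k -> Kcone h ->
  {ae mu, forall u, I01 u -> k u = h u} -> forall u, I01 u -> k u <= h u.
Proof.
move=> kK hK ae u uI; rewrite leNgt; apply/negP => hk.
have nk := cvgr_gt _ (K_lc kK uI) _ hk.
move/I01P: (uI) => /andP[u0 u1].
have [e /= e0 He] := nk.
have [v [av vu kv]] : exists v, [/\ Num.max 0 (u - e) < v, v < u & k v = h v].
  apply: ae_I01_dense ae; rewrite ?le_max ?lexx//; last exact: ltW.
  by rewrite gt_max u0 ltrBlDr ltrDl.
have : h u < k v.
  apply: He => //=; rewrite gtr0_norm ?subr_gt0//.
  by move: av; rewrite gt_max => /andP[_]; lra.
rewrite kv ltNge K_mono//; last exact: ltW.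
apply/I01P; rewrite (lt_trans vu)// andbT.
by move: av; rewrite gt_max => /andP[].
Qed.

Lemma K_ae_eq k h : Kcone k -> Kcone h ->
  {ae mu, forall u, I01 u -> k u = h u} -> forall u, I01 u -> k u = h u.
Proof.
move=> kK hK ae u uI; apply/eqP; rewrite eq_le !K_ae_le//.
by apply: ae_I01_imp ae => v _ ->.
Qed.

Lemma var_eq0_ae f : L2 f -> covU f f = 0 ->
  {ae mu, forall u, I01 u -> f u = EU f}.
Proof.
move=> f2; rewrite -varE => v0.
have f1 : L1 (fun u => (f u - EU f) ^+ 2).
  by apply: L2_sqr; apply: L2B => //; exact: L2_cst.
have := EU_eq0_ae f1 (fun u _ => sqr_ge0 _) v0.
apply: ae_I01_imp => u uI /eqP.
by rewrite sqrf_eq0 subr_eq0 => /eqP.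
Qed.

(** Uniqueness claims end here: a variance is shown to vanish, and left continuity upgrades almost
    everywhere equality to equality at each point. *)
Lemma K_varB_eq0 k h : Kcone k -> Kcone h ->
  covU (fun u => k u - h u) (fun u => k u - h u) = 0 ->
  forall u, I01 u -> k u - EU k = h u - EU h.
Proof.
move=> kK hK v0 u uI.
have k2 := K_L2 kK; have h2 := K_L2 hK.
have ae := var_eq0_ae (L2B k2 h2) v0.
have := @K_ae_eq (fun u => 1 * k u + 0) (fun u => 1 * h u + (EU k - EU h)).
move=> /(_ (K_affine _ ler01 kK) (K_affine _ ler01 hK)).
move=> /(_ _ u uI) H.
suff : 1 * k u + 0 = 1 * h u + (EU k - EU h) by lra.
apply: H; apply: ae_I01_imp ae => v _.
by rewrite EUB; [lra|exact: L2_L1|exact: L2_L1].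
Qed.

Lemma K_var_eq0 k : Kcone k -> covU k k = 0 -> constant01 k.
Proof.
move=> kK v0; exists (EU k) => u uI.
have := @K_varB_eq0 k (fun _ => 0) kK (K_cst 0) _ u uI.
rewrite EU_cst !subr0 => H; apply/eqP; rewrite -subr_eq0; apply/eqP/H.
by rewrite -[RHS]v0; apply: cov_eq => w _; rewrite subr0.
Qed.

Lemma const_cov0 k h : L2 h -> constant01 k -> covU k h = 0.
Proof.
move=> h2 [c kc]; rewrite -(cov_cstl c h2); exact: cov_eq.
Qed.

Lemma K_nonconst_var k : Kcone k -> ~ constant01 k <-> 0 < covU k k.
Proof.
move=> kK; split=> [nc|v0 /(@const_cov0 _ _ (K_L2 kK)) v00]; last first.
  by rewrite v00 ltxx in v0.
rewrite lt_def var_ge0 andbT; apply/eqP => v0; apply: nc; exact: K_var_eq0.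
Qed.

Lemma ge_mean_var0 h : L2 h -> (forall u, I01 u -> EU h <= h u) -> covU h h = 0.
Proof.
move=> h2 hE; have h1 := L2_L1 h2.
have hc1 : L1 (fun u => h u - EU h) by apply: L1B => //; exact: L1_cst.
have ae : {ae mu, forall u, I01 u -> h u - EU h = 0}.
  apply: EU_eq0_ae => //; first by move=> u uI; rewrite subr_ge0 hE.
  by rewrite EUB ?EU_cst ?subrr//; exact: L1_cst.
suff : (\int[mu]_(u in I01) ((h u - EU h) ^+ 2)%:E = 0)%E.
  by move=> e; rewrite -varE /varU /EU e.
transitivity (\int[mu]_(u in I01) cst 0%E u)%E; last by rewrite integral0.
apply: ae_eq_integral => //.
- exact: measurable_I01.
- apply/measurable_EFinP; apply: measurable_funX; exact: L1_meas.
- by apply: ae_I01_imp ae => u _ ->; rewrite /= expr0n.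
Qed.

Lemma le_mean_var0 h : L2 h -> (forall u, I01 u -> h u <= EU h) -> covU h h = 0.
Proof.
move=> h2 hE; have Nh2 := L2Z (-1) h2.
have := ge_mean_var0 Nh2; rewrite covZl// covZr// mulrA mulrNN !mul1r; apply.
by move=> u uI; rewrite EUZ; [rewrite !mulN1r lerN2; exact: hE|exact: L2_L1].
Qed.

(* Centring [f] at a value separating its values on [h < E h] from those on
   [E h <= h] makes the integrand of the covariance non-negative. *)
Lemma chebyshev f h : L2 f -> L2 h -> mono01 f -> mono01 h -> 0 <= covU f h.
Proof.
move=> f2 h2 fm hm.
have [[a [aI ha]]|noA] := pselect (exists a, I01 a /\ h a < EU h); last first.
  rewrite covC var_eq0_cov//; apply: ge_mean_var0 => // u uI.
  by rewrite leNgt; apply/negP => hu; apply: noA; exists u.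
have [[b [bI hb]]|noB] := pselect (exists b, I01 b /\ EU h <= h b); last first.
  rewrite covC var_eq0_cov//; apply: le_mean_var0 => // u uI.
  by rewrite leNgt; apply/negP => hu; apply: noB; exists u; split=> //; exact: ltW.
pose A := [set f u | u in [set u | I01 u /\ h u < EU h]].
have Aub x : I01 x -> EU h <= h x -> ubound A (f x).
  move=> xI hx _ [u [uI hu] <-]; apply: fm => //.
  rewrite leNgt; apply/negP => xu.
  by have := hm _ _ xI uI (ltW xu); rewrite leNgt (lt_le_trans hu).
have supA : has_sup A.
  by split; [exists (f a), a|exists (f b); exact: Aub].
have hc2 : L2 (fun u => h u - EU h) by apply: L2B => //; exact: L2_cst.
suff : 0 <= covU (fun u => f u - sup A) h.
  by rewrite covBl ?cov_cstl ?subr0//; exact: L2_cst.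
have fc2 : L2 (fun u => f u - sup A) by apply: L2B => //; exact: L2_cst.
have -> : covU (fun u => f u - sup A) h = EU (fun u => (f u - sup A) * (h u - EU h)).
  rewrite EU_mul// covBr ?cov_cstr//; [|exact: L2_cst].
  rewrite subr0 [X in _ * X]EUB; [|exact: L2_L1|exact: L1_cst].
  by rewrite EU_cst subrr mulr0 addr0.
apply: EU_ge0 => u uI; have [hu|hu] := ltP (h u) (EU h).
  rewrite mulr_le0// ?subr_le0; last exact: ltW.
  by apply: ub_le_sup; [case: supA|exists u].
by rewrite mulr_ge0 ?subr_ge0//; apply: ge_sup; [case: supA|exact: Aub].
Qed.

End cone.

(** * Existence of the isotonic projection *)

Section projection.
Variable R : realType.
Implicit Types f h k : R -> R.
Local Notation mu := (@lebesgue_measure R).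
Local Notation I01 := (@I01 R).
Hint Resolve measurable_I01 : core.

Lemma L2_sqrB f k : L2 f -> L2 k -> L1 (fun u => (f u - k u) ^+ 2).
Proof. by move=> f2 k2; apply: L2_sqr; exact: L2B. Qed.

Lemma sqdistE f k : L2 f -> L2 k -> sqdist f k = (EU (fun u => (f u - k u) ^+ 2))%:E.
Proof. by move=> f2 k2; rewrite /sqdist EUE//; exact: L2_sqrB. Qed.

(** Fatou on the squared differences. Square integrability of the limit comes out of the same bound,
    since [k] is [f] minus the square-integrable [f - k]. *)
Lemma fatou_L2 f (c : R) (k_ : nat -> R -> R) k : L2 f ->
  (forall n, L2 (k_ n)) -> (forall u, I01 u -> k_ n u @[n --> \oo] --> k u) ->
  measurable_fun I01 k ->
  (forall n, EU (fun u => (f u - k_ n u) ^+ 2) <= c) ->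
  L2 k /\ EU (fun u => (f u - k u) ^+ 2) <= c.
Proof.
move=> f2 k2 kcvg mk kc.
have mfk : measurable_fun I01 (fun u => f u - k u).
  by apply: measurable_funB => //; exact: L2_meas.
have le_c : (\int[mu]_(u in I01) ((f u - k u) ^+ 2)%:E <= c%:E)%E.
  have mfn n : measurable_fun I01 (fun u => ((f u - k_ n u) ^+ 2)%:E).
    by apply/measurable_EFinP/measurable_funX/measurable_funB; exact: L2_meas.
  have fn0 n u : I01 u -> (0 <= ((f u - k_ n u) ^+ 2)%:E)%E.
    by move=> _; rewrite lee_fin sqr_ge0.
  have F := @fatou _ _ _ mu I01 (@measurable_I01 R) _ mfn fn0.
  have -> : (\int[mu]_(u in I01) ((f u - k u) ^+ 2)%:E =
      \int[mu]_(u in I01) limn_einf (fun n => ((f u - k_ n u) ^+ 2)%:E))%E.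
    apply: eq_integral => u; rewrite inE => uI; symmetry.
    have c1 : (f u - k_ n u) @[n --> \oo] --> f u - k u.
      by apply: cvgB; [exact: cvg_cst|exact: kcvg].
    apply: (fst (cvg_limn_einf_sup _)).
    by apply: (cvg_EFin _ (cvgM c1 c1)); near=> n.
  apply: le_trans F _.
  rewrite limn_einf_lim; apply: lime_le; first exact: is_cvg_einfs.
  near=> n; apply: (@le_trans _ _ (\int[mu]_(u in I01) ((f u - k_ n u) ^+ 2)%:E)%E).
    by apply: ereal_inf_lbound; exists n => /=.
  by rewrite EUE ?lee_fin//; exact: L2_sqrB.
have fk2 : L2 (fun u => f u - k u).
  by split=> //; apply: le_lt_trans le_c _; exact: ltry.
split.
  by apply: L2_eq (L2B f2 fk2) => u _; rewrite opprB addrC subrK.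
by rewrite -lee_fin -EUE//; exact: L2_sqr.
Unshelve. all: by end_near. Qed.

(** Left continuity is left out because pointwise limits of monotone functions stay monotone but
    need not stay left-continuous; it is restored at the end by [left_reg]. *)
Definition mono_sqdist f : set R :=
  [set EU (fun u => (f u - k u) ^+ 2) | k in [set k | L2 k /\ mono01 k]].

Lemma mono_sqdist_lb f : lbound (mono_sqdist f) 0.
Proof. by move=> _ [k _ <-]; apply: EU_ge0 => u _; exact: sqr_ge0. Qed.

Lemma mono_sqdist_inf f : has_inf (mono_sqdist f).
Proof.
split; last by exists 0; exact: mono_sqdist_lb.
exists (EU (fun u => (f u - 0) ^+ 2)), (fun _ => 0) => //; split=> //.
exact: L2_cst.
Qed.

Lemma inf_le_sqdist f k : L2 k -> mono01 k ->
  inf (mono_sqdist f) <= EU (fun u => (f u - k u) ^+ 2).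
Proof. by move=> k2 km; apply: ge_inf; [case: (mono_sqdist_inf f)|exists k]. Qed.

Lemma mono_min k h : mono01 k -> mono01 h -> mono01 (fun u => Num.min (k u) (h u)).
Proof.
move=> km hm x y xI yI xy; rewrite le_min !ge_min km//= hm// orbT//.
Qed.

Lemma mono_max k h : mono01 k -> mono01 h -> mono01 (fun u => Num.max (k u) (h u)).
Proof.
move=> km hm x y xI yI xy; rewrite ge_max !le_max km//= hm// orbT//.
Qed.

Lemma L2_norm_le k f h : L2 f -> L2 h -> measurable_fun I01 k ->
  (forall u, I01 u -> `|k u| <= `|f u| + `|h u|) -> L2 k.
Proof.
move=> f2 h2 mk kfh; apply: L2I => //.
apply: (@L1_le _ _ (fun u => 2 * f u ^+ 2 + 2 * h u ^+ 2)).
- exact: measurable_funX.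
- move=> u uI; have := kfh u uI.
  rewrite normrX -[f u ^+ 2]real_normK ?num_real// -[h u ^+ 2]real_normK ?num_real//.
  move: `|k u| `|f u| `|h u| (normr_ge0 (k u)) => a b c a0 abc.
  apply: (@le_trans _ _ ((b + c) ^+ 2)).
    by rewrite ler_sqr ?nnegrE// (le_trans a0).
  by have := sqr_ge0 (b - c); rewrite !expr2; lra.
- by apply: L1D; apply: L1Z; exact: L2_sqr.
Qed.

Lemma L2_min k h : L2 k -> L2 h -> L2 (fun u => Num.min (k u) (h u)).
Proof.
move=> k2 h2; apply: (L2_norm_le k2 h2).
  by apply: measurable_minr; exact: L2_meas.
by move=> u _; have := normr_ge0 (k u); have := normr_ge0 (h u); case: (leP (k u) (h u)) => _; lra.
Qed.

Lemma L2_max k h : L2 k -> L2 h -> L2 (fun u => Num.max (k u) (h u)).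
Proof.
move=> k2 h2; apply: (L2_norm_le k2 h2).
  by apply: measurable_maxr; exact: L2_meas.
by move=> u _; have := normr_ge0 (k u); have := normr_ge0 (h u); case: (leP (k u) (h u)) => _; lra.
Qed.

(** Pointwise, the minimum and the maximum are [k] and [h] in some order, so both pairs have the
    same total distance; the maximum costs at least the infimum. *)
Lemma sqdist_min_le f k h : L2 f -> L2 k -> L2 h -> mono01 k -> mono01 h ->
  EU (fun u => (f u - Num.min (k u) (h u)) ^+ 2) <=
  EU (fun u => (f u - k u) ^+ 2) + EU (fun u => (f u - h u) ^+ 2) -
  inf (mono_sqdist f).
Proof.
move=> f2 k2 h2 km hm; rewrite lerBrDr.
apply: (@le_trans _ _ (EU (fun u => (f u - Num.min (k u) (h u)) ^+ 2) +
   EU (fun u => (f u - Num.max (k u) (h u)) ^+ 2))).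
  by rewrite lerD2l; apply: inf_le_sqdist; [exact: L2_max|exact: mono_max].
have mi2 := L2_min k2 h2; have ma2 := L2_max k2 h2.
rewrite -!EUD; [|exact: L2_sqrB|exact: L2_sqrB|exact: L2_sqrB|exact: L2_sqrB].
apply: le_EU; [by apply: L1D; exact: L2_sqrB|by apply: L1D; exact: L2_sqrB|].
by move=> u _; case: (leP (k u) (h u)) => _; lra.
Qed.

Lemma EU_indic_itv (u : R) : I01 u -> EU (fun v => (u < v)%R%:R) = 1 - u.
Proof.
move=> /I01P/andP[u0 u1].
rewrite /EU (_ : (fun v => _) = EFin \o \1_(`]u, +oo[%classic)); last first.
  by apply/funext => v; rewrite /= indicE /= mem_setE in_itv/= andbT.
transitivity (fine (1 - u)%:E) => //; congr fine.
rewrite integral_indic; [|exact: measurable_I01|exact: measurable_itv].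
have -> : `]u, +oo[%classic `&` I01 = `]u, 1[%classic.
  apply/seteqP; split=> v /=; rewrite /I01/= !in_itv/= ?andbT.
    by move=> [-> /andP[_ ->]].
  by move=> /andP[uv ->]; rewrite uv (lt_trans u0).
by rewrite [LHS]lebesgue_measure_itv/= lte_fin u1.
Qed.

(** A monotone [k] satisfies [k v ^+ 2 >= k u ^+ 2] on []u, 1[] if [k u >= 0] and on []0, u]] if
    [k u < 0], so [Num.min u (1 - u) * k u ^+ 2 <= c]. Pointwise limits along a minimising sequence
    are therefore finite. *)
Lemma mono_bound (c u : R) : 0 <= c -> I01 u -> exists C : R, forall k, L2 k -> mono01 k ->
  EU (fun u => k u ^+ 2) <= c -> `|k u| <= C.
Proof.
move=> c0 uI; move/I01P: (uI) => /andP[u0 u1].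
pose a := Num.min u (1 - u).
have a0 : 0 < a by rewrite lt_min u0 subr_gt0.
(* The bound [c / a + 1] avoids a square root, by [x <= x ^+ 2 + 1]. *)
exists (c / a + 1) => k k2 km kc.
have indic (P : R -> bool) : (forall v, I01 v -> P v -> k u ^+ 2 <= k v ^+ 2) ->
   L2 (fun v => (P v)%:R) -> EU (fun v => (P v)%:R) * k u ^+ 2 <= c.
  move=> Pk P2; apply: le_trans kc; rewrite mulrC -EUZ; last exact: L2_L1.
  apply: le_EU; [by apply: L1Z; exact: L2_L1|exact: L2_sqr|move=> v vI].
  by case: (boolP (P v)) => [Pv|_]; rewrite ?mulr1 ?mulr0 ?sqr_ge0// Pk.
have sq : a * k u ^+ 2 <= c.
  have EUitv := EU_indic_itv uI.
  have I2 : L2 (fun v => (u < v)%R%:R) := K_L2 (K_indic_itv u).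
  have [ku0|ku0] := leP 0 (k u).
    have H := indic (fun v => (u < v)%R) _ I2; rewrite EUitv in H.
    apply: le_trans (H _).
      by apply: ler_wpM2r; rewrite ?sqr_ge0// ge_min lexx orbT.
    move=> v vI uv; have kuv := km _ _ uI vI (ltW uv).
    by rewrite ler_sqr ?nnegrE// (le_trans ku0).
  have EUitv' : EU (fun v => (v <= u)%R%:R) = u.
    transitivity (EU (fun v => 1 - (u < v)%R%:R)).
      by apply: EU_eq => v _; case: ltP => _; rewrite ?subr0 ?subrr.
    rewrite EUB; [|exact: L1_cst|exact: L2_L1].
    by rewrite EU_cst EUitv subKr.
  have I2' : L2 (fun v => (v <= u)%R%:R).
    apply: L2_eq (L2B (L2_cst 1) I2) => v _.
    by case: ltP => _; rewrite ?subr0 ?subrr.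
  have H := indic (fun v => (v <= u)%R) _ I2'; rewrite EUitv' in H.
  apply: le_trans (H _).
    by apply: ler_wpM2r; rewrite ?sqr_ge0// ge_min lexx.
  move=> v vI vu; have kvu := km _ _ vI uI vu.
  by rewrite -[k u ^+ 2]sqrrN -[k v ^+ 2]sqrrN ler_sqr ?nnegrE; lra.
have : k u ^+ 2 <= c / a by rewrite ler_pdivlMr// mulrC.
rewrite -[X in X <= _]real_normK ?num_real//.
have := normr_ge0 (k u); move: `|k u| => x x0 xc.
have := sqr_ge0 (x - 1); rewrite !expr2 in xc *; lra.
Qed.

End projection.

(** * Running minima of a minimising sequence and left regularisation of the limit *)

Section minimiser.
Variable R : realType.
Implicit Types f h k : R -> R.
Local Notation mu := (@lebesgue_measure R).
Local Notation I01 := (@I01 R).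
Hint Resolve measurable_I01 : core.

(** As [N] grows this decreases to the infimum of the tail starting at [n]; as [n] grows those
    infima increase to the liminf. *)
Fixpoint run_min (k_ : nat -> R -> R) (n N : nat) (u : R) : R :=
  if N is N'.+1 then Num.min (run_min k_ n N' u) (k_ (n + N)%N u) else k_ n u.

Lemma run_min_L2 (k_ : nat -> R -> R) n N : (forall n, L2 (k_ n)) -> L2 (run_min k_ n N).
Proof. by move=> k2; elim: N => [|N IH] /=; [exact: k2|exact: L2_min]. Qed.

Lemma run_min_mono (k_ : nat -> R -> R) n N : (forall n, mono01 (k_ n)) -> mono01 (run_min k_ n N).
Proof. by move=> km; elim: N => [|N IH] /=; [exact: km|exact: mono_min]. Qed.

Lemma run_min_S (k_ : nat -> R -> R) n N u : run_min k_ n N.+1 u <= run_min k_ n.+1 N u.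
Proof.
elim: N => [|N IH]; first by rewrite /= addn1 ge_min lexx orbT.
rewrite [X in _ <= X]/= le_min; apply/andP; split.
  by apply: le_trans IH; rewrite [X in X <= _]/= ge_min lexx.
by rewrite /= addSnnS ge_min lexx orbT.
Qed.

Lemma pow2V_gt0 n : 0 < (2 ^- n : R).
Proof. by rewrite invr_gt0 exprn_gt0. Qed.

Lemma pow2V_S n : 2 ^- n.+1 = 2 ^- n / 2 :> R.
Proof. by rewrite exprSr invfM. Qed.

(** Each further function adds at most its own excess over the infimum, here half of the previous
    one. Keeping the exact remainder [- 2 ^- (n + N)] of the geometric sum is what closes the
    induction. *)
Lemma run_min_sqdist f (k_ : nat -> R -> R) n N : L2 f ->
  (forall n, [/\ L2 (k_ n), mono01 (k_ n) &
    EU (fun u => (f u - k_ n u) ^+ 2) <= inf (mono_sqdist f) + 2 ^- n]) ->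
  EU (fun u => (f u - run_min k_ n N u) ^+ 2) <=
    inf (mono_sqdist f) + 2 * 2 ^- n - 2 ^- (n + N).
Proof.
move=> f2 Hk; elim: N => [|N IH].
  by case: (Hk n) => _ _ /=; rewrite addn0; lra.
have [k2 km kd] := Hk (n + N.+1)%N.
have := @sqdist_min_le R f (run_min k_ n N) (k_ (n + N.+1)%N).
have r2 : L2 (run_min k_ n N) by apply: run_min_L2 => i; case: (Hk i).
have rm : mono01 (run_min k_ n N) by apply: run_min_mono => i; case: (Hk i).
move=> /(_ f2 r2 k2 rm km) /= H; apply: le_trans H _.
by move: kd; rewrite addnS pow2V_S; lra.
Qed.

Lemma sqr_le_sqdist f k : L2 f -> L2 k -> EU (fun u => k u ^+ 2) <=
  2 * EU (fun u => (f u - k u) ^+ 2) + 2 * EU (fun u => f u ^+ 2).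
Proof.
move=> f2 k2; have fk := L2_sqrB f2 k2; have ff := L2_sqr f2.
rewrite -!EUZ// -EUD; [|exact: L1Z|exact: L1Z].
apply: le_EU; [exact: L2_sqr|by apply: L1D; exact: L1Z|move=> u _].
by have := sqr_ge0 (2 * f u - k u); rewrite !expr2; lra.
Qed.

Lemma pow2V_small (e : R) : 0 < e -> exists n, (2 * 2 ^- n : R) <= e.
Proof.
move=> e0; exists (Num.truncn (2 / e)).+1.
rewrite ler_pdivrMr ?exprn_gt0// mulrC -ler_pdivrMr//.
have /ltW H : 2 / e < (Num.truncn (2 / e)).+1%:R by rewrite truncnS_gt.
apply: (le_trans H); rewrite -natrX ler_nat.
by apply: ltnW; exact: ltn_expl.
Qed.

Lemma mono_minimiser f : L2 f ->
  exists k, [/\ L2 k, mono01 k &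
    EU (fun u => (f u - k u) ^+ 2) <= inf (mono_sqdist f)].
Proof.
move=> f2; set m := inf _.
have ex n : exists k, [/\ L2 k, mono01 k &
    EU (fun u => (f u - k u) ^+ 2) <= m + 2 ^- n].
  have [_ [k [k2 km] <-] kd] := inf_adherent (pow2V_gt0 n) (mono_sqdist_inf f).
  by exists k; split=> //; exact: ltW.
have [k_ Hk] := choice ex.
pose r := run_min k_.
have r2 n N : L2 (r n N) by apply: run_min_L2 => i; case: (Hk i).
have rm n N : mono01 (r n N) by apply: run_min_mono => i; case: (Hk i).
have rd n N : EU (fun u => (f u - r n N u) ^+ 2) <= m + 2 * 2 ^- n.
  apply: le_trans (run_min_sqdist n N f2 Hk) _.
  by have := pow2V_gt0 (n + N); rewrite -/m; lra.
have m0 : 0 <= m by apply: lb_le_inf; [case: (mono_sqdist_inf f)|exact: mono_sqdist_lb].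
have rb u : I01 u -> exists C, forall n N, `|r n N u| <= C.
  (* The bound on [EU (k ^+ 2)] from [sqr_le_sqdist], with the excess [2 * 2 ^- n] replaced by its
     largest value 2. *)
  move=> uI; pose c := 2 * (m + 2) + 2 * EU (fun u => f u ^+ 2).
  have Ef0 : 0 <= EU (fun u => f u ^+ 2) by apply: EU_ge0 => v _; exact: sqr_ge0.
  have c0 : 0 <= c by rewrite /c; lra.
  have [C HC] := mono_bound c0 uI; exists C => n N; apply: HC => //.
  apply: le_trans (sqr_le_sqdist f2 (r2 n N)) _.
  have := rd n N; have : 2 ^- n <= 1 :> R by rewrite invf_le1 ?exprn_gt0// exprn_ege1// ler1n.
  by rewrite /c; lra.
pose p n u := inf (range (fun N => r n N u)).
have rlb n u : I01 u -> has_lbound (range (fun N => r n N u)).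
  move=> uI; have [C HC] := rb u uI; exists (- C) => _ [N _ <-].
  by have := HC n N; rewrite ler_norml => /andP[].
have ple n N u : I01 u -> p n u <= r n N u.
  by move=> uI; apply: ge_inf; [exact: rlb|exists N].
have lep n u c : (forall N, c <= r n N u) -> c <= p n u.
  by move=> H; apply: lb_le_inf; [exists (r n 0%N u), 0%N|move=> _ [N _ <-]].
have pcvg n u : I01 u -> r n N u @[N --> \oo] --> p n u.
  move=> uI; apply: nonincreasing_cvgn; last exact: rlb.
  apply/nonincreasing_seqP => N; by rewrite /r/= ge_min lexx.
have pm n : mono01 (p n).
  by move=> x y xI yI xy; apply: lep => N; apply: le_trans (ple n N x xI) _; exact: rm.
have pP n : L2 (p n) /\ EU (fun u => (f u - p n u) ^+ 2) <= m + 2 * 2 ^- n.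
  apply: (@fatou_L2 R f _ (r n)) => //; [exact: pcvg|exact: mono01_meas].
have pS u : I01 u -> {homo p^~ u : i j / (i <= j)%N >-> i <= j}.
  move=> uI; apply/nondecreasing_seqP => n; apply: lep => N.
  exact: le_trans (ple n N.+1 u uI) (run_min_S _ _ _ _).
have pub u : I01 u -> has_ubound (range (p^~ u)).
  move=> uI; have [C HC] := rb u uI; exists C => _ [n _ <-].
  apply: le_trans (ple n 0%N u uI) _.
  by have := HC n 0%N; rewrite ler_norml => /andP[].
pose k u := sup (range (p^~ u)).
have kcvg u : I01 u -> p n u @[n --> \oo] --> k u.
  by move=> uI; apply: nondecreasing_cvgn; [exact: pS|exact: pub].
have km : mono01 k.
  move=> x y xI yI xy; apply: ge_sup; first by exists (p 0%N x), 0%N.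
  move=> _ [n _ <-]; apply: (@le_trans _ _ (p n y)); first exact: pm.
  by apply: ub_le_sup; [exact: pub|exists n].
have kP n : L2 k /\ EU (fun u => (f u - k u) ^+ 2) <= m + 2 * 2 ^- n.
  (* Shifting by [n] puts the whole sequence within [2 * 2 ^- n] of the infimum without changing its
     limit, so the bound holds for every [n]. *)
  apply: (@fatou_L2 R f _ (fun j => p (j + n)%N)) => //.
  - by move=> j; case: (pP (j + n)%N).
  - by move=> u uI; rewrite (cvg_shiftn n (p^~ u)); exact: kcvg.
  - exact: mono01_meas.
  - move=> j; case: (pP (j + n)%N) => _ H; apply: le_trans H _.
    rewrite lerD2l ler_pM2l// lef_pV2 ?posrE ?exprn_gt0//.
    by rewrite ler_eXn2l ?ltr1n// leq_addl.
exists k; split=> //; first by case: (kP 0%N).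
apply/ler_addgt0Pr => e e0; have [n ne] := pow2V_small e0.
by case: (kP n) => _ H; apply: le_trans H _; rewrite lerD2l.
Qed.

Definition left_reg k (u : R) : R := sup [set k v | v in [set v | 0 < v /\ v < u]].

Lemma left_regularisation k : L2 k -> mono01 k ->
  Kcone (left_reg k) /\ {ae mu, forall u, I01 u -> k u = left_reg k u}.
Proof.
move=> k2 km; set k' := left_reg k.
have I01lt (v u : R) : I01 u -> 0 < v -> v < u -> I01 v.
  by move=> /I01P/andP[_ u1] v0 vu; apply/I01P; rewrite v0 (lt_trans vu).
have ubk u : I01 u -> ubound [set k v | v in [set v | 0 < v /\ v < u]] (k u).
  move=> uI _ [v [v0 vu] <-]; apply: km => //; last exact: ltW.
  exact: I01lt vu.
have ne u : I01 u -> [set k v | v in [set v | 0 < v /\ v < u]] !=set0.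
  move=> /I01P/andP[u0 _]; exists (k (u / 2)), (u / 2) => //=; split; lra.
have le1 u v : I01 u -> 0 < v -> v < u -> k v <= k' u.
  by move=> uI v0 vu; apply: ub_le_sup; [exists (k u); exact: ubk|exists v].
have le2 u : I01 u -> k' u <= k u.
  by move=> uI; apply: ge_sup; [exact: ne|exact: ubk].
have k'm : mono01 k'.
  move=> x y xI yI xy; apply: ge_sup; first exact: ne.
  by move=> _ [v [v0 vx] <-]; apply: le1 => //; exact: lt_le_trans xy.
pose D := [set u | I01 u /\ k' u < k u].
have cD : countable D.
  (* The gaps between [k' u] and [k u] at distinct discontinuities are disjoint, so a rational
     chosen in each one enumerates [D]. *)
  have ex u : exists q : rat, D u -> k' u < ratr q < k u.
    have [[uI Du]|nD] := pselect (D u); last by exists 0.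
    have [q] := rat_in_itvoo Du; rewrite in_itv/= => H.
    by exists q => _.
  have [q Hq] := choice ex.
  apply/countable_injP; exists (pickle \o q) => x y; rewrite !inE => Dx Dy.
  move=> /= /(pcan_inj (@pickleK _)) qxy.
  have [xI _] := Dx; have [yI _] := Dy.
  move: (Hq x Dx) (Hq y Dy); rewrite qxy => /andP[x1 x2] /andP[y1 y2].
  have [/I01P/andP[x0 _] /I01P/andP[y0 _]] := (xI, yI).
  have [xy|yx|//] := ltgtP x y.
    by have := le1 _ _ yI x0 xy; rewrite leNgt (lt_trans y1 x2).
  by have := le1 _ _ xI y0 yx; rewrite leNgt (lt_trans x1 y2).
have ae : {ae mu, forall u, I01 u -> k u = k' u}.
  have D0 : mu D = 0%E by exact: countable_lebesgue_measure0.
  exists D; split=> //.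
    exact: countable_measurable.
  move=> u /= H; apply: contrapT => nD; apply: H => uI.
  apply/eqP; rewrite eq_le le2// andbT leNgt; apply/negP => kk; exact: nD.
split=> //; split.
- have mk' := mono01_meas k'm.
  split=> //; case: k2 => mk; congr (_ < _)%E.
  apply: (@ae_eq_integral _ _ _ mu); [exact: measurable_I01|..].
  + by apply/measurable_EFinP/measurable_funX.
  + by apply/measurable_EFinP/measurable_funX.
  + by apply: ae_I01_imp ae => u _ /= ->.
- exact/mono01P.
- move=> u uI; apply/cvgrPdist_lt => e e0.
  have := sup_adherent e0 (conj (ne u uI) (ex_intro _ _ (ubk u uI))).
  move=> [_ [v [v0 vu] <-] kv].
  near=> w.
  have vw : v < w by near: w; exact: nbhs_left_gt.
  have [wI wu] : I01 w /\ w < u by near: w; exact: near_left_I01.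
  rewrite ger0_norm ?subr_ge0; last by apply: k'm => //; exact: ltW.
  by have := le1 _ _ wI v0 vw; rewrite -/(left_reg k u) -/k' in kv *; lra.
Unshelve. all: by end_near. Qed.

(** The left regularisation of a minimiser among all monotone functions agrees with it almost
    everywhere, so it has the same distance and lies in the cone. *)
Lemma isoproj_exists f : L2 f -> exists k, isoproj f k.
Proof.
move=> f2; have [k [k2 km kmin]] := mono_minimiser f2.
have [kK ae] := left_regularisation k2 km.
exists (left_reg k); split=> // h hK.
have h2 := K_L2 hK; have k'2 := K_L2 kK.
have -> : sqdist f (left_reg k) = sqdist f k.
  apply: (@ae_eq_integral _ _ _ mu); [exact: measurable_I01|..].
  + by apply/measurable_EFinP/measurable_funX/measurable_funB; exact: L2_meas.
  + by apply/measurable_EFinP/measurable_funX/measurable_funB; exact: L2_meas.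
  + by apply: ae_I01_imp ae => u _ /= ->.
rewrite !sqdistE// lee_fin; apply: le_trans kmin _.
by apply: inf_le_sqdist => //; exact: K_mono.
Qed.

End minimiser.

(** * Variational characterisation of the projection *)

Section variational.
Local Opaque covU EU.
Variable R : realType.
Implicit Types f h k w d : R -> R.
Local Notation mu := (@lebesgue_measure R).
Local Notation I01 := (@I01 R).
Hint Resolve measurable_I01 : core.

(** First-order optimality: expanding the square along [k + t d] gives [2 * e <= t * D] for every
    admissible [t]. The range [t < 1] leaves room for the direction [- k]. *)
Lemma isoproj_direction f k d : L2 f -> isoproj f k -> L2 d ->
  (forall t, 0 < t < 1 -> Kcone (fun u => k u + t * d u)) ->
  EU (fun u => (f u - k u) * d u) <= 0.
Proof.
move=> f2 [kK kmin] d2 Kt; have k2 := K_L2 kK.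
have fk2 := L2B f2 k2.
set e := EU _; set D := EU (fun u => d u ^+ 2).
have D0 : 0 <= D by apply: EU_ge0 => u _; exact: sqr_ge0.
have key t : 0 < t < 1 -> 2 * e <= t * D.
  move=> t01; have /andP[t0 _] := t01.
  have := kmin _ (Kt t t01).
  rewrite !sqdistE ?lee_fin//; last by apply: K_L2; exact: Kt.
  rewrite [X in _ <= X](@EU_eq _ _ (fun u => (f u - k u) ^+ 2 +
     (- (2 * t) * ((f u - k u) * d u) + t ^+ 2 * d u ^+ 2))); last by move=> u _; ring.
  have a1 := L2_sqr fk2; have a2 := L1_mul fk2 d2; have a3 := L2_sqr d2.
  rewrite EUD//; last by apply: L1D; exact: L1Z.
  rewrite EUD; [|exact: L1Z|exact: L1Z].
  rewrite !EUZ// -/e -/D -lerBlDl subrr => H.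
  have : 0 <= t * (t * D - 2 * e) by move: H; rewrite expr2; congr (_ <= _); ring.
  by rewrite pmulr_rge0// subr_ge0.
rewrite leNgt; apply/negP => e0.
(* If [e > 0], this [t] makes [t * D <= e], against [2 * e <= t * D]. *)
have t01 : 0 < e / (e + D + 1) < 1.
  by rewrite divr_gt0 ?ltr_pdivrMr; lra.
have := key _ t01; have t0 := t01; case/andP: t0 => t0 t1.
have -> : e / (e + D + 1) * D = e * (D / (e + D + 1)) by ring.
have : D / (e + D + 1) <= 1 by rewrite ler_pdivrMr; lra.
move=> /(ler_wpM2l (ltW e0)); lra.
Qed.

Lemma isoproj_mean f k : L2 f -> isoproj f k -> EU k = EU f.
Proof.
move=> f2 pk; have kK := proj1 pk; have k2 := K_L2 kK.
have H c : EU (fun u => (f u - k u) * c) = c * (EU f - EU k).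
  rewrite -EUB; [|exact: L2_L1|exact: L2_L1].
  rewrite -EUZ; last by apply: L2_L1; exact: L2B.
  by apply: EU_eq => u _; rewrite mulrC.
have Kc c t : Kcone (fun u => k u + t * c) by apply: KD => //; exact: K_cst.
have := isoproj_direction f2 pk (L2_cst 1) (fun t _ => Kc 1 t).
have := isoproj_direction f2 pk (L2_cst (-1)) (fun t _ => Kc (-1) t).
by rewrite !H; lra.
Qed.

Lemma isoproj_EU f k h : L2 f -> isoproj f k -> L2 h ->
  EU (fun u => (f u - k u) * h u) = covU f h - covU k h.
Proof.
move=> f2 pk h2; have k2 := K_L2 (proj1 pk).
rewrite EU_mul//; last exact: L2B.
rewrite EUB; [|exact: L2_L1|exact: L2_L1].
by rewrite (isoproj_mean f2 pk) subrr mul0r addr0 covBl.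
Qed.

Lemma isoproj_le f k h : L2 f -> isoproj f k -> Kcone h -> covU f h <= covU k h.
Proof.
move=> f2 pk hK; have h2 := K_L2 hK.
rewrite -subr_le0 -isoproj_EU//; apply: isoproj_direction => // t /andP[t0 _].
by apply: KD; [case: pk|apply: KZ => //; exact: ltW].
Qed.

Lemma isoproj_self f k : L2 f -> isoproj f k -> covU f k = covU k k.
Proof.
move=> f2 pk; have kK := proj1 pk; have k2 := K_L2 kK.
apply/eqP; rewrite eq_le (isoproj_le f2 pk kK) -subr_le0 /=.
(* Moving towards 0 stays in the cone because [(1 - t) * k] has a non-negative factor; the two
   opposite directions give equality. *)
have : EU (fun u => (f u - k u) * (-1 * k u)) <= 0.
  apply: isoproj_direction => //; first exact: L2Z.
  move=> t /andP[t0 t1].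
  have -> : (fun u => k u + t * (-1 * k u)) = (fun u => (1 - t) * k u).
    by apply/funext => u; ring.
  by apply: KZ => //; lra.
rewrite (isoproj_EU f2 pk (L2Z _ k2)) (covZr _ f2 k2) (covZr _ k2 k2).
by gen_lra.
Qed.

(** Var (k - p) splits into cov (k, k) - cov (p, k) and cov (p, p) - cov (k, p). Each is
    non-positive, since [covU k k = covU f k] and [covU p p = covU f p]. *)
Lemma isoproj_unique f k p : L2 f -> isoproj f k -> Kcone p ->
  (forall h, Kcone h -> covU f h <= covU p h) -> covU f p = covU p p ->
  covU (fun u => k u - p u) (fun u => k u - p u) = 0.
Proof.
move=> f2 pk pK ple pself; have kK := proj1 pk.
have k2 := K_L2 kK; have p2 := K_L2 pK.
have := var_ge0 (fun u => k u - p u); rewrite (varBE k2 p2).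
have := ple _ kK; have := isoproj_le f2 pk pK; have := isoproj_self f2 pk.
by rewrite (covC p k) pself; gen_lra.
Qed.

Lemma isoproj_const f k : L2 f -> isoproj f k -> constant01 k ->
  forall h, Kcone h -> covU f h <= 0.
Proof.
move=> f2 pk kc h hK; apply: le_trans (isoproj_le f2 pk hK) _.
by rewrite const_cov0//; exact: K_L2.
Qed.

Lemma isoproj_nonconst f k h : L2 f -> isoproj f k -> Kcone h -> 0 < covU f h ->
  ~ constant01 k.
Proof.
by move=> f2 pk hK fh kc; have := isoproj_const f2 pk kc hK; rewrite leNgt fh.
Qed.

Lemma cov_centred d h : L2 d -> L2 h -> covU d h = EU (fun u => (d u - EU d) * h u).
Proof.
move=> d2 h2; have dc : L2 (fun u => d u - EU d) by apply: L2B => //; exact: L2_cst.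
rewrite EU_mul// covBl ?cov_cstl//; last exact: L2_cst.
rewrite EUB ?EU_cst; [|exact: L2_L1|exact: L1_cst].
by rewrite subrr mul0r addr0 subr0.
Qed.

Lemma covU_dominated d (h_ : nat -> R -> R) h : L2 d ->
  (forall n, L2 (h_ n)) -> L2 h -> (forall n u, I01 u -> `|h_ n u| <= 1) ->
  (forall u, I01 u -> h_ n u @[n --> \oo] --> h u) ->
  (forall n, covU d (h_ n) = 0) -> covU d h = 0.
Proof.
move=> d2 hn2 h2 hn1 hcvg dn0; have d1 := L2_L1 d2.
have hd : L2 (fun u => d u - EU d) by apply: L2B => //; exact: L2_cst.
pose F n u := ((d u - EU d) * h_ n u)%:E; pose G u := ((d u - EU d) * h u)%:E.
have mF n : measurable_fun I01 (F n).
  by apply/measurable_EFinP/measurable_funM; exact: L2_meas.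
have mG : measurable_fun I01 G.
  by apply/measurable_EFinP/measurable_funM; exact: L2_meas.
have FG : {ae mu, forall u, I01 u -> F n u @[n --> \oo] --> G u}.
  apply: aeW => u uI; apply: cvg_EFin; first by near=> n.
  by apply: cvgM; [exact: cvg_cst|exact: hcvg].
have iH := integrable_norm (L2_L1 hd).
have FH : {ae mu, forall u n, I01 u -> (`|F n u| <= `|d u - EU d|%:E)%E}.
  apply: aeW => u n uI; rewrite /F /= lee_fin normrM.
  by rewrite ler_piMr// hn1.
have [_ _ H] := @dominated_convergence _ _ _ mu I01 (@measurable_I01 R) _ _ _ mF mG FG iH FH.
have Fn0 : ([sequence (\int[mu]_(x in I01) F n x)]_n = cst 0)%E.
  by apply/funext => n /=; rewrite /F EUE -?cov_centred ?dn0//; exact: L1_mul.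
rewrite Fn0 in H; have L := cvg_lim (@ereal_hausdorff R) H.
rewrite lim_cst in L; last exact: ereal_hausdorff.
move: L; rewrite /G EUE; last exact: L1_mul.
by rewrite -cov_centred// => /(_ _)[<-].
Unshelve. all: by end_near. Qed.

(** * Level sets and the polar cone *)

(** A stand-in for the indicator of a half-line. It is continuous and non-decreasing for [a > 0],
    and its slope is at most [a], so subtracting [ramp / a] from the identity also leaves a
    non-decreasing function. *)
Definition ramp (a b x : R) : R := Num.min 1 (Num.max 0 (a * x + b)).

Lemma ramp01 a b x : 0 <= ramp a b x <= 1.
Proof. by rewrite /ramp le_min ler01 le_max lexx ge_min lexx. Qed.

Lemma ramp_norm a b x : `|ramp a b x| <= 1.
Proof. by have /andP[r0 r1] := ramp01 a b x; rewrite ger0_norm. Qed.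

Lemma ramp_homo a b : 0 < a -> {homo ramp a b : x y / x <= y}.
Proof.
move=> a0 x y xy; rewrite /ramp le_min ge_min lexx/= ge_min ge_max !le_max lexx/=.
by rewrite lerD2r ler_pM2l// xy !orbT.
Qed.

Lemma ramp_lip a b : 0 < a -> {homo (fun x => x - a^-1 * ramp a b x) : x y / x <= y}.
Proof.
move=> a0 x y xy; have axy : a * x <= a * y by rewrite ler_pM2l.
suff : ramp a b y - ramp a b x <= a * (y - x).
  rewrite -ler_pdivrMl// => H; have := H; rewrite mulrBr; lra.
rewrite mulrBr /ramp; move: (a * x) (a * y) axy => X Y XY.
have clampP (z : R) : let v := Num.min 1 (Num.max 0 z) in
    [\/ z <= 0 /\ v = 0, 0 <= z <= 1 /\ v = z | 1 <= z /\ v = 1].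
  case: (leP 0 z) => z0 /=; last by constructor 1; split; [exact: ltW|exact: min_r].
  by case: (leP 1 z) => z1; [constructor 3|constructor 2; split=> //; lra].
by case: (clampP (X + b)) => -[X1 ->]; case: (clampP (Y + b)) => -[Y1 ->]; lra.
Qed.

Lemma ramp_continuous a b : continuous (ramp a b).
Proof.
move=> x; apply: (@continuous_min R R (fun _ => 1) (fun y => Num.max 0 (a * y + b))).
  exact: cvg_cst.
apply: (@continuous_max R R (fun _ => 0) (fun y => a * y + b)); first exact: cvg_cst.
by apply: cvgD; [apply: cvgM; [exact: cvg_cst|exact: cvg_id]|exact: cvg_cst].
Qed.

Lemma K_ramp a b h : 0 < a -> Kcone h -> Kcone (ramp a b \o h).
Proof.
move=> a0 hK; apply: K_comp => //; [exact: ramp_homo|exact: ramp_continuous|].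
apply: (@L2_bounded _ _ 1); last by move=> u _; exact: ramp_norm.
apply: mono01_meas => x y xI yI xy; apply: ramp_homo => //; exact: K_mono.
Qed.

(* Both [ramp \o h] and [h - ramp \o h / a] lie in the cone, so the polar
   inequality holds with both signs. *)
Lemma polar_ramp w h a b : L2 w -> (forall k, Kcone k -> covU w k <= 0) ->
  Kcone h -> covU w h = 0 -> 0 < a -> covU w (ramp a b \o h) = 0.
Proof.
move=> w2 wpol hK wh a0; have rK := K_ramp b a0 hK.
have h2 := K_L2 hK; have r2 := K_L2 rK.
apply/eqP; rewrite eq_le wpol//=.
have dK : Kcone (fun u => h u - a^-1 * ramp a b (h u)).
  split; first by apply: L2B => //; exact: L2Z.
  - apply/mono01P => x y xI yI xy; apply: (ramp_lip b a0); exact: K_mono.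
  - move=> u uI; apply: cvgB; first exact: K_lc.
    by apply: cvgM; [exact: cvg_cst|exact: K_lc].
have := wpol _ dK; rewrite covBr//; last exact: L2Z.
by rewrite wh covZr// sub0r oppr_le0 pmulr_rge0// invr_gt0.
Qed.

Lemma near_scale_ge1 (e : R) : 0 < e -> \forall n \near \oo, 1 <= n.+1%:R * e.
Proof.
move=> e0; have := near_infty_natSinv_lt (PosNum e0).
apply: filterS => n /= H; rewrite -ler_pdivrMl// mulr1 ltW//.
Qed.

(** Ramps that start at [c] and saturate at [c + 1 / n.+1] converge to the strict indicator. *)
Lemma polar_level_gt w h (c : R) : L2 w -> (forall k, Kcone k -> covU w k <= 0) ->
  Kcone h -> covU w h = 0 -> covU w (fun u => (c < h u)%R%:R) = 0.
Proof.
move=> w2 wpol hK wh.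
apply: (@covU_dominated _ (fun n => ramp n.+1%:R (- (n.+1%:R * c)) \o h)) => //.
- by move=> n; apply: K_L2; exact: K_ramp.
- by apply: K_L2; exact: K_indic_gt.
- by move=> n u _; exact: ramp_norm.
- move=> u uI; apply: cvg_near_cst; have [ch|hc] := ltP c (h u).
    have hc0 : 0 < h u - c by rewrite subr_gt0.
    apply: filterS (near_scale_ge1 hc0) => n; rewrite mulrBr /ramp/= => H.
    by rewrite max_r ?min_l//; lra.
  near=> n; rewrite /ramp/= max_l ?min_r//.
  by rewrite -mulrBr; apply: mulr_ge0_le0 => //; rewrite subr_le0.
- by move=> n; exact: polar_ramp.
Unshelve. all: by end_near. Qed.

(** Here the ramps start at [c - 1 / n.+1] and have already reached 1 at [c], so the limit includes
    the level [c] itself. *)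
Lemma polar_level_ge w h (c : R) : L2 w -> (forall k, Kcone k -> covU w k <= 0) ->
  Kcone h -> covU w h = 0 -> covU w (fun u => (c <= h u)%R%:R) = 0.
Proof.
move=> w2 wpol hK wh.
apply: (@covU_dominated _ (fun n => ramp n.+1%:R (1 - n.+1%:R * c) \o h)) => //.
- by move=> n; apply: K_L2; exact: K_ramp.
- exact: L2_indic_ge.
- by move=> n u _; exact: ramp_norm.
- move=> u uI; apply: cvg_near_cst; have [ch|hc] := leP c (h u).
    near=> n; have : 0 <= n.+1%:R * (h u - c) by rewrite mulr_ge0// subr_ge0.
    by rewrite mulrBr /ramp/= => H; rewrite max_r ?min_l//; lra.
  have hc0 : 0 < c - h u by rewrite subr_gt0.
  apply: filterS (near_scale_ge1 hc0) => n; rewrite mulrBr /ramp/= => H.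
  by rewrite max_l ?min_r//; lra.
- by move=> n; exact: polar_ramp.
Unshelve. all: by end_near. Qed.

(** Left continuity puts the endpoint [sup A] into the sublevel set, so a proper superlevel set is
    exactly an open tail. *)
Lemma K_level p (a b c : R) : Kcone p -> I01 a -> I01 b -> p a <= c -> c < p b ->
  exists2 s, I01 s & forall u, I01 u -> (c < p u) = (s < u).
Proof.
move=> pK aI bI pa pb; pose A := [set u | I01 u /\ p u <= c].
have Aa : A a by [].
have Aub u : I01 u -> c < p u -> ubound A u.
  move=> uI pu v [vI pv]; rewrite leNgt; apply/negP => uv.
  by have := K_mono pK uI vI (ltW uv); rewrite leNgt (le_lt_trans pv).
have supA : has_sup A by split; [exists a|exists b; exact: Aub].
have aS : a <= sup A by apply: ub_le_sup; [case: supA|].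
have Sb : sup A <= b by apply: ge_sup; [exists a|exact: Aub].
have SI : I01 (sup A).
  apply/I01P; move/I01P: aI => /andP[a0 _]; move/I01P: bI => /andP[_ b1].
  by rewrite (lt_le_trans a0)//= (le_lt_trans Sb).
exists (sup A) => // u uI; apply/idP/idP => [pu|Su].
  rewrite lt_neqAle; apply/andP; split; last by apply: ge_sup; [exists a|exact: Aub].
  apply/eqP => Su; rewrite -Su in pu uI.
  have [e /= e0 He] := cvgr_gt _ (K_lc pK SI) _ pu.
  have [v [vI pv] vS] := sup_adherent e0 supA.
  have vle : v <= sup A by apply: ub_le_sup; [case: supA|].
  move: vle; rewrite le_eqVlt => /orP[/eqP vE|vlt].
    by move: pu; rewrite -vE ltNge pv.
  have : c < p v.
    by apply: He => //=; rewrite gtr0_norm ?subr_gt0//; lra.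
  by rewrite ltNge pv.
rewrite ltNge; apply/negP => pu.
by move: Su; rewrite ltNge ub_le_sup//; case: supA.
Qed.

Lemma K_nonconst_level p : Kcone p -> ~ constant01 p ->
  exists2 s, I01 s & forall u, I01 u -> (EU p < p u) = (s < u).
Proof.
move=> pK pn; have p2 := K_L2 pK.
have [[a [aI pa]]|noA] := pselect (exists a, I01 a /\ p a <= EU p); last first.
  case: pn; apply: K_var_eq0 => //; apply: ge_mean_var0 => // u uI.
  by rewrite leNgt; apply/negP => pu; apply: noA; exists u; split=> //; exact: ltW.
have [[b [bI pb]]|noB] := pselect (exists b, I01 b /\ EU p < p b); last first.
  case: pn; apply: K_var_eq0 => //; apply: le_mean_var0 => // u uI.
  by rewrite leNgt; apply/negP => pu; apply: noB; exists u.
exact: K_level pa pb.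
Qed.

(* Otherwise the projection [p] of [- d] is not constant and pairs positively
   with its own level set [p > E p]. *)
Lemma cov_ge0_of_tails d : L2 d ->
  (forall s, I01 s -> 0 <= covU d (fun u => (s < u)%R%:R)) ->
  forall k, Kcone k -> 0 <= covU d k.
Proof.
move=> d2 dtail k kK; have k2 := K_L2 kK.
have nd2 := L2Z (-1) d2; have [p pp] := isoproj_exists nd2.
have pK := proj1 pp; have p2 := K_L2 pK.
have [pc|pn] := pselect (constant01 p).
  by have := isoproj_const nd2 pp pc kK; rewrite covZl//; lra.
exfalso; have [s sI ps] := K_nonconst_level pK pn.
pose w u := -1 * d u - p u; have w2 : L2 w by exact: L2B.
have wpol h : Kcone h -> covU w h <= 0.
  move=> hK; rewrite covBl//; last exact: K_L2.
  by rewrite subr_le0; exact: isoproj_le.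
have wp : covU w p = 0 by rewrite covBl// (isoproj_self nd2 pp) subrr.
have := polar_level_gt (EU p) w2 wpol pK wp.
have I2 := K_L2 (K_indic_itv s).
rewrite (@cov_eq _ _ w _ (fun u => (s < u)%R%:R))//; last by move=> u uI; rewrite ps.
rewrite covBl// covZl// (cov_centred p2 I2) => H.
have g0 u : I01 u -> 0 <= (p u - EU p) * (s < u)%R%:R.
  move=> uI; rewrite -ps//; case: ltP => H'; last by rewrite mulr0.
  by rewrite mulr1 subr_ge0 ltW.
have E0 : EU (fun u => (p u - EU p) * (s < u)%R%:R) = 0.
  by have := EU_ge0 g0; have := dtail s sI; lra.
have g1 : L1 (fun u => (p u - EU p) * (s < u)%R%:R).
  by apply: L1_mul => //; apply: L2B => //; exact: L2_cst.
have ae := EU_eq0_ae g1 g0 E0; move/I01P: (sI) => /andP[s0 s1].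
have [v [sv v1]] := ae_I01_dense (ltW s0) s1 (lexx _) ae.
have vI : I01 v by apply/I01P; rewrite v1 (lt_trans s0).
have := ps v vI; rewrite sv mulr1 => pv /eqP.
by rewrite subr_eq0 gt_eqF.
Qed.

(** The tail at [s] is [h s < h] plus the part [x] of the level set of [h s] beyond [s], and
    [h s <= h] minus the part [y] up to [s]. Hence its covariance with [d] is both [covU d x] and
    [- covU d y]. As [d] is non-decreasing on that level set, the first is non-negative if
    [d s >= EU d], the second otherwise. *)
Lemma cov_ge0_of_levels d h : L2 d -> Kcone h ->
  (forall u v, I01 u -> I01 v -> u <= v -> h u = h v -> d u <= d v) ->
  (forall c, covU d (fun u => (c < h u)%R%:R) = 0) ->
  (forall c, covU d (fun u => (c <= h u)%R%:R) = 0) ->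
  forall k, Kcone k -> 0 <= covU d k.
Proof.
move=> d2 hK dm dgt dge; apply: cov_ge0_of_tails => // s sI.
have I2 := K_L2 (K_indic_itv s).
have gt2 := K_L2 (K_indic_gt (h s) hK); have ge2 := L2_indic_ge (h s) hK.
pose x u : R := (s < u)%R%:R - (h s < h u)%R%:R.
pose y u : R := (h s <= h u)%R%:R - (s < u)%R%:R.
have x2 : L2 x by exact: L2B.
have y2 : L2 y by exact: L2B.
have xE u : I01 u -> x u = ((s < u) && (h u == h s))%:R.
  move=> uI; rewrite /x; case: ltP => su.
    have := K_mono hK sI uI (ltW su); rewrite le_eqVlt eq_sym => /orP[/eqP E|hl].
      by rewrite E eqxx ltxx subr0.
    by rewrite hl gt_eqF// subrr.
  by have := K_mono hK uI sI su; rewrite ltNge => ->; rewrite subr0.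
have yE u : I01 u -> y u = ((u <= s) && (h u == h s))%:R.
  move=> uI; rewrite /y; case: ltP => su.
    by have := K_mono hK sI uI (ltW su) => ->; rewrite subrr.
  by have := K_mono hK uI sI su; rewrite eq_le => -> /=; rewrite subr0.
have dx : covU d (fun u => (s < u)%R%:R) = covU d x.
  by rewrite (covBr d2 I2 gt2) dgt subr0.
have dy : covU d (fun u => (s < u)%R%:R) = - covU d y.
  by rewrite (covBr d2 ge2 I2) dge sub0r opprK.
have dc2 : L2 (fun u => d u - EU d) := L2B d2 (L2_cst _).
have [ds|ds] := leP 0 (d s - EU d).
  rewrite dx (cov_centred d2 x2); apply: EU_ge0 => u uI; rewrite (xE u uI).
  case: (boolP (s < u)) => su /=; rewrite ?mulr0 ?lexx //.
  case: eqP => hu; rewrite ?mulr0// mulr1.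
  by have := dm _ _ sI uI (ltW su) (esym hu); move: ds; gen_lra.
rewrite dy (cov_centred d2 y2) -mulN1r -EUZ; last exact: L1_mul.
apply: EU_ge0 => u uI; rewrite (yE u uI).
case: (boolP (u <= s)) => su /=; rewrite ?mulr0 ?lexx //.
case: eqP => hu; rewrite ?mulr0// mulr1.
by have := dm _ _ uI sI su hu; move: ds; gen_lra.
Qed.

End variational.

(** * Quantile functions *)

Section quantiles.
Variable R : realType.
Implicit Types f h k G : R -> R.
Local Notation I01 := (@I01 R).
Hint Resolve measurable_I01 : core.

(** The limits of [G] make the infimum genuine, and right continuity makes it attained. *)
Lemma quantile_leP G u y : distr_fun G -> I01 u ->
  (quantile G u <= y) <-> (u <= G y).
Proof.
move=> [Gm Grc Gm0 Gp1] uI; move/I01P: (uI) => /andP[u0 u1].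
have ne : [set y | u <= G y] !=set0.
  have [M [_ HM]] := cvgr_gt _ Gp1 _ u1; exists (M + 1) => /=.
  by apply/ltW/HM; rewrite ltrDl.
have lb : has_lbound [set y | u <= G y].
  have [M [_ HM]] := cvgr_lt _ Gm0 _ u0; exists (M - 1) => z /= uGz.
  rewrite leNgt; apply/negP => zM; move: uGz; rewrite leNgt HM//.
  by apply: lt_trans zM _; rewrite ltrBlDr ltrDl.
split=> [qy|uy]; last exact: ge_inf.
rewrite leNgt; apply/negP => Gyu.
have [e /= e0 He] := cvgr_lt _ (Grc y) _ Gyu.
have [z zu zlt] := @inf_adherent R _ (e / 2) (divr_gt0 e0 (ltr0Sn _ 1)) (conj ne lb).
have zy : z < y + e / 2 by apply: lt_le_trans zlt _; rewrite lerD2r.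
have : G (y + e / 2) < u.
  apply: He => /=; last by lra.
  by rewrite opprD addNKr normrN gtr0_norm; lra.
by rewrite ltNge (le_trans zu)// Gm// ltW.
Qed.

Lemma quantile_K G : M2 G -> Kcone (quantile G).
Proof.
move=> [GD G2].
have qG u : I01 u -> u <= G (quantile G u) by move=> uI; apply/quantile_leP.
have qm : mono01 (quantile G).
  by move=> x y xI yI xy; apply/quantile_leP => //; apply: le_trans xy _; exact: qG.
split=> //; first exact/mono01P.
move=> u uI; apply/cvgrPdist_lt => e e0.
have Gu : G (quantile G u - e) < u.
  rewrite ltNge; apply/negP => /(quantile_leP _ GD uI); lra.
near=> v.
have [vI vu] : I01 v /\ v < u by near: v; exact: near_left_I01.
have Gv : G (quantile G u - e) < v by near: v; exact: nbhs_left_gt.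
rewrite ger0_norm ?subr_ge0; last by apply: qm => //; exact: ltW.
have : quantile G u - e < quantile G v.
  by rewrite ltNge; apply/negP => /(quantile_leP _ GD vI); rewrite leNgt Gv.
by lra.
Unshelve. all: by end_near. Qed.

(** Optimising over distribution functions is thus optimising over the cone. The candidate [G y] is
    the largest level at which [k] is at most [y], with 0 adjoined for the case of no such level.
    Left continuity gives the equivalence [Ggal], from which all properties of [G] are read off. *)
Lemma K_quantile k : Kcone k ->
  exists G, M2 G /\ forall u, I01 u -> quantile G u = k u.
Proof.
move=> kK; pose A y := [set 0] `|` [set u | I01 u /\ k u <= y].
pose G y := sup (A y).
have A1 y : ubound (A y) 1.
  by move=> u [->//|[/I01P/andP[_ u1] _]]; exact: ltW.
have A0 y : A y 0 by left.
have supA y : has_sup (A y) by split; [exists 0|exists 1].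
have G0 y : 0 <= G y by apply: ub_le_sup; [case: (supA y)|].
have G1 y : G y <= 1 by apply: ge_sup; [exists 0|].
have Ggal u y : I01 u -> (k u <= y) = (u <= G y).
  move=> uI; apply/idP/idP => [kuy|uG].
    by apply: ub_le_sup; [case: (supA y)|right].
  rewrite leNgt; apply/negP => yk.
  have [e /= e0 He] := cvgr_gt _ (K_lc kK uI) _ yk.
  move/I01P: (uI) => /andP[u0 u1].
  pose v := Num.max (u / 2) (u - e / 2).
  have vu : v < u by rewrite /v gt_max; apply/andP; split; lra.
  have v0 : 0 < v by rewrite /v lt_max; apply/orP; left; lra.
  have vI : I01 v by apply/I01P; rewrite v0 (lt_trans vu).
  have ve : u - e / 2 <= v by rewrite /v le_max lexx orbT.
  have yv : y < k v.
    by apply: He => //=; rewrite gtr0_norm ?subr_gt0//; lra.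
  have : G y <= v.
    apply: ge_sup; first by exists 0.
    move=> w [->|[wI kw]]; first exact: ltW.
    rewrite leNgt; apply/negP => vw.
    by have := K_mono kK vI wI (ltW vw); rewrite leNgt (le_lt_trans kw).
  by rewrite leNgt (lt_le_trans vu).
have Gm : {homo G : x y / x <= y}.
  move=> x y xy; apply: ge_sup; first by exists 0.
  move=> u [->//|[uI kx]]; rewrite -Ggal//; exact: le_trans xy.
have Glt t y : I01 t -> y < k t -> G y < t by move=> tI; rewrite !ltNge Ggal.
have GD : distr_fun G.
  split=> //.
  - move=> y; apply/cvgrPdist_le => e e0.
    have [c yc Hc] : exists2 c, y < c & forall z, z < c -> G z <= G y + e.
      have [t1|t1] := leP 1 (G y + e).
        by exists (y + 1); rewrite ?ltrDl// => z _; exact: le_trans (G1 z) t1.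
      have tI : I01 (G y + e) by apply/I01P; rewrite t1 andbT ltr_wpDl.
      exists (k (G y + e)); last by move=> z zk; apply/ltW/Glt.
      by rewrite ltNge Ggal// gerDl leNgt e0.
    near=> z.
    have yz : y < z by near: z; exact: nbhs_right_gt.
    rewrite ler0_norm ?subr_le0; last by apply: Gm; exact: ltW.
    by rewrite opprB lerBlDl; apply: Hc; near: z; exact: nbhs_right_lt.
  - apply/cvgrPdist_lt => e e0.
    pose t := Num.min (e / 2) (1 / 2).
    have t0 : 0 < t by rewrite /t lt_min; apply/andP; split; lra.
    have t1 : t <= 1 / 2 by rewrite /t ge_min lexx orbT.
    have te : t <= e / 2 by rewrite /t ge_min lexx.
    have tI : I01 t by apply/I01P; rewrite t0; lra.
    exists (k t); split; first exact: num_real.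
    move=> y yk /=; rewrite sub0r normrN ger0_norm//.
    by have := Glt _ _ tI yk; lra.
  - apply/cvgrPdist_lt => e e0.
    pose t := Num.max (1 - e / 2) (1 / 2).
    have t0 : 1 / 2 <= t by rewrite /t le_max lexx orbT.
    have t1 : t < 1 by rewrite /t gt_max; apply/andP; split; lra.
    have te : 1 - e / 2 <= t by rewrite /t le_max lexx.
    have tI : I01 t by apply/I01P; rewrite t1; lra.
    exists (k t); split; first exact: num_real.
    move=> y yk /=; rewrite ger0_norm ?subr_ge0//.
    have tG : t <= G y by rewrite -Ggal// ltW.
    by lra.
have qE u : I01 u -> quantile G u = k u.
  move=> uI; apply/eqP; rewrite eq_le; apply/andP; split.
    by apply/(quantile_leP _ GD uI); rewrite -Ggal.
  by rewrite Ggal//; apply/quantile_leP.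
exists G; split=> //; split=> //.
by apply: L2_eq (K_L2 kK) => u /qE.
Unshelve. all: by end_near. Qed.

End quantiles.

(** * Absolutely continuous distortions are primitives of their weight *)

Section stieltjes.
Variable R : realType.
Local Notation mu := (@lebesgue_measure R).

Lemma stieltjes_itv (G : cumulativeBounded (0 : R) (1 : R)) (a b : R) : a <= b ->
  lebesgue_stieltjes_measure G `]a, b]%classic = (G b - G a)%:E.
Proof.
move=> ab; rewrite /lebesgue_stieltjes_measure /measure_extension/=.
by rewrite measurable_mu_extE/= ?wlength_itv_bnd//; exact: is_ocitv.
Qed.

(** Half-open so that the cells of one generation partition []0, 1]] and have Stieltjes mass equal
    to an increment. *)
Definition cell (n i : nat) : set R := `]i%:R / 2 ^+ n, i.+1%:R / 2 ^+ n]%classic.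

Lemma cellP n i (x : R) : cell n i x <-> i%:R < x * 2 ^+ n <= i.+1%:R.
Proof.
have p0 : 0 < 2 ^+ n :> R by rewrite exprn_gt0.
by rewrite /cell /= in_itv/= ltr_pdivrMr// ler_pdivlMr.
Qed.

Lemma cell_inj n i j (x : R) : cell n i x -> cell n j x -> i = j.
Proof.
move=> /cellP/andP[i1 i2] /cellP/andP[j1 j2]; apply/eqP; rewrite eqn_leq.
have := lt_le_trans i1 j2; have := lt_le_trans j1 i2.
by rewrite !ltr_nat !ltnS => -> ->.
Qed.

Lemma cell_exists n (x : R) : 0 < x <= 1 -> exists2 i, (i < 2 ^ n)%N & cell n i x.
Proof.
move=> /andP[x0 x1]; have p0 : 0 < 2 ^+ n :> R by rewrite exprn_gt0.
have exj : exists j, x * 2 ^+ n <= j%:R.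
  by exists (2 ^ n)%N; rewrite natrX ler_piMl// ltW.
case: (ex_minnP exj) => -[|i] xi imin.
  by move: xi; rewrite leNgt mulr_gt0.
exists i; first by apply: imin; rewrite natrX ler_piMl// ltW.
apply/cellP; rewrite xi andbT ltNge; apply/negP => /imin.
by rewrite ltnn.
Qed.

Lemma cell_refine n i j (x : R) : cell n i x -> cell n.+1 j x -> cell n.+1 j `<=` cell n i.
Proof.
move=> /cellP/andP[i1 i2] /cellP/andP[j1 j2] y /cellP/andP[y1 y2].
rewrite exprS mulrCA in j1 j2 y1 y2.
have ij : 2 * i%:R <= j%:R :> R.
  rewrite -natrM ler_nat -ltnS -(ltr_nat R) natrM.
  by apply: lt_le_trans j2; rewrite ltr_pM2l.
have ji : j.+1%:R <= 2 * i.+1%:R :> R.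
  rewrite -natrM ler_nat -(ltr_nat R) natrM.
  by apply: lt_le_trans j1 _; rewrite ler_pM2l.
by apply/cellP; apply/andP; split; lra.
Qed.

(** An inner approximation of an open set by finitely many disjoint intervals, the only families
    that [abs_continuous01] speaks about. *)
Definition inner_cells (U : set R) (n : nat) : set R :=
  \big[setU/set0]_(i < 2 ^ n | `[< cell n i `<=` U >]) cell n i.

Lemma inner_cellsP (U : set R) n x : inner_cells U n x <->
  exists i, [/\ (i < 2 ^ n)%N, cell n i `<=` U & cell n i x].
Proof.
rewrite /inner_cells big_mkcond/=.
rewrite -(bigcup_mkord _ (fun i => if `[< cell n i `<=` U >] then cell n i else set0)).
split=> [[i /= i2]|[i [i2 iU ix]]].
  by case: asboolP => // iU ix; exists i.
by exists i => //=; case: asboolP.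
Qed.

Lemma inner_cells_homo (U : set R) : {homo inner_cells U : n m / (n <= m)%N >-> (n <= m)%O}.
Proof.
apply: homo_leq => [A //|A B C|n]; first exact: le_trans.
apply/subsetPset => x /inner_cellsP[i [i2 iU ix]]; apply/inner_cellsP.
have x01 : 0 < x <= 1.
  move: ix => /cellP/andP[ix1 ix2]; have p0 : 0 < 2 ^+ n :> R by rewrite exprn_gt0.
  apply/andP; split.
    by rewrite -(pmulr_lgt0 _ p0); apply: le_lt_trans ix1.
  rewrite -(ler_pM2r p0) mul1r; apply: le_trans ix2 _.
  by rewrite -natrX ler_nat.
have [j j2 jx] := cell_exists n.+1 x01; exists j; split=> //.
exact: subset_trans (cell_refine ix jx) iU.
Qed.

Lemma measurable_inner_cells (U : set R) n : measurable (inner_cells U n).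
Proof. by apply: bigsetU_measurable => i _; exact: measurable_itv. Qed.

Lemma inner_cells_sub (U : set R) n : inner_cells U n `<=` U.
Proof. by move=> x /inner_cellsP[i [_ iU]]; exact: iU. Qed.

Lemma cell_trivIset n : trivIset [set: 'I_(2 ^ n)] (fun i => cell n i).
Proof.
apply/trivIsetP => i j _ _ ij; rewrite -subset0 => x [ix jx].
by have := cell_inj ix jx => /val_inj/eqP; rewrite (negbTE ij).
Qed.

Lemma open_inner_cells (U : set R) : open U -> U `&` `]0, 1]%classic `<=` \bigcup_n inner_cells U n.
Proof.
move=> oU x [Ux]; rewrite /= in_itv/= => x01.
have /nbhs_ballP[r /= r0 rU] : nbhs x U by exact: open_nbhs_nbhs.
have [n nr] := pow2V_small r0; exists n => //; apply/inner_cellsP.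
have [i i2 ix] := cell_exists n x01; exists i; split=> // y yi; apply: rU.
have p0 : 0 < 2 ^- n :> R := pow2V_gt0 R n.
move: ix yi; rewrite /cell/= !in_itv/= -(natr1 i) !mulrDl mul1r => /andP[x1 x2] /andP[y1 y2].
by rewrite /ball/= ltr_norml; lra.
Qed.

Lemma cell_bounds n i : (i < 2 ^ n)%N ->
  [/\ 0 <= i%:R / 2 ^+ n :> R, i%:R / 2 ^+ n <= i.+1%:R / 2 ^+ n :> R
    & i.+1%:R / 2 ^+ n <= 1 :> R].
Proof.
move=> i2; have p0 : 0 < 2 ^+ n :> R by rewrite exprn_gt0.
split; first by rewrite divr_ge0// ltW.
  by rewrite ler_pM2r ?invr_gt0// ler_nat.
by rewrite ler_pdivrMr// mul1r -natrX ler_nat.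
Qed.

(** A null set has an open cover of length below [d]; each finite union of cells inside it has
    Stieltjes mass at most [e], and these unions increase to the cover within []0, 1]]. Outside []0,
    1]] there is no mass, because the increment of [G] there is already the total mass 1. *)
Lemma stieltjes_dominated (G : cumulativeBounded (0 : R) (1 : R)) :
  G 0 = 0 -> G 1 = 1 -> abs_continuous01 G ->
  lebesgue_stieltjes_measure G `<< mu.
Proof.
move=> G0 G1 acG; set nu := lebesgue_stieltjes_measure G.
apply/null_content_dominatesP => A mA A0.
pose J : set R := `]0, 1]%classic.
have mJ : measurable J by exact: measurable_itv.
have nu_itv (a b : R) : a <= b -> nu `]a, b]%classic = (G b - G a)%:E.
  exact: stieltjes_itv.
have nu01 : nu J = 1%E by rewrite nu_itv// G0 G1 subr0.
have nuT : nu setT = 1%E by exact: probability_setT.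
have nuC : nu (~` J) = 0%E.
  have : nu setT = (nu J + nu (~` J))%E.
    by rewrite -measureU ?setUv ?setICr//; exact: measurableC.
  rewrite nuT nu01; have : nu (~` J) \is a fin_num.
    by apply: fin_num_measure; exact: measurableC.
  by case: (nu _) => //= r _ [H]; congr EFin; lra.
have key (e : R) : 0 < e -> (nu (A `&` J) <= e%:E)%E.
  move=> e0; have [d d0 Hd] := acG e e0.
  have A_fin : (mu A < +oo)%E by rewrite A0.
  have [U [oU AU UA]] := lebesgue_regularity_outer mA A_fin d0.
  have mU : measurable U by exact: open_measurable.
  have Ud : (mu U < d%:E)%E.
    have -> : U = A `|` (U `\` A) by rewrite setDUK.
    rewrite measureU ?setDIK//; [|exact: measurableD].
    by rewrite [X in (X + _ < _)%E]A0 add0e.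
  have mc n i : measurable (cell n i) by exact: measurable_itv.
  have nuV n : (nu (inner_cells U n) <= e%:E)%E.
    pose sel i := `[< cell n i `<=` U >].
    pose a i : R := i%:R / 2 ^+ n.
    (* Cells not inside [U] are collapsed to empty intervals, so the sums can run over all
       indices. *)
    pose b i : R := if sel i then i.+1%:R / 2 ^+ n else a i.
    have grid i j : (i <= j)%N -> i%:R / 2 ^+ n <= j%:R / 2 ^+ n :> R.
      by move=> ij; rewrite ler_pM2r ?ler_nat// invr_gt0 exprn_gt0.
    have bE i : b i <= i.+1%:R / 2 ^+ n.
      by rewrite /b; case: (sel i) => //; exact: grid.
    have aleb i : a i <= b i.
      by rewrite /b; case: (sel i) => //; exact: grid.
    have Hab : \sum_(i < 2 ^ n) (b i - a i) < d.
      rewrite -lte_fin; apply: le_lt_trans Ud.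
      apply: (@le_trans _ _ (mu (inner_cells U n))); last first.
        apply: (@le_measure _ _ _ mu); rewrite ?inE//.
          exact: measurable_inner_cells.
        exact: inner_cells_sub.
      rewrite /inner_cells (@measure_bigsetU_ord _ _ _ mu); [|by move=> i; exact: mc|exact: cell_trivIset].
      rewrite -sumEFin big_mkcond [X in (_ <= X)%E]big_mkcond/=; apply: lee_sum => i _.
      rewrite /b /sel; case: asboolP => _; last by rewrite subrr.
      by rewrite /cell lebesgue_measure_itv/= lte_fin ltr_pM2r ?invr_gt0 ?exprn_gt0// ltr_nat ltnSn.
    have Hdisj i j : (i < 2 ^ n)%N -> (j < 2 ^ n)%N -> i <> j -> b i <= a j \/ b j <= a i.
      move=> _ _ /eqP; rewrite neq_ltn => /orP[ij|ji]; [left|right].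
        by apply: le_trans (bE i) _; exact: grid.
      by apply: le_trans (bE j) _; exact: grid.
    have Hbnd i : (i < 2 ^ n)%N -> 0 <= a i /\ a i <= b i /\ b i <= 1.
      move=> i2; have [c1 c2 c3] := cell_bounds i2; split=> //; split=> //.
      exact: le_trans (bE i) c3.
    have := Hd _ a b Hbnd Hdisj Hab; rewrite -lte_fin => /ltW; apply: le_trans.
    have nuB := @measure_bigsetU_ord _ _ _ nu (2 ^ n)%N
      (fun i => `[< cell n i `<=` U >]) _ (fun i => mc n i) (@cell_trivIset n).
    rewrite [X in (X <= _)%E]nuB.
    rewrite -sumEFin big_mkcond [X in (_ <= X)%E]big_mkcond/=; apply: lee_sum => i _.
    rewrite /b /sel; case: asboolP => _; last by rewrite subrr normr0.
    rewrite [X in (X <= _)%E]nu_itv; last by case: (cell_bounds (ltn_ord i)).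
    by rewrite lee_fin ler_norm.
  apply: (@le_trans _ _ (nu (\bigcup_n inner_cells U n))).
    apply: (@le_measure _ _ _ nu); rewrite ?inE.
    - exact: measurableI.
    - by apply: bigcup_measurable => n _; exact: measurable_inner_cells.
    - by move=> x [/AU Ux x01]; exact: open_inner_cells.
  have H := @nondecreasing_cvg_mu _ _ _ nu _ (measurable_inner_cells U) _ (@inner_cells_homo U).
  have {}H := H (bigcup_measurable (fun n _ => measurable_inner_cells U n)).
  have E := cvg_lim (@ereal_hausdorff R) H.
  apply: (@le_trans _ _ (limn (nu \o inner_cells U))).
    by rewrite le_eqVlt; apply/orP; left; apply/eqP; exact: esym (E _).
  apply: lime_le; first by apply/cvg_ex; eexists; exact: H.
  by near=> n; exact: nuV.
have nuA : nu (A `&` J) = 0%E.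
  apply/eqP; rewrite eq_le measure_ge0 andbT; apply/lee_addgt0Pr => e e0.
  by rewrite add0e; exact: key.
apply/eqP; rewrite eq_le measure_ge0 andbT.
have -> : A = (A `&` J) `|` (A `\` J) by rewrite setUIDK.
apply: le_trans (measureU2 _ _ _) _; [exact: measurableI|exact: measurableD|].
rewrite -[X in (_ <= X)%E]add0e; apply: leeD; first by rewrite [X in (X <= _)%E]nuA.
rewrite -nuC; apply: (@le_measure _ _ _ nu); rewrite ?inE; last by move=> x [].
  exact: measurableD.
exact: measurableC.
Unshelve. all: by end_near. Qed.

End stieltjes.

(** * The weight of a distortion as an almost everywhere derivative *)

Section primitive.
Variable R : realType.
Implicit Types g : R -> R.
Local Notation mu := (@lebesgue_measure R).
Local Notation I01 := (@I01 R).

Definition clamp01 (y : R) : R := Num.max 0 (Num.min 1 y).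

Lemma clamp01P y : 0 <= clamp01 y <= 1.
Proof. by rewrite /clamp01 le_max lexx ge_max ler01 ge_min lexx. Qed.

Lemma clamp01_id y : 0 <= y <= 1 -> clamp01 y = y.
Proof. by move=> /andP[y0 y1]; rewrite /clamp01 min_r// max_r. Qed.

Lemma clamp01_homo : {homo clamp01 : x y / x <= y}.
Proof.
move=> x y xy; rewrite /clamp01 ge_max !le_max lexx/= le_min !ge_min lexx/= xy.
by rewrite !orbT.
Qed.

Lemma clamp01_lip x y : x <= y -> clamp01 y - clamp01 x <= y - x.
Proof.
move=> xy; rewrite /clamp01.
case: (leP 1 x) => x1; case: (leP 1 y) => y1.
- by rewrite subrr subr_ge0.
- by lra.
- by case: (leP 0 x) => x0; case: (leP 0 1) => ?; lra.
- by case: (leP 0 x) => x0; case: (leP 0 y) => y0; lra.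
Qed.

(* Extended by constants to the line; its right derivative at [u] in (0,1) is
   [gam g u]. *)
Definition conj_cdf g (x : R) : R := 1 - g (clamp01 (1 - x)).

Lemma conj_cdfE g x : 0 <= x <= 1 -> conj_cdf g x = 1 - g (1 - x).
Proof. by move=> /andP[x0 x1]; rewrite /conj_cdf clamp01_id; lra. Qed.

Lemma distortion_homo g x y : distortion g -> 0 <= x -> x <= y -> y <= 1 -> g x <= g y.
Proof.
move=> [gm _ _ _] x0 xy y1; apply: gm => //; rewrite in_itv/=.
  by rewrite x0 (le_trans xy).
by rewrite y1 (le_trans x0).
Qed.

Lemma conj_cdf_homo g : distortion g -> {homo conj_cdf g : x y / x <= y}.
Proof.
move=> gD x y xy; rewrite /conj_cdf lerD2l lerN2.
have /andP[a0 a1] := clamp01P (1 - x); have /andP[b0 b1] := clamp01P (1 - y).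
by apply: distortion_homo => //; apply: clamp01_homo; rewrite lerD2l lerN2.
Qed.

Lemma conj_cdf_continuous g : abs_continuous01 g -> continuous (conj_cdf g).
Proof.
move=> gac x; apply/cvgrPdist_lt => e e0; have [d d0 Hd] := gac e e0.
have key y z : y <= z -> z - y < d -> `|conj_cdf g z - conj_cdf g y| < e.
  move=> yz zy.
  have zy' : 1 - z <= 1 - y by rewrite lerD2l lerN2.
  have /andP[a0 a1] := clamp01P (1 - y); have /andP[b0 b1] := clamp01P (1 - z).
  have := Hd 1%N (fun _ => clamp01 (1 - z)) (fun _ => clamp01 (1 - y)).
  rewrite !big_ord1 => H.
  have -> : conj_cdf g z - conj_cdf g y = g (clamp01 (1 - y)) - g (clamp01 (1 - z)).
    by rewrite /conj_cdf; ring.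
  apply: H.
  - by move=> i _; split=> //; split=> //; exact: clamp01_homo.
  - by case=> // -[].
  - by have := clamp01_lip zy'; lra.
near=> y; have [xy|yx] := leP x y.
  rewrite distrC; apply: key => //.
  have : `|x - y| < d by near: y; exact: cvgr_dist_lt.
  by rewrite ler0_norm ?subr_le0// opprB.
apply: key; first exact: ltW.
have : `|x - y| < d by near: y; exact: cvgr_dist_lt.
by rewrite gtr0_norm ?subr_gt0.
Unshelve. all: by end_near. Qed.

Lemma conj_cdf_le0 g x : distortion g -> x <= 0 -> conj_cdf g x = 0.
Proof.
move=> [_ _ _ g1] x0; rewrite /conj_cdf /clamp01 min_l; last by lra.
by rewrite max_r// g1 subrr.
Qed.

Lemma conj_cdf_ge1 g x : distortion g -> 1 <= x -> conj_cdf g x = 1.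
Proof.
move=> [_ _ g0 _] x1; rewrite /conj_cdf /clamp01 min_r; last by lra.
by rewrite max_l ?g0 ?subr0//; lra.
Qed.

Lemma conj_cdf_abs_continuous g : abs_continuous01 g -> abs_continuous01 (conj_cdf g).
Proof.
move=> gac e e0; have [d d0 Hd] := gac e e0; exists d => // n a b Hab Hdisj Hs.
have -> : \sum_(i < n) `|conj_cdf g (b i) - conj_cdf g (a i)| =
          \sum_(i < n) `|g (1 - a i) - g (1 - b i)|.
  apply: eq_bigr => i _; have [a0 [ab b1]] := Hab i (ltn_ord i).
  rewrite !conj_cdfE; [|lra|lra].
  by have -> : 1 - g (1 - b i) - (1 - g (1 - a i)) = g (1 - a i) - g (1 - b i) by ring.
apply: (Hd n (fun i => 1 - b i) (fun i => 1 - a i)).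
- by move=> i i_n; have [a0 [ab b1]] := Hab i i_n; split; [|split]; lra.
- by move=> i j i_n j_n ij; have [H|H] := Hdisj i j i_n j_n ij; [right|left]; lra.
- by rewrite (eq_bigr (fun i : 'I_n => b i - a i))// => i _; ring.
Qed.

Lemma conj_cdf_density g : distortion g -> abs_continuous01 g ->
  exists f : R -> R, mu.-integrable setT (EFin \o f) /\
    forall a b, a <= b -> (\int[mu]_(x in `]a, b]%classic) (f x)%:E)%E =
      (conj_cdf g b - conj_cdf g a)%:E.
Proof.
move=> gD gac.
have rc : right_continuous (conj_cdf g).
  by apply: right_continuousW; exact: conj_cdf_continuous.
have Ny : conj_cdf g @ -oo --> (0 : R).
  apply: cvg_near_cst; exists 0; split; first exact: num_real.
  by move=> x x0; exact: conj_cdf_le0 (ltW x0).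
have y1 : conj_cdf g @ +oo --> (1 : R).
  apply: cvg_near_cst; exists 1; split; first exact: num_real.
  by move=> x x1; exact: conj_cdf_ge1 (ltW x1).
pose G : cumulativeBounded (0 : R) (1 : R) := HB.pack (conj_cdf g)
  (isCumulative.Build R _ R (conj_cdf g) (conj_cdf_homo gD) rc)
  (isCumulativeBounded.Build R 0 1 (conj_cdf g) Ny y1).
have dom : lebesgue_stieltjes_measure G `<< mu.
  apply: stieltjes_dominated; last exact: conj_cdf_abs_continuous.
    exact: conj_cdf_le0.
  exact: conj_cdf_ge1.
have [f [f0 ffin fint fE]] := radon_nikodym_sigma_finite dom.
exists (fine \o f); split.
  apply: eq_integrable fint => // x _; rewrite /= fineK//.
move=> a b ab; rewrite -[RHS](stieltjes_itv G ab).
have mab : measurable (`]a, b]%classic : set R) by exact: measurable_itv.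
rewrite (fE _ mab); apply: eq_integral => x _; rewrite /= fineK//.
Qed.

(** The left difference quotient of [g] at [1 - u] is the right difference quotient of [conj_cdf g]
    at [u], and almost everywhere the latter has the full limit [f u]. *)
Lemma gam_density g (f : R -> R) : distortion g ->
  mu.-integrable setT (EFin \o f) ->
  (forall a b, a <= b -> (\int[mu]_(x in `]a, b]%classic) (f x)%:E)%E =
      (conj_cdf g b - conj_cdf g a)%:E) ->
  {ae mu, forall u, I01 u -> gam g u = f u}.
Proof.
move=> gD fint fE.
have floc : locally_integrable setT f by apply: open_integrable_locally => //; exact: openT.
have finty y : mu.-integrable [set` Interval (BRight 0) (BRight y)] (EFin \o f).
  by apply: integrableS fint => //; exact: measurable_itv.
have := FTC1 finty floc; set F := fun x => _.
have FE x : 0 <= x -> F x = conj_cdf g x.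
  move=> x0; rewrite /F /Rintegral fE//= (@conj_cdf_le0 g 0)// subr0//.
move=> [N [mN N0 NF]]; exists N; split=> // u /= Hu; apply: NF => /= HF.
apply: Hu => uI; move/I01P: (uI) => /andP[u0 u1].
have [dF F'] := HF u0.
rewrite /gam; apply: cvg_lim => //.
have cF : (fun h => h^-1 *: (F (h + u) - F u)) @ 0^' --> f u.
  move: dF; rewrite /derivable => /cvg_ex[l Hl].
  rewrite -F' derive1E; have -> : 'D_1 F u = l by exact: cvg_lim Hl.
  move: Hl; rewrite /=; apply: cvg_trans; apply: near_eq_cvg; near=> h.
  by rewrite [h *: 1]mulr1.
have : (fun h => h^-1 *: (F (h + u) - F u)) @ 0^'+ --> f u.
  by apply: cvg_trans cF; apply: cvg_app; apply: within_subset => h /=; exact: lt0r_neq0.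
apply: cvg_trans; apply: near_eq_cvg; near=> h.
have h0 : 0 < h by near: h; exact: nbhs_right_gt.
have h1 : h < 1 - u by near: h; apply: nbhs_right_lt; rewrite subr_gt0.
rewrite !FE; [|lra|lra]; rewrite !conj_cdfE; [|lra|lra].
rewrite /GRing.scale/= mulrC; congr (_ * _).
have -> : 1 - (h + u) = 1 - u - h by ring.
by ring.
Unshelve. all: by end_near. Qed.

(** At [s = 0] this is the normalisation of the weight; for other [s] it reduces tail covariances of
    [gam g] to values of [g]. *)
Lemma gam_tail g (s : R) : distortion g -> abs_continuous01 g -> L2 (gam g) ->
  0 <= s -> s < 1 -> EU (fun u => gam g u * (s < u)%R%:R) = g (1 - s).
Proof.
move=> gD gac g2 s0 s1; have [f [fint fE]] := conj_cdf_density gD gac.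
have ae := gam_density gD fint fE.
have I2 := K_L2 (K_indic_itv s).
have mf : measurable_fun I01 f.
  by have /measurable_int/measurable_EFinP := fint; exact: measurable_funS.
rewrite /EU -[RHS]/(fine (g (1 - s))%:E); congr fine.
transitivity (\int[mu]_(u in I01) (f u * (s < u)%R%:R)%:E)%E.
  apply: (@ae_eq_integral _ _ _ mu); [exact: measurable_I01|..].
  - by apply/measurable_EFinP/measurable_funM; exact: L2_meas.
  - by apply/measurable_EFinP/measurable_funM => //; exact: L2_meas.
  - by apply: ae_I01_imp ae => u _ /= ->.
transitivity (\int[mu]_(u in `]s, 1%R[%classic) (f u)%:E)%E.
  rewrite [RHS]integral_mkcond [LHS]integral_mkcond; apply: eq_integral => u _.
  rewrite !patchE !mem_setE /I01 !in_itv/=.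
  case: (ltP s u) => su; last by rewrite mulr0/=; case: ifP.
  by rewrite (le_lt_trans s0 su) mulr1.
rewrite integral_itv_bndo_bndc; last first.
  apply/measurable_EFinP; move/measurable_int/measurable_EFinP: fint.
  exact: measurable_funS.
rewrite fE; last exact: ltW.
rewrite (conj_cdf_ge1 gD (lexx 1)) conj_cdfE; last by rewrite s0 ltW.
by congr EFin; ring.
Qed.

Lemma gam_mean g : distortion g -> abs_continuous01 g -> L2 (gam g) -> EU (gam g) = 1.
Proof.
move=> gD gac g2; have := gam_tail gD gac g2 (lexx 0) ltr01.
have [_ _ _ g1] := gD; rewrite subr0 g1 => <-.
by apply: EU_eq => u /I01P/andP[u0 _]; rewrite u0 mulr1.
Qed.

End primitive.

(** * The family of projections along a ray *)

Section real_estimates.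
Variable R : realFieldType.
Implicit Types a b x y S s D e : R.

Lemma sqr_inj_ge0 a b : 0 <= a -> 0 <= b -> a ^+ 2 = b ^+ 2 -> a = b.
Proof. by move=> a0 b0 /eqP; rewrite eqrXn2// => /eqP. Qed.

Lemma le_of_sqr_le_mul a b : 0 <= a -> 0 <= b -> a ^+ 2 <= a * b -> a <= b.
Proof.
rewrite le_eqVlt => /orP[/eqP<-//|a0] b0.
by rewrite expr2 ler_pM2l.
Qed.

(** Continuity of [slope_c] in abstract form: [S] and [S'] are the deviations of two projections,
    [x] and [y] their covariances with [q], [s] the deviation of [q], and [D] the distance of the
    multipliers. *)
Lemma quotient_close S s e : 0 < S -> 0 <= s -> 0 < e ->
  exists2 d, 0 < d & forall D x y S', 0 <= D -> D < d -> `|S' - S| <= D * s ->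
    `|x - y| <= s * (D * s) -> `|x| <= s * S -> `|x / S - y / S'| < e.
Proof.
move=> S0 s0 e0.
pose M := 4 * (s ^+ 2 + s + 1).
have M0 : 0 < M by rewrite /M mulr_gt0// ltr_wpDl// addr_ge0// sqr_ge0.
have q1 : 0 < 2 * (s + 1) by rewrite mulr_gt0// ltr_wpDl.
(* The first bound keeps [S' > S / 2]; the second makes [4 * (D * s ^+ 2) < e * S], which controls
   the difference of the quotients. *)
exists (Num.min (S / (2 * (s + 1))) (e * S / M)).
  by rewrite lt_min !divr_gt0// mulr_gt0.
move=> D x y S' D0; rewrite lt_min ltr_pdivlMr// ltr_pdivlMr// => /andP[D1 D2] SS' C1 C2.
have Ds : 0 <= D * s by rewrite mulr_ge0.
have S'2 : S / 2 < S'.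
  by move: SS'; rewrite ler_norml => /andP[+ _]; lra.
have S'0 : 0 < S' by lra.
have -> : x / S - y / S' = (x * (S' - S) + S * (x - y)) / (S * S').
  by field; rewrite !gt_eqF.
rewrite normrM [X in _ * X]gtr0_norm ?invr_gt0 ?mulr_gt0//.
rewrite ltr_pdivrMr ?mulr_gt0//.
apply: le_lt_trans (ler_normD _ _) _; rewrite !normrM [X in _ + X * _]gtr0_norm//.
apply: (@le_lt_trans _ _ (s * S * (D * s) + S * (s * (D * s)))).
  apply: lerD; first by apply: ler_pM.
  by apply: ler_wpM2l => //; exact: ltW.
have -> : s * S * (D * s) + S * (s * (D * s)) = S * (2 * (D * s ^+ 2)) by ring.
rewrite [X in _ < X]mulrCA ltr_pM2l//.
apply: (@lt_trans _ _ (e * (S / 2))); last by rewrite ltr_pM2l.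
suff : 4 * (D * s ^+ 2) < e * S by lra.
apply: le_lt_trans D2; have : 0 <= D * (s + 1) by rewrite mulr_ge0// addr_ge0.
by rewrite /M; lra.
Qed.

End real_estimates.

Section ray.
Variable R : realType.
Implicit Types f h c q : R -> R.
Implicit Types k : R -> R -> R.
Local Notation I01 := (@I01 R).
Local Opaque covU EU stdU.

Definition ray c q (l u : R) : R := c u + l * q u.

(** The study of the ray is carried out for any square-integrable [c] and any [q] of positive
    variance in the cone. *)
Definition proj_family c q k : Prop :=
  [/\ L2 c, Kcone q, 0 < covU q q &
      forall l, 0 <= l -> isoproj (ray c q l) (k l)].

(** The covariance of [c] with the normalised projection; for [c] and [q] these are the coordinates
    of the touching point. *)
Definition slope_c c k (l : R) : R := covU c (k l) / stdU (k l).

Lemma stdU_gt0 k (l : R) : Kcone (k l) -> ~ constant01 (k l) <-> 0 < stdU (k l).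
Proof.
move=> kK; rewrite K_nonconst_var// -sqr_stdU; split=> [|H]; last exact: exprn_gt0.
by rewrite exprn_even_gt0//= => H; rewrite lt_def H stdU_ge0.
Qed.

Lemma L2_ray c q (l : R) : L2 c -> Kcone q -> L2 (ray c q l).
Proof. by move=> c2 qK; exact: (L2D c2 (L2Z l (K_L2 qK))). Qed.

Lemma cov_ray c q (l : R) h : L2 c -> Kcone q -> L2 h ->
  covU (ray c q l) h = covU c h + l * covU q h.
Proof.
move=> c2 qK h2; have q2 := K_L2 qK.
by rewrite (covDl c2 (L2Z l q2) h2) (covZl _ q2 h2).
Qed.

Lemma family_K c q k l : proj_family c q k -> 0 <= l -> Kcone (k l).
Proof. by case=> _ _ _ H /H[]. Qed.

Lemma family_le c q k l h : proj_family c q k -> 0 <= l -> Kcone h ->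
  covU c h + l * covU q h <= covU (k l) h.
Proof.
move=> [c2 qK _ kP] l0 hK; rewrite -(cov_ray l c2 qK (K_L2 hK)).
exact: isoproj_le (L2_ray l c2 qK) (kP l l0) hK.
Qed.

Lemma family_le_std c q k l h : proj_family c q k -> 0 <= l -> Kcone h ->
  covU c h + l * covU q h <= stdU (k l) * stdU h.
Proof.
move=> kF l0 hK; apply: le_trans (family_le kF l0 hK) _.
exact: cov_le (K_L2 (family_K kF l0)) (K_L2 hK).
Qed.

Lemma family_self c q k l : proj_family c q k -> 0 <= l ->
  covU c (k l) + l * covU q (k l) = stdU (k l) ^+ 2.
Proof.
move=> kF l0; have [c2 qK _ kP] := kF; have k2 := K_L2 (family_K kF l0).
rewrite -(cov_ray l c2 qK k2) sqr_stdU.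
exact: isoproj_self (L2_ray l c2 qK) (kP l l0).
Qed.

Lemma family_slope c q k l : proj_family c q k -> 0 <= l -> 0 < stdU (k l) ->
  slope_c c k l + l * slope_c q k l = stdU (k l).
Proof.
move=> kF l0; have := family_self kF l0; rewrite /slope_c.
move: (stdU (k l)) (covU c (k l)) (covU q (k l)) => S C Q H S0.
by rewrite mulrA -mulrDl H expr2 mulfK// lt0r_neq0.
Qed.

Lemma family_slope_le c q k l l' : proj_family c q k -> 0 <= l -> 0 <= l' ->
  0 < stdU (k l') -> slope_c c k l' + l * slope_c q k l' <= stdU (k l).
Proof.
move=> kF l0 l'0; have := family_le_std kF l0 (family_K kF l'0); rewrite /slope_c.
move: (stdU (k l')) (stdU (k l)) (covU c (k l')) (covU q (k l')) => S' S C Q H S0.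
by rewrite mulrA -mulrDl ler_pdivrMr.
Qed.

(** Equality case of Cauchy-Schwarz: the variance of [stdU (k l) * h - stdU h * k l] is a
    non-negative multiple of [stdU (k l) * stdU h - covU (k l) h]. Cross-multiplying avoids dividing
    by a deviation. *)
Lemma family_eq c q k l h : proj_family c q k -> 0 <= l -> Kcone h ->
  stdU (k l) * stdU h <= covU c h + l * covU q h ->
  forall u, I01 u -> stdU (k l) * (h u - EU h) = stdU h * (k l u - EU (k l)).
Proof.
move=> kF l0 hK eqh u uI; have kK := family_K kF l0.
have k2 := K_L2 kK; have h2 := K_L2 hK.
have Sh0 := stdU_ge0 h; have Sk0 := stdU_ge0 (k l).
have le1 := le_trans eqh (family_le kF l0 hK).
have xK := KZ Sk0 hK; have yK := KZ Sh0 kK.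
have V0 : covU (fun u => stdU (k l) * h u - stdU h * k l u)
    (fun u => stdU (k l) * h u - stdU h * k l u) = 0.
  apply/eqP; rewrite eq_le var_ge0 andbT (varBE (K_L2 xK) (K_L2 yK)).
  rewrite (covZl _ h2 (K_L2 xK)) (covZr _ h2 h2) (covZl _ h2 (K_L2 yK)) (covZr _ h2 k2).
  rewrite (covZl _ k2 (K_L2 yK)) (covZr _ k2 k2) -!sqr_stdU (covC h (k l)).
  move: le1 Sh0 Sk0; move: (covU (k l) h) (stdU h) (stdU (k l)) => C a b le1 a0 b0.
  have -> : b * (b * a ^+ 2) - 2 * (b * (a * C)) + a * (a * b ^+ 2) =
     - (2 * (a * b) * (C - b * a)) by ring.
  by rewrite oppr_le0 mulr_ge0 ?subr_ge0// mulr_ge0// mulr_ge0.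
have := K_varB_eq0 xK yK V0 uI; rewrite (EUZ _ (L2_L1 h2)) (EUZ _ (L2_L1 k2)).
by clear; move: (stdU (k l)) (stdU h) (EU h) (EU (k l)) => a b x y; rewrite !mulrBr.
Qed.

Lemma slope_homo c q k l l' : proj_family c q k -> 0 <= l -> l < l' ->
  0 < stdU (k l) -> 0 < stdU (k l') -> slope_c q k l <= slope_c q k l'.
Proof.
move=> kF l0 ll' S0 S'0; have l'0 := le_trans l0 (ltW ll').
have := family_slope_le kF l0 l'0 S'0; rewrite -(family_slope kF l0 S0).
have := family_slope_le kF l'0 l0 S0; rewrite -(family_slope kF l'0 S'0).
move: (slope_c c k l) (slope_c c k l') (slope_c q k l) (slope_c q k l') => t t' r r'.
clear -ll'; move=> H1 H2; have ll : 0 < l' - l by rewrite subr_gt0.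
by rewrite -subr_ge0 -(pmulr_rge0 _ ll) mulrBr !mulrBl; lra.
Qed.

Lemma stdU_triangle f h : L2 f -> L2 h -> stdU f <= stdU (fun u => f u - h u) + stdU h.
Proof.
move=> f2 h2; have d2 := L2B f2 h2.
apply: (le_of_sqr_le_mul (stdU_ge0 f)).
  exact: addr_ge0 (stdU_ge0 _) (stdU_ge0 _).
have E : covU f f = covU (fun u => f u - h u) f + covU h f.
  by rewrite (covBl f2 h2 f2) subrK.
rewrite sqr_stdU E mulrDr (covC _ f) (covC h f).
exact: lerD (cov_le f2 d2) (cov_le f2 h2).
Qed.

Lemma stdUN f h : L2 f -> L2 h -> stdU (fun u => f u - h u) = stdU (fun u => h u - f u).
Proof.
move=> f2 h2; apply: (sqr_inj_ge0 (stdU_ge0 _) (stdU_ge0 _)).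
rewrite (sqr_stdU (fun u => f u - h u)) (sqr_stdU (fun u => h u - f u)).
rewrite (varBE f2 h2) (varBE h2 f2) (covC h f).
by move: (covU f f) (covU f h) (covU h h) => x y z; ring.
Qed.

(** Testing each projection against the other and adding the two self-pairing identities bounds the
    variance of the difference by [(l - l')] times its covariance with [q]; Cauchy-Schwarz then
    cancels one factor. *)
Lemma family_lip c q k l l' : proj_family c q k -> 0 <= l -> 0 <= l' ->
  stdU (fun u => k l u - k l' u) <= `|l - l'| * stdU q.
Proof.
move=> kF l0 l'0; have [c2 qK _ _] := kF; have q2 := K_L2 qK.
have kK := family_K kF l0; have k'K := family_K kF l'0.
have k2 := K_L2 kK; have k'2 := K_L2 k'K; have d2 := L2B k2 k'2.
apply: (le_of_sqr_le_mul (stdU_ge0 _)).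
  exact: mulr_ge0 (normr_ge0 _) (stdU_ge0 _).
have H : covU (fun u => k l u - k l' u) (fun u => k l u - k l' u) <=
    (l - l') * covU q (fun u => k l u - k l' u).
  have := family_le kF l0 k'K; have := family_le kF l'0 kK.
  have := family_self kF l0; have := family_self kF l'0.
  rewrite (sqr_stdU (k l)) (sqr_stdU (k l')) (varBE k2 k'2) (covBr q2 k2 k'2).
  rewrite (covC (k l') (k l)).
  move: (covU c (k l)) (covU c (k l')) (covU q (k l)) (covU q (k l')).
  move: (covU (k l) (k l)) (covU (k l) (k l')) (covU (k l') (k l')).
  by clear; move=> *; rewrite mulrBr !mulrBl; lra.
rewrite sqr_stdU mulrCA; apply: le_trans H _; apply: le_trans (ler_norm _) _.
rewrite normrM; apply: (ler_wpM2l (normr_ge0 _)); rewrite (mulrC _ (stdU q)).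
exact: norm_cov_le q2 d2.
Qed.

Lemma slope_continuous c q k l : proj_family c q k -> 0 <= l -> 0 < stdU (k l) ->
  forall e, 0 < e -> exists2 d, 0 < d & forall l', 0 <= l' -> `|l - l'| < d ->
    `|slope_c q k l - slope_c q k l'| < e.
Proof.
move=> kF l0 S0 e e0; have [c2 qK q0 _] := kF; have q2 := K_L2 qK.
have k2 := K_L2 (family_K kF l0).
have [d d0 Hd] := quotient_close S0 (stdU_ge0 q) e0; exists d => // l' l'0 ll'.
have k'2 := K_L2 (family_K kF l'0); have lip := family_lip kF l0 l'0.
apply: (Hd `|l - l'| _ _ _ (normr_ge0 _) ll').
- have := stdU_triangle k2 k'2; have := stdU_triangle k'2 k2; rewrite (stdUN k'2 k2).
  rewrite ler_norml; move: lip; move: (`|l - l'| * stdU q) => X; gen_lra.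
- rewrite -(covBr q2 k2 k'2); apply: le_trans (norm_cov_le q2 (L2B k2 k'2)) _.
  by apply: ler_wpM2l; [exact: stdU_ge0|exact: lip].
- exact: norm_cov_le q2 k2.
Qed.

(** Optimality of [k l] is tested against [q] itself. Both terms involving [c] are at most [stdU c]
    in size after normalisation, and they are divided by [l], so the correlation with [q] tends to
    1. *)
Lemma slope_lower c q k l : proj_family c q k -> 0 < l -> 0 < stdU (k l) ->
  stdU q - 2 * stdU c / l <= slope_c q k l.
Proof.
move=> kF lp S0; have [c2 qK q0 _] := kF; have q2 := K_L2 qK.
have l0 := ltW lp; have k2 := K_L2 (family_K kF l0).
have Sq : 0 < stdU q by rewrite lt_def stdU_ge0 andbT -sqrf_eq0 sqr_stdU gt_eqF.
have H1 := family_le_std kF l0 qK; rewrite -(family_slope kF l0 S0) -sqr_stdU in H1.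
have : - (stdU c * stdU q) <= covU c q.
  by have := norm_cov_le c2 q2; rewrite ler_norml => /andP[].
have : slope_c c k l <= stdU c.
  by rewrite /slope_c (ler_pdivrMr _ _ S0); exact: cov_le c2 k2.
move: H1; move: (slope_c c k l) (slope_c q k l) (covU c q) (stdU c) (stdU q) Sq.
clear -lp; move=> t r C sc s s0 H1 tc Cc.
have H2 : (l * s - 2 * sc) * s <= (l * r) * s.
  have : t * s <= sc * s by rewrite ler_pM2r.
  by lra.
rewrite ler_pM2r// in H2.
rewrite -(ler_pM2l lp) mulrBr mulrCA divff ?gt_eqF// mulr1; lra.
Qed.

(* Equal slopes force [k l2] to be a positive multiple of [k l1] up to a
   constant; the difference of the residuals [ray l2 - k l2] and
   [ray l1 - k l1] then pairs non-negatively with the cone, and moving down the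
   ray keeps the projection on the same half-line. *)
Lemma slope_flat c q k l1 l2 : proj_family c q k -> 0 <= l1 -> l1 < l2 ->
  0 < stdU (k l1) -> 0 < stdU (k l2) -> slope_c q k l1 = slope_c q k l2 ->
  forall l, 0 <= l -> l < l1 -> 0 < stdU (k l) -> slope_c q k l = slope_c q k l1.
Proof.
move=> kF l10 l12 S1 S2 req l l0 ll1 S0; have [c2 qK q0 kP] := kF; have q2 := K_L2 qK.
have l20 := le_trans l10 (ltW l12).
have k1K := family_K kF l10; have k2K := family_K kF l20; have kK := family_K kF l0.
have k12 := K_L2 k1K; have k22 := K_L2 k2K; have k2 := K_L2 kK.
pose b := stdU (k l2) / stdU (k l1).
have b0 : 0 < b := divr_gt0 S2 S1.
have bS : stdU (k l1) * b = stdU (k l2).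
  by rewrite /b mulrC; exact: (divfK (lt0r_neq0 S1)).
(* With equal slopes on [q], the support inequality at [l2] orders the slopes on [c]; hence the
   normalised [k l2] also attains the bound at [l1], which is the equality case of [family_eq]. *)
have eq12 : stdU (k l1) * stdU (k l2) <= covU c (k l2) + l1 * covU q (k l2).
  have := family_slope_le kF l20 l10 S1; have := family_slope kF l10 S1.
  have := family_slope kF l20 S2; rewrite req /slope_c.
  move: S2; move: (covU c (k l1) / stdU (k l1)) (covU c (k l2)) (covU q (k l2)) => t C Q.
  move: (stdU (k l1)) (stdU (k l2)) => s1 s2; clear => s20 H1 H2 H3.
  rewrite -ler_pdivlMr// mulrDl; move: H1 H2 H3; rewrite -mulrA.
  by move: (C / s2) (Q / s2) => x y; lra.
have k2E u : I01 u -> k l2 u - EU (k l2) = b * (k l1 u - EU (k l1)).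
  move=> uI; apply: (mulfI (lt0r_neq0 S1)); rewrite mulrA bS.
  exact: family_eq kF l10 k2K eq12 u uI.
have covk2 h : L2 h -> covU (k l2) h = b * covU (k l1) h.
  move=> h2; rewrite -(cov_affinel b (EU (k l2) - b * EU (k l1)) k12 h2).
  by apply: cov_eq; [move=> u uI; have := k2E u uI; gen_lra|move=> *; reflexivity].
pose w1 u := ray c q l1 u - k l1 u; pose w2 u := ray c q l2 u - k l2 u.
have r12 := L2_ray l1 c2 qK; have r22 := L2_ray l2 c2 qK.
have w12 : L2 w1 := L2B r12 k12; have w22 : L2 w2 := L2B r22 k22.
have w1pol h : Kcone h -> covU w1 h <= 0.
  move=> hK; rewrite (covBl r12 k12 (K_L2 hK)) subr_le0.
  exact: isoproj_le r12 (kP l1 l10) hK.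
have w2pol h : Kcone h -> covU w2 h <= 0.
  move=> hK; rewrite (covBl r22 k22 (K_L2 hK)) subr_le0.
  exact: isoproj_le r22 (kP l2 l20) hK.
have w1k : covU w1 (k l1) = 0.
  by rewrite (covBl r12 k12 k12) (isoproj_self r12 (kP l1 l10)) subrr.
have w2k : covU w2 (k l1) = 0.
  have : covU w2 (k l2) = 0.
    by rewrite (covBl r22 k22 k22) (isoproj_self r22 (kP l2 l20)) subrr.
  rewrite covC (covk2 _ w22) covC => H.
  by apply: (mulfI (lt0r_neq0 b0)); rewrite mulr0; exact: H.
pose d u := w2 u - w1 u; have d2 : L2 d := L2B w22 w12.
(* Up to a constant, [d] is [(l2 - l1) q - (b - 1) k l1], so it inherits the monotonicity of [q]
   wherever [k l1] is constant. *)
have dpos h : Kcone h -> 0 <= covU d h.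
  apply: (cov_ge0_of_levels d2 k1K).
  - move=> u v uI vI uv kuv; rewrite /d /w1 /w2 /ray.
    have := k2E u uI; have := k2E v vI; rewrite kuv.
    have : (l2 - l1) * q u <= (l2 - l1) * q v.
      by apply: ler_wpM2l; [rewrite subr_ge0 ltW|exact: K_mono].
    by rewrite !mulrBl; gen_lra.
  - move=> x; have x2 := K_L2 (K_indic_gt x k1K).
    rewrite (covBl w22 w12 x2) (polar_level_gt x w22 w2pol k1K w2k).
    by rewrite (polar_level_gt x w12 w1pol k1K w1k) subrr.
  - move=> x; have x2 := L2_indic_ge x k1K.
    rewrite (covBl w22 w12 x2) (polar_level_ge x w22 w2pol k1K w2k).
    by rewrite (polar_level_ge x w12 w1pol k1K w1k) subrr.
(* Solving for [q] in terms of [d] and [k l1] writes [ray c q l], up to a constant, as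
   [a * k l1 + w1 - t * d]. The last two terms pair non-positively with the cone and vanish on
   [k l1], so [a * k l1] is the projection as soon as [a] is positive. *)
pose t := (l1 - l) / (l2 - l1).
have t0 : 0 < t by apply: divr_gt0; rewrite subr_gt0.
pose a := 1 - t * (b - 1).
have rayE h : L2 h -> covU (ray c q l) h = a * covU (k l1) h + (covU w1 h - t * covU d h).
  move=> h2; rewrite (covBl w22 w12 h2) (covBl r12 k12 h2) (covBl r22 k22 h2) (covk2 _ h2).
  rewrite !(cov_ray _ c2 qK h2) /a /t.
  move: (covU c h) (covU q h) (covU (k l1) h) => C Q K1.
  by clear -l12; field; rewrite subr_eq0 gt_eqF.
have wle h : Kcone h -> covU (ray c q l) h <= a * covU (k l1) h.
  move=> hK; rewrite (rayE _ (K_L2 hK)) gerDl.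
  have : 0 <= t * covU d h := mulr_ge0 (ltW t0) (dpos h hK).
  by have := w1pol h hK; gen_lra.
have dk1 : covU d (k l1) = 0 by rewrite (covBl w22 w12 k12) w2k w1k subrr.
have rl2 := L2_ray l c2 qK.
(* If [a <= 0], Chebyshev would make the variance of [k l] non-positive. *)
have [a0|a0] := leP a 0.
  exfalso; have := wle _ kK; rewrite (isoproj_self rl2 (kP l l0)) -sqr_stdU.
  rewrite leNgt => /negP; apply; apply: le_lt_trans (exprn_gt0 2 S0).
  exact: mulr_le0_ge0 a0 (chebyshev k12 k2 (K_mono k1K) (K_mono kK)).
have aK := KZ (ltW a0) k1K.
have V0 := isoproj_unique rl2 (kP l l0) aK.
have {}V0 : covU (fun u => k l u - a * k l1 u) (fun u => k l u - a * k l1 u) = 0.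
  apply: V0.
  - by move=> h hK; rewrite (covZl _ k12 (K_L2 hK)); exact: wle.
  - rewrite (covZl _ k12 (K_L2 aK)) (covZr _ rl2 k12) (covZr _ k12 k12) (rayE _ k12).
    by rewrite w1k dk1 mulr0 subrr addr0.
have kE u : I01 u -> k l u - EU (k l) = a * k l1 u - EU (fun u => a * k l1 u).
  exact: (K_varB_eq0 kK aK V0).
have covkE h : L2 h -> covU (k l) h = a * covU (k l1) h.
  move=> h2; rewrite -(cov_affinel a (EU (k l) - EU (fun u => a * k l1 u)) k12 h2).
  by apply: cov_eq; [move=> u uI; have := kE u uI; gen_lra|move=> *; reflexivity].
have Sk : stdU (k l) = a * stdU (k l1).
  apply: (sqr_inj_ge0 (stdU_ge0 _) (mulr_ge0 (ltW a0) (stdU_ge0 _))).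
  by rewrite exprMn (sqr_stdU (k l)) (sqr_stdU (k l1)) (covkE _ k2) covC (covkE _ k12) mulrA expr2.
rewrite /slope_c (covC q (k l)) (covC q (k l1)) (covkE _ q2) Sk.
move: (covU (k l1) q) (stdU (k l1)) => x y.
by rewrite invfM mulrACA (divff (lt0r_neq0 a0)) mul1r.
Qed.

End ray.

(** * Monotone functions of the multiplier *)

Section multiplier.
Variable R : realType.
Implicit Types r : R -> R.

(** Monotone and bounded below, [r] converges to an infimum, so [lim] is a genuine limit here. The
    two clauses are the form in which [c0] is used. *)
Lemma lim_right_homo r (B : R) :
  (forall l l', 0 < l -> l < l' -> r l <= r l') -> (forall l, 0 < l -> B <= r l) ->
  let c := lim (r @ 0^'+) in
  (forall l, 0 < l -> c <= r l) /\
  (forall x d, c < x -> 0 < d -> exists l, [/\ 0 < l, l < d & r l < x]).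
Proof.
move=> rm rB c.
have rm' l l' : 0 < l -> l <= l' -> r l <= r l'.
  by move=> l0; rewrite le_eqVlt => /orP[/eqP->//|]; exact: rm.
have cv : r x @[x --> 0^'+] --> inf [set r x | x in `]0, 1[].
  apply: (@nondecreasing_at_right_cvgr _ r 0 (BLeft 1)) => //.
  - by rewrite bnd_simp.
  - by move=> x y; rewrite !in_itv/= => /andP[x0 _] _; exact: rm'.
  - by exists B => _ [x /= + <-]; rewrite in_itv/= => /andP[x0 _]; exact: rB.
have cE : c = inf [set r x | x in `]0, 1[] by apply: cvg_lim cv.
have lb : has_lbound [set r x | x in `]0, 1[].
  by exists B => _ [x /= + <-]; rewrite in_itv/= => /andP[x0 _]; exact: rB.
have ne : [set r x | x in `]0, 1[] !=set0.
  by exists (r (1 / 2)), (1 / 2) => //=; rewrite in_itv/=; lra.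
split=> [l l0|x d cx d0].
  apply: (@le_trans _ _ (r (Num.min l (1 / 2)))).
    rewrite cE; apply: ge_inf => //; exists (Num.min l (1 / 2)) => //=.
    by rewrite in_itv/= lt_min l0 gt_min; apply/andP; split; lra.
  by apply: rm'; rewrite ?ge_min ?lexx// lt_min l0; lra.
have e0 : 0 < x - c by rewrite subr_gt0.
have [_ [l /= + <-] rl] := inf_adherent e0 (conj ne lb).
rewrite in_itv/= => /andP[l0 _]; exists (Num.min l (d / 2)); split.
- by rewrite lt_min l0; lra.
- by rewrite gt_min; apply/orP; right; lra.
- apply: (@le_lt_trans _ _ (r l)); last by move: rl; rewrite -cE; lra.
  by apply: rm'; rewrite ?ge_min ?lexx// lt_min l0; lra.
Qed.

Lemma homo_crossing r (t l1 l2 : R) : 0 < l1 -> l1 <= l2 ->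
  (forall l, 0 < l -> forall e, 0 < e -> exists2 d, 0 < d &
     forall l', 0 <= l' -> `|l - l'| < d -> `|r l - r l'| < e) ->
  r l1 <= t <= r l2 -> exists2 l, 0 < l & r l = t.
Proof.
move=> l10 l12 rc /andP[t1 t2].
have cont : {within `[l1, l2], continuous r}.
  apply: continuous_in_subspaceT => x; rewrite inE/= in_itv/= => /andP[x1 _].
  have x0 := lt_le_trans l10 x1.
  apply/cvgrPdist_lt => e e0; have [d d0 Hd] := rc x x0 e e0.
  near=> y; apply: Hd.
    by apply/ltW; near: y; exact: lt_nbhsr.
  by near: y; exact: cvgr_dist_lt.
have t12 : Num.min (r l1) (r l2) <= t <= Num.max (r l1) (r l2).
  by rewrite ge_min t1 le_max t2 orbT.
have [l + rl] := IVT l12 cont t12; rewrite in_itv/= => /andP[ll _].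
by exists l => //; exact: lt_le_trans ll.
Unshelve. all: by end_near. Qed.

(** The constant may blow up towards [lo], as the multiplier can do there, but it must serve the
    whole interval from [e1] up to [hi]. *)
Lemma local_lipschitz_continuous (V : R -> R) (lo hi : R) :
  (forall e0, lo < e0 < hi -> exists M e1, [/\ 0 <= M, lo < e1 < e0 &
     forall e e', e1 < e -> e <= e' -> e' < hi -> 0 <= V e' - V e <= M * (e' - e)]) ->
  {within `]lo, hi[%classic, continuous V}.
Proof.
move=> H; apply: continuous_in_subspaceT => x; rewrite inE/= in_itv/= => x01.
have [M [e1 [M0 /andP[le1 e1x] HM]]] := H x x01; case/andP: x01 => lox xhi.
apply/cvgrPdist_lt => e e0.
have M1 : 0 < M + 1 by rewrite ltr_wpDl.
near=> y.
have y1 : e1 < y by near: y; exact: lt_nbhsr.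
have y2 : y < hi by near: y; exact: lt_nbhsl.
have yx : `|x - y| < e / (M + 1) by near: y; apply: cvgr_dist_lt => //; exact: divr_gt0.
rewrite ltr_pdivlMr// in yx.
have [xy|xy] := leP x y.
  have /andP[V0 V1] := HM _ _ e1x xy y2.
  rewrite distrC ger0_norm//; apply: le_lt_trans V1 _; move: yx.
  rewrite distrC ger0_norm ?subr_ge0// mulrDr mulr1 mulrC; apply: le_lt_trans.
  by rewrite lerDl subr_ge0.
have /andP[V0 V1] := HM _ _ y1 (ltW xy) xhi.
rewrite ger0_norm//; apply: le_lt_trans V1 _; move: yx.
rewrite gtr0_norm ?subr_gt0// mulrDr mulr1 mulrC; apply: le_lt_trans.
by rewrite lerDl subr_ge0 ltW.
Unshelve. all: by end_near. Qed.

End multiplier.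

(** * Optimality of the normalised projections *)

Section optimality.
Variable R : realType.
Implicit Types g F G h : R -> R.
Local Notation I01 := (@I01 R).
Local Opaque covU EU stdU.

Lemma kup_family g F : M2 F -> 0 < stdD F -> L2 (gam g) ->
  proj_family (gam g) (quantile F) (kup g F).
Proof.
move=> FM sF g2; have qK := quantile_K FM; split.
- exact: g2.
- exact: qK.
- by rewrite -sqr_stdU; exact: exprn_gt0.
- move=> l _; apply: (@xgetPex _ _ (isoproj (ray (gam g) (quantile F) l))).
  exact: isoproj_exists (L2_ray l g2 qK).
Qed.

(** Tested at [k l], the ray at [l'] has covariance Var (k l) plus [(l' - l)] times cov (q, k l),
    and the latter is non-negative by Chebyshev. *)
Lemma ray_nonconst c q k (l l' : R) : proj_family c q k -> 0 <= l -> l < l' ->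
  ~ constant01 (k l) -> ~ constant01 (k l').
Proof.
move=> kF l0 ll' nc; have [c2 qK q0 kP] := kF.
have l'0 := le_trans l0 (ltW ll'); have kK := family_K kF l0; have k2 := K_L2 kK.
apply: (isoproj_nonconst (L2_ray l' c2 qK) (kP l' l'0) kK).
rewrite (cov_ray l' c2 qK k2).
have : 0 < covU c (k l) + l * covU q (k l).
  rewrite (family_self kF l0) sqr_stdU; exact/(K_nonconst_var kK).
have : 0 <= (l' - l) * covU q (k l).
  apply: mulr_ge0; first by rewrite subr_ge0 ltW.
  exact: chebyshev (K_L2 qK) k2 (K_mono qK) (K_mono kK).
by rewrite mulrBl; gen_lra.
Qed.

Lemma kup_nonconst g F (l : R) : M2 F -> 0 < stdD F -> L2 (gam g) -> A4 g F ->
  0 < l -> 0 < stdU (kup g F l).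
Proof.
move=> FM sF g2 [S0 Sinf] lp; have kF := kup_family FM sF g2.
apply/(stdU_gt0 (family_K kF (ltW lp))).
set S := [set _ | _] in S0 Sinf.
have hS : has_inf S by split=> //; exists 0 => x [].
have [l1 [l10 nc]] := inf_adherent lp hS; rewrite Sinf add0r => l1l.
exact: ray_nonconst kF l10 l1l nc.
Qed.

Lemma sqr_distE (q h : R -> R) : L2 q -> L2 h ->
  EU (fun u => (q u - h u) ^+ 2) =
  (EU q - EU h) ^+ 2 + (stdU q - stdU h) ^+ 2 + 2 * (stdU q * stdU h - covU q h).
Proof.
move=> q2 h2; rewrite (EU_sqr_decomp (L2B q2 h2)) (EUB (L2_L1 q2) (L2_L1 h2)).
rewrite (varBE q2 h2) -(sqr_stdU q) -(sqr_stdU h).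
by move: (stdU q) (stdU h) (EU q) (EU h) (covU q h) => a b x y z; ring.
Qed.

Lemma stdU_eq h (s : R) : 0 <= s -> covU h h = s ^+ 2 -> stdU h = s.
Proof. by move=> s0 H; apply: (sqr_inj_ge0 (stdU_ge0 h) s0); rewrite sqr_stdU. Qed.

Lemma hup_affine g F (mu sigma l : R) : hup g F mu sigma l =
  (fun u => sigma / stdU (kup g F l) * kup g F l u +
     (mu - sigma / stdU (kup g F l) * EU (kup g F l))).
Proof.
apply/funext => u; rewrite /hup; move: (stdU _)^-1 (EU _) (kup g F l u) => a b c.
by ring.
Qed.

Lemma hup_spec g F (mu sigma l : R) : Kcone (kup g F l) -> 0 < sigma ->
  0 < stdU (kup g F l) ->
  [/\ Kcone (hup g F mu sigma l), EU (hup g F mu sigma l) = mu,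
      stdU (hup g F mu sigma l) = sigma &
      forall x, L2 x -> covU x (hup g F mu sigma l) = sigma * slope_c x (kup g F) l].
Proof.
move=> kK s0 S0; have k2 := K_L2 kK; rewrite hup_affine.
have a0 : 0 < sigma / stdU (kup g F l) := divr_gt0 s0 S0.
split.
- exact: K_affine (ltW a0) kK.
- rewrite (EUD (L2_L1 (L2Z _ k2)) (L1_cst _)) (EUZ _ (L2_L1 k2)) EU_cst.
  by rewrite addrC subrK.
- apply: (stdU_eq (ltW s0)).
  rewrite (cov_affinel _ _ k2 (L2_affine _ _ k2)) (cov_affiner _ _ k2 k2) -sqr_stdU.
  move: S0; move: (stdU (kup g F l)) => S; clear => S0.
  by field; rewrite gt_eqF.
- move=> x x2; rewrite (cov_affiner _ _ k2 x2) /slope_c.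
  by rewrite mulrAC mulrA.
Qed.

Lemma HgQE g h : L2 (gam g) -> EU (gam g) = 1 -> L2 h ->
  HgQ g h = EU h + covU (gam g) h.
Proof. by move=> g2 E1 h2; rewrite /HgQ (EU_mul g2 h2) E1 mul1r addrC. Qed.

Lemma MsetE F (mu sigma : R) (eps : \bar R) G : 0 < sigma -> Mset F mu sigma eps G ->
  [/\ Kcone (quantile G), EU (quantile G) = mu, stdU (quantile G) = sigma & dW_le F G eps].
Proof.
move=> s0 [GM Gmean Gsec Gd]; have qK := quantile_K GM; split.
- exact: qK.
- exact: Gmean.
- apply: (stdU_eq (ltW s0)); have := EU_sqr_decomp (K_L2 qK).
  rewrite -/(secmomD G) Gsec -/(meanD G) Gmean => H.
  by apply: (addIr (mu ^+ 2)); rewrite -H addrC.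
- exact: Gd.
Qed.

Lemma Mset_quantile F (mu sigma : R) (eps : \bar R) h : 0 < sigma -> Kcone h ->
  EU h = mu -> stdU h = sigma ->
  (forall r, eps = r%:E -> dWq (quantile F) h <= Num.sqrt r) -> eps != -oo%E ->
  exists G, Mset F mu sigma eps G /\ forall u, I01 u -> quantile G u = h u.
Proof.
move=> s0 hK Eh Sh hd eN; have [G [GM qE]] := K_quantile hK.
exists G; split; last exact: qE.
have E1 : EU (quantile G) = EU h by exact: EU_eq.
split.
- exact: GM.
- by rewrite /meanD E1.
- rewrite /secmomD (EU_sqr_decomp (K_L2 (quantile_K GM))) (cov_eq qE qE) E1 Eh.
  by rewrite -sqr_stdU Sh addrC.
- rewrite /dW_le /dW; case: eps hd eN => [r hd _|//|//].
  have -> : dWq (quantile F) (quantile G) = dWq (quantile F) h; last exact: hd.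
  by congr Num.sqrt; apply: EU_eq => u uI; rewrite qE.
Qed.

Lemma Hg_eq g G h : (forall u, I01 u -> quantile G u = h u) -> Hg g G = HgQ g h.
Proof. by move=> qE; apply: EU_eq => u uI; rewrite qE. Qed.

Lemma supH_max g F (mu sigma : R) (eps : \bar R) G : Mset F mu sigma eps G ->
  (forall G', Mset F mu sigma eps G' -> Hg g G' <= Hg g G) ->
  supH g F mu sigma eps = (Hg g G)%:E.
Proof.
move=> GM Gmax; apply/eqP; rewrite eq_le; apply/andP; split.
  by apply: ge_ereal_sup => _ [G' G'M <-]; rewrite lee_fin; exact: Gmax.
by apply: ereal_sup_ubound; exists G.
Qed.

(** Sufficiency of the Lagrange conditions. The hypothesis before the conclusion is complementary
    slackness: it is trivial for [l = 0], and for [l > 0] it says that no feasible law is less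
    correlated with [F] than the candidate. *)
Lemma hup_optimal g F (mu sigma : R) (eps : \bar R) (l : R) :
  M2 F -> 0 < stdD F -> L2 (gam g) -> EU (gam g) = 1 -> 0 < sigma -> 0 <= l ->
  0 < stdU (kup g F l) -> eps != -oo%E ->
  (forall r, eps = r%:E -> dWq (quantile F) (hup g F mu sigma l) <= Num.sqrt r) ->
  (forall G, Mset F mu sigma eps G ->
     l * (sigma * slope_c (quantile F) (kup g F) l) <= l * covU (quantile F) (quantile G)) ->
  unique_maximiser g F mu sigma eps (hup g F mu sigma l) /\
  supH g F mu sigma eps = (HgQ g (hup g F mu sigma l))%:E.
Proof.
move=> FM sF g2 E1 s0 l0 S0 eN hd hcmp.
have kF := kup_family FM sF g2; have kK := family_K kF l0.
have [hK Eh Sh hcov] := hup_spec mu kK s0 S0; have h2 := K_L2 hK.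
have HhE : HgQ g (hup g F mu sigma l) = mu + sigma * slope_c (gam g) (kup g F) l.
  by rewrite (HgQE g2 E1 h2) Eh (hcov _ g2).
have HGE G : Mset F mu sigma eps G -> Hg g G = mu + covU (gam g) (quantile G).
  move=> /(MsetE s0)[qK Eq _ _]; by rewrite /Hg (HgQE g2 E1 (K_L2 qK)) Eq.
have bnd G : Mset F mu sigma eps G ->
    covU (gam g) (quantile G) + l * covU (quantile F) (quantile G) <=
    sigma * slope_c (gam g) (kup g F) l + l * (sigma * slope_c (quantile F) (kup g F) l).
  move=> /(MsetE s0)[qK _ Sq _]; have := family_le_std kF l0 qK.
  rewrite Sq -(family_slope kF l0 S0).
  move: (slope_c _ _ _) (slope_c _ _ _) (covU _ _) (covU _ _) => t r x y; clear.
  by congr (_ <= _); ring.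
have Gmax G : Mset F mu sigma eps G -> Hg g G <= HgQ g (hup g F mu sigma l).
  move=> GM; rewrite (HGE G GM) HhE; have := bnd G GM; have := hcmp G GM.
  move: (slope_c (gam g) _ _) (slope_c (quantile F) _ _) => t r.
  move: (covU (gam g) _) (covU (quantile F) _) => x y; clear; lra.
have [G [GM GE]] := Mset_quantile s0 hK Eh Sh hd eN.
have HG := Hg_eq g GE.
have sE : supH g F mu sigma eps = (HgQ g (hup g F mu sigma l))%:E.
  rewrite -HG; apply: (supH_max GM) => G' G'M; rewrite HG; exact: Gmax G' G'M.
split; last exact: sE.
split.
  exists G; split; [exact: GM|by rewrite sE HG|].
  by move=> u; rewrite inE; exact: GE.
move=> G' G'M; rewrite sE => -[HG'] u; rewrite inE => uI.
have [qK Eq Sq _] := MsetE s0 G'M.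
have eqb : stdU (kup g F l) * stdU (quantile G') <=
    covU (gam g) (quantile G') + l * covU (quantile F) (quantile G').
  rewrite Sq -(family_slope kF l0 S0); have := hcmp G' G'M.
  move: HG'; rewrite (HGE G' G'M) HhE.
  move: (slope_c (gam g) _ _) (slope_c (quantile F) _ _) => t r.
  move: (covU (gam g) _) (covU (quantile F) _) => x y; clear => H1 H2.
  have : x = sigma * t by lra.
  by move=> ->; rewrite mulrDl; lra.
have := family_eq kF l0 qK eqb uI; rewrite Sq Eq /hup.
move: S0; move: (stdU (kup g F l)) (EU (kup g F l)) (kup g F l u) (quantile G' u).
clear => S E x y S0 H; have -> : sigma * (x - E) = S * (y - mu) by rewrite H.
by rewrite mulrAC divff ?gt_eqF// mul1r addrC subrK.
Qed.

Lemma HgQ_corr g F (mu sigma l : R) : L2 (gam g) -> EU (gam g) = 1 ->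
  Kcone (kup g F l) -> 0 < sigma -> 0 < stdU (kup g F l) ->
  HgQ g (hup g F mu sigma l) =
  mu + sigma * stdU (gam g) * corrU (gam g) (kup g F l).
Proof.
move=> g2 E1 kK s0 S0; have [hK Eh Sh hcov] := hup_spec mu kK s0 S0.
rewrite (HgQE g2 E1 (K_L2 hK)) Eh (hcov _ g2) /slope_c /corrU -mulrA; congr (_ + sigma * _).
(* If [gam g] had no variance, the correlation would be a division by zero, hence 0; the covariance
   vanishes as well, so the formula persists. *)
have z0 : stdU (gam g) = 0 -> covU (gam g) (kup g F l) = 0.
  by move=> z; apply: (var_eq0_cov g2 (K_L2 kK)); rewrite -sqr_stdU z expr0n.
move: z0; move: (stdU (gam g)) (covU (gam g) (kup g F l)) (stdU (kup g F l)) => s C S.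
clear => z0; have [s0|sn] := eqVneq s 0; first by rewrite s0 z0// !mul0r.
by rewrite invfM [in RHS]mulrCA mulVKf.
Qed.

Lemma corr_slope (q : R -> R) (k : R -> R -> R) (l : R) :
  corrU q (k l) = slope_c q k l / stdU q.
Proof. by rewrite /corrU /slope_c invfM mulrCA mulrC. Qed.

Lemma dWq_hup g F (mu sigma l : R) : M2 F -> Kcone (kup g F l) -> 0 < stdD F ->
  0 < sigma -> 0 < stdU (kup g F l) ->
  dWq (quantile F) (hup g F mu sigma l) =
  Num.sqrt ((meanD F - mu) ^+ 2 + (stdD F - sigma) ^+ 2 +
    2 * sigma * stdD F * (1 - corrU (quantile F) (kup g F l))).
Proof.
move=> FM kK sF s0 S0; have q2 := K_L2 (quantile_K FM).
have [hK Eh Sh hcov] := hup_spec mu kK s0 S0.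
congr Num.sqrt; rewrite (sqr_distE q2 (K_L2 hK)) Eh Sh (hcov _ q2) corr_slope.
rewrite /meanD; congr (_ + _); move: sF; rewrite /stdD.
move: (stdU (quantile F)) (slope_c (quantile F) (kup g F) l) => s r; clear => s0.
by field; rewrite gt_eqF.
Qed.

Lemma Mset_cov F (mu sigma e : R) G : M2 F -> 0 < sigma -> 0 <= e ->
  Mset F mu sigma e%:E G ->
  2 * (stdD F * sigma - covU (quantile F) (quantile G)) <=
    e - ((meanD F - mu) ^+ 2 + (stdD F - sigma) ^+ 2).
Proof.
move=> FM s0 e0 GM; have q2 := K_L2 (quantile_K FM).
have [qK Eq Sq] := MsetE s0 GM; rewrite /dW_le /dW /dWq ler_sqrt//.
by rewrite (sqr_distE q2 (K_L2 qK)) Eq Sq /meanD /stdD; gen_lra.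
Qed.

End optimality.

(** * Existence and uniqueness of the multiplier, continuity of the value, the constant case *)

Section main_results.
Variable R : realType.

Lemma budget_level (lo e c D : R) : 0 < D -> lo < e -> e < lo + D * (1 - c) ->
  exists t, [/\ c < t, t < 1 & e = lo + D * (1 - t)].
Proof.
move=> D0 lo_e e_hi; exists (1 - (e - lo) / D); split.
- by rewrite ltrBrDl -ltrBrDr ltr_pdivrMr// mulrC ltrBlDl.
- by rewrite gtrBl divr_gt0// subr_gt0.
- by rewrite subKr mulrC divfK ?gt_eqF// addrC subrK.
Qed.

Implicit Types g F G h : R -> R.
Local Notation I01 := (@I01 R).
Local Opaque covU EU stdU.

Lemma corr_homo g F (l l' : R) : M2 F -> 0 < stdD F -> L2 (gam g) -> A4 g F ->
  0 < l -> l < l' ->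
  corrU (quantile F) (kup g F l) <= corrU (quantile F) (kup g F l').
Proof.
move=> FM sF g2 a4 l0 ll'; have kF := kup_family FM sF g2.
rewrite !corr_slope; apply: ler_wpM2r; first by rewrite invr_ge0 stdU_ge0.
apply: (slope_homo kF (ltW l0) ll'); first exact: (kup_nonconst FM sF g2 a4 l0).
exact: (kup_nonconst FM sF g2 a4 (lt_trans l0 ll')).
Qed.

Lemma corr_ge0 g F (l : R) : M2 F -> 0 < stdD F -> L2 (gam g) -> 0 <= l ->
  0 <= corrU (quantile F) (kup g F l).
Proof.
move=> FM sF g2 l0; have kF := kup_family FM sF g2; have kK := family_K kF l0.
have qK := quantile_K FM.
apply: divr_ge0; first exact: chebyshev (K_L2 qK) (K_L2 kK) (K_mono qK) (K_mono kK).
exact: mulr_ge0 (stdU_ge0 _) (stdU_ge0 _).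
Qed.

Lemma corr_le1 g F (l : R) : M2 F -> 0 < stdD F -> L2 (gam g) -> 0 <= l ->
  0 < stdU (kup g F l) -> corrU (quantile F) (kup g F l) <= 1.
Proof.
move=> FM sF g2 l0 S0; have kF := kup_family FM sF g2; have kK := family_K kF l0.
rewrite /corrU (ler_pdivrMr _ _ (mulr_gt0 sF S0)) mul1r.
exact: cov_le (K_L2 (quantile_K FM)) (K_L2 kK).
Qed.

Lemma corr_continuous g F (l : R) : M2 F -> 0 < stdD F -> L2 (gam g) -> 0 <= l ->
  0 < stdU (kup g F l) -> forall e, 0 < e -> exists2 d, 0 < d &
     forall l', 0 <= l' -> `|l - l'| < d ->
       `|corrU (quantile F) (kup g F l) - corrU (quantile F) (kup g F l')| < e.
Proof.
move=> FM sF g2 l0 S0 e e0; have kF := kup_family FM sF g2.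
have [d d0 Hd] := slope_continuous kF l0 S0 (mulr_gt0 e0 sF).
exists d; first exact: d0.
move=> l' l'0 /(Hd l' l'0).
rewrite (corr_slope (quantile F) (kup g F) l) (corr_slope (quantile F) (kup g F) l').
move: sF; rewrite /stdD; move: (stdU (quantile F)) => s.
move: (slope_c (quantile F) (kup g F) l) (slope_c (quantile F) (kup g F) l') => x y.
clear => s0 H; rewrite -mulrBl normrM [X in _ * X]gtr0_norm ?invr_gt0//.
by rewrite ltr_pdivrMr.
Qed.

Lemma c0_spec g F : M2 F -> 0 < stdD F -> L2 (gam g) -> A4 g F ->
  (forall l, 0 < l -> c0 g F <= corrU (quantile F) (kup g F l)) /\
  (forall x d, c0 g F < x -> 0 < d ->
     exists l, [/\ 0 < l, l < d & corrU (quantile F) (kup g F l) < x]).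
Proof.
move=> FM sF g2 a4; apply: (@lim_right_homo _ _ 0).
- by move=> l l' l0 ll'; exact: (corr_homo FM sF g2 a4 l0 ll').
- by move=> l l0; exact: (corr_ge0 FM sF g2 (ltW l0)).
Qed.

Lemma corr_large g F (t : R) : M2 F -> 0 < stdD F -> L2 (gam g) -> A4 g F -> t < 1 ->
  exists2 l0, 0 < l0 & forall l, l0 <= l -> t <= corrU (quantile F) (kup g F l).
Proof.
move=> FM sF g2 a4 t1; have kF := kup_family FM sF g2.
have sc := stdU_ge0 (gam g).
(* Beyond this threshold the error [2 * stdU (gam g) / l] of [slope_lower] is at most
   [(1 - t) * stdD F]; the added 1 keeps it positive. *)
have l00 : 0 < 2 * (stdU (gam g) + 1) / ((1 - t) * stdD F).
  have t0 : 0 < 1 - t by rewrite subr_gt0.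
  exact: divr_gt0 (mulr_gt0 (ltr0Sn _ 1) (ltr_wpDl sc ltr01)) (mulr_gt0 t0 sF).
exists (2 * (stdU (gam g) + 1) / ((1 - t) * stdD F)).
  exact: l00.
move=> l Hl; have lp : 0 < l := lt_le_trans l00 Hl.
have := slope_lower kF lp (kup_nonconst FM sF g2 a4 lp).
rewrite corr_slope; move: Hl sF sc; rewrite /stdD.
move: (stdU (quantile F)) (stdU (gam g)) (slope_c _ _ _) => s c r; clear -t1 lp => Hl s0 c0 H.
rewrite ler_pdivlMr//; apply: le_trans H.
have ts : 0 < (1 - t) * s by rewrite mulr_gt0// subr_gt0.
rewrite ler_pdivrMr// in Hl.
rewrite -(ler_pM2l lp) mulrBr [X in _ <= _ - X]mulrC divfK ?gt_eqF//; lra.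
Qed.

Lemma multiplier_exists g F (t : R) : M2 F -> 0 < stdD F -> L2 (gam g) -> A4 g F ->
  c0 g F < t -> t < 1 -> exists2 l, 0 < l & corrU (quantile F) (kup g F l) = t.
Proof.
move=> FM sF g2 a4 ct t1; have [_ near0] := c0_spec FM sF g2 a4.
have [l2 l20 Hl2] := corr_large FM sF g2 a4 t1.
have [l1 [l10 l12 Hl1]] := near0 t l2 ct l20.
apply: (@homo_crossing _ (fun l => corrU (quantile F) (kup g F l)) t l1 l2 l10 (ltW l12)).
- move=> l l0; exact: (corr_continuous FM sF g2 (ltW l0) (kup_nonconst FM sF g2 a4 l0)).
- by rewrite (ltW Hl1) (Hl2 l2 (lexx _)).
Qed.

(** Equality at [l1 < l2] would freeze the correlation on []0, l1]] by [slope_flat], whereas near 0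
    it falls below any value exceeding its limit [c0]. *)
Lemma multiplier_lt g F (l1 l2 : R) : M2 F -> 0 < stdD F -> L2 (gam g) -> A4 g F ->
  0 < l1 -> l1 < l2 -> c0 g F < corrU (quantile F) (kup g F l1) ->
  corrU (quantile F) (kup g F l1) < corrU (quantile F) (kup g F l2).
Proof.
move=> FM sF g2 a4 l10 l12 c1; have kF := kup_family FM sF g2.
rewrite lt_neqAle (corr_homo FM sF g2 a4 l10 l12) andbT; apply/eqP => E.
have [_ near0] := c0_spec FM sF g2 a4.
have [l [l0 ll1 Hl]] := near0 _ _ c1 l10.
have nc x (x0 : 0 < x) := kup_nonconst FM sF g2 a4 x0.
have sE : slope_c (quantile F) (kup g F) l1 = slope_c (quantile F) (kup g F) l2.
  move: E; rewrite !corr_slope => /(divIf (lt0r_neq0 sF)); exact.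
have H := slope_flat kF (ltW l10) l12 (nc _ l10) (nc _ (lt_trans l10 l12)) sE
  (ltW l0) ll1 (nc _ l0).
by move: Hl; rewrite !corr_slope H ltxx.
Qed.

Lemma multiplier_unique g F (l1 l2 : R) : M2 F -> 0 < stdD F -> L2 (gam g) -> A4 g F ->
  0 < l1 -> 0 < l2 -> c0 g F < corrU (quantile F) (kup g F l1) ->
  corrU (quantile F) (kup g F l1) = corrU (quantile F) (kup g F l2) -> l1 = l2.
Proof.
move=> FM sF g2 a4 l10 l20 c1 E; have [l12|l21|] := ltgtP l1 l2; last exact.
  by have := multiplier_lt FM sF g2 a4 l10 l12 c1; rewrite E ltxx.
rewrite E in c1.
by have := multiplier_lt FM sF g2 a4 l20 l21 c1; rewrite E ltxx.
Qed.

Definition eps_lo F (mu sigma : R) : R := (meanD F - mu) ^+ 2 + (stdD F - sigma) ^+ 2.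

Lemma eps_lo_ge0 F (mu sigma : R) : 0 <= eps_lo F mu sigma.
Proof. by rewrite addr_ge0// sqr_ge0. Qed.

Lemma active_constraint g F (mu sigma e : R) : M2 F -> 0 < stdD F ->
  L2 (gam g) -> EU (gam g) = 1 -> A4 g F -> 0 < sigma ->
  eps_lo F mu sigma < e ->
  e < eps_lo F mu sigma + 2 * sigma * stdD F * (1 - c0 g F) ->
  exists l, [/\ 0 < l,
    e = eps_lo F mu sigma +
        2 * sigma * stdD F * (1 - corrU (quantile F) (kup g F l)),
    c0 g F < corrU (quantile F) (kup g F l),
    unique_maximiser g F mu sigma e%:E (hup g F mu sigma l) &
    supH g F mu sigma e%:E = (HgQ g (hup g F mu sigma l))%:E].
Proof.
move=> FM sF g2 E1 a4 s0 lo_e e_hi; set lo := eps_lo F mu sigma in lo_e e_hi *.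
have D0 : 0 < 2 * sigma * stdD F := mulr_gt0 (mulr_gt0 (ltr0Sn _ 1) s0) sF.
have [t [ct t1 et]] := budget_level D0 lo_e e_hi.
have [l l0 rl] := multiplier_exists FM sF g2 a4 ct t1.
have eE : e = lo + 2 * sigma * stdD F * (1 - corrU (quantile F) (kup g F l)).
  by rewrite rl; exact: et.
have S0 := kup_nonconst FM sF g2 a4 l0; have kF := kup_family FM sF g2.
have e0 : 0 <= e := le_trans (eps_lo_ge0 F mu sigma) (ltW lo_e).
have [um sE] : unique_maximiser g F mu sigma e%:E (hup g F mu sigma l) /\
    supH g F mu sigma e%:E = (HgQ g (hup g F mu sigma l))%:E.
  apply: (hup_optimal FM sF g2 E1 s0 (ltW l0) S0); first exact: isT.
  - move=> r [<-]; rewrite (dWq_hup mu FM (family_K kF (ltW l0)) sF s0 S0).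
    by rewrite -/(eps_lo F mu sigma) -eE; exact: lexx.
  - move=> G GM; apply: (ler_wpM2l (ltW l0)); have := Mset_cov FM s0 e0 GM.
    rewrite -/(eps_lo F mu sigma) -/lo {1}eE corr_slope; move: sF; rewrite /stdD.
    move: (covU _ _) (slope_c _ _ _) (stdU (quantile F)) => x r s; clear => sF.
    have -> : lo + 2 * sigma * s * (1 - r / s) - lo = 2 * sigma * (s - r).
      by field; rewrite gt_eqF.
    by lra.
exists l; split; [exact: l0|exact: eE|by rewrite rl; exact: ct|exact: um|exact: sE].
Qed.

Lemma supH_continuous g F (mu sigma : R) : M2 F -> 0 < stdD F ->
  L2 (gam g) -> EU (gam g) = 1 -> A4 g F -> 0 < sigma ->
  let lo := eps_lo F mu sigma in
  let hi := lo + 2 * sigma * stdD F * (1 - c0 g F) in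
  {within `]lo, hi[%classic, continuous (fun e : R => fine (supH g F mu sigma e%:E))}.
Proof.
move=> FM sF g2 E1 a4 s0 lo hi; have kF := kup_family FM sF g2.
have nc x (x0 : 0 < x) := kup_nonconst FM sF g2 a4 x0.
have ac e : lo < e -> e < hi -> exists l, [/\ 0 < l,
    e = lo + 2 * sigma * (stdD F - slope_c (quantile F) (kup g F) l) &
    fine (supH g F mu sigma e%:E) = mu + sigma * slope_c (gam g) (kup g F) l].
  move=> e1 e2; have [l [l0 eE _ _ ->]] := active_constraint FM sF g2 E1 a4 s0 e1 e2.
  exists l; split; first exact: l0.
    apply: (etrans eE); rewrite (corr_slope (quantile F) (kup g F) l) -/lo.
    move: sF; rewrite /stdD; generalize lo.
    move: (slope_c (quantile F) (kup g F) l) (stdU (quantile F)) => r s lo'; clear => s0.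
    by field; rewrite gt_eqF.
  have [hK Eh _ hcov] := hup_spec mu (family_K kF (ltW l0)) s0 (nc l l0).
  by rewrite /= (HgQE g2 E1 (K_L2 hK)) Eh (hcov _ g2).
apply: local_lipschitz_continuous => e0 /andP[lo_e0 e0_hi].
pose e1 := (lo + e0) / 2.
have lo1 : lo < e1 by rewrite /e1; lra.
have e10 : e1 < e0 by rewrite /e1; lra.
have [l1 [l10 e1E _]] := ac e1 lo1 (lt_trans e10 e0_hi).
(* A change of [r] moves [eps] by [2 * sigma] times that change and the value by at most [sigma * l]
   times it, so the local rate is [l / 2]. Multipliers decrease in [eps], so the one at [e1]
   dominates. *)
exists (l1 / 2), e1; split; [exact: divr_ge0 (ltW l10) (ler0n _ _)|by rewrite lo1 e10|].
move=> e e' e1e ee' e'hi.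
have [l [l0 eE ->]] := ac e (lt_trans lo1 e1e) (le_lt_trans ee' e'hi).
have [l' [l'0 e'E ->]] := ac e' (lt_le_trans (lt_trans lo1 e1e) ee') e'hi.
have ll1 : l <= l1.
  rewrite leNgt; apply/negP => l1l.
  have := slope_homo kF (ltW l10) l1l (nc _ l10) (nc _ l0).
  rewrite leNgt => /negP; apply; move: e1e; rewrite eE e1E.
  move: (slope_c _ _ _) (slope_c _ _ _) (stdD F) => x y z; clear -s0.
  by rewrite ltrD2l ltr_pM2l ?mulr_gt0// ltrD2l ltrN2.
have := family_slope_le kF (ltW l0) (ltW l'0) (nc _ l'0).
have := family_slope_le kF (ltW l'0) (ltW l0) (nc _ l0).
rewrite -(family_slope kF (ltW l0) (nc _ l0)) -(family_slope kF (ltW l'0) (nc _ l'0)).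
move: e'E eE; move: (slope_c (gam g) _ l) (slope_c (gam g) _ l').
move: (slope_c (quantile F) _ l) (slope_c (quantile F) _ l') (stdD F).
clear -s0 l0 l'0 ee' ll1 => r r' s t t' e'E eE H1 H2.
have rr : e' - e = 2 * sigma * (r - r') by rewrite e'E eE; ring.
have rr0 : 0 <= r - r'.
  have : 0 <= 2 * sigma * (r - r') by rewrite -rr subr_ge0.
  by rewrite pmulr_rge0// mulr_gt0.
rewrite rr; have -> : mu + sigma * t' - (mu + sigma * t) = sigma * (t' - t) by ring.
apply/andP; split.
  apply: mulr_ge0; first exact: ltW.
  have : 0 <= l' * (r - r') by rewrite mulr_ge0// ltW.
  by lra.
have -> : l1 / 2 * (2 * sigma * (r - r')) = sigma * (l1 * (r - r')) by field.
apply: ler_wpM2l; first exact: ltW.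
have : l * (r - r') <= l1 * (r - r') by exact: ler_wpM2r.
by lra.
Qed.

(** When [k_0] is not constant the correlation is continuous at 0, so it cannot lie below the limit
    there. *)
Lemma c0_le_corr0 g F : M2 F -> 0 < stdD F -> L2 (gam g) -> A4 g F ->
  0 < stdU (kup g F 0) -> c0 g F <= corrU (quantile F) (kup g F 0).
Proof.
move=> FM sF g2 a4 S0; rewrite leNgt; apply/negP => H.
have [cle _] := c0_spec FM sF g2 a4.
have e0 : 0 < c0 g F - corrU (quantile F) (kup g F 0) by rewrite subr_gt0.
have [d d0 Hd] := corr_continuous FM sF g2 (lexx 0) S0 e0.
have d2 : 0 < d / 2 := divr_gt0 d0 (ltr0Sn _ 1).
have := Hd (d / 2) (ltW d2); rewrite sub0r normrN (gtr0_norm d2).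
have := cle _ d2; move: (corrU _ (kup g F (d / 2))) (corrU _ (kup g F 0)) (c0 g F).
clear -d0 => x y z H1 H2.
have : `|y - x| < z - y by apply: H2; lra.
by rewrite ltr_norml; lra.
Qed.

Lemma hup_dist_le g F (mu sigma r l : R) : M2 F -> 0 < stdD F -> L2 (gam g) ->
  0 < sigma -> 0 <= l -> 0 < stdU (kup g F l) ->
  c0 g F <= corrU (quantile F) (kup g F l) ->
  eps_lo F mu sigma + 2 * sigma * stdD F * (1 - c0 g F) <= r ->
  dWq (quantile F) (hup g F mu sigma l) <= Num.sqrt r.
Proof.
move=> FM sF g2 s0 l0 S0 cl hr; have kF := kup_family FM sF g2.
rewrite (dWq_hup mu FM (family_K kF l0) sF s0 S0); apply: ler_wsqrtr.
apply: le_trans hr; rewrite lerD2l; apply: ler_wpM2l; last by rewrite lerD2l lerN2.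
exact: (ltW (mulr_gt0 (mulr_gt0 (ltr0Sn _ 1) s0) sF)).
Qed.

(** A constant projection of gamma means that gamma has non-positive covariance with the cone,
    whence the bound [mu]. It is approached by [hup] at small multipliers, all of which are feasible
    since their correlations are at least [c0]. *)
Lemma supH_const g F (mu sigma : R) (eps : \bar R) : M2 F -> 0 < stdD F ->
  L2 (gam g) -> EU (gam g) = 1 -> A4 g F -> 0 < sigma ->
  ((eps_lo F mu sigma + 2 * sigma * stdD F * (1 - c0 g F))%:E <= eps)%E ->
  constant01 (gamup g F) -> supH g F mu sigma eps = mu%:E.
Proof.
move=> FM sF g2 E1 a4 s0 hi_eps gc; have kF := kup_family FM sF g2.
have [_ qK _ kP] := kF; have [cle _] := c0_spec FM sF g2 a4.
have eN : eps != -oo%E by clear -hi_eps; case: eps hi_eps.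
apply/eqP; rewrite eq_le; apply/andP; split.
  apply: ge_ereal_sup => _ [G GM <-]; rewrite lee_fin.
  have [hK Eh _ _] := MsetE s0 GM; have h2 := K_L2 hK.
  rewrite /Hg (HgQE g2 E1 h2) Eh gerDl.
  have := isoproj_const (L2_ray 0 g2 qK) (kP 0 (lexx 0)) gc hK.
  by rewrite (cov_ray 0 g2 qK h2) mul0r addr0.
apply/lee_addgt0Pr => e e0.
(* From t + l r >= 0 and r <= [stdD F], the value at [l] falls short of [mu] by at most
   [sigma * l * stdD F = e]. *)
pose l := e / (sigma * stdD F).
have l0 : 0 < l := divr_gt0 e0 (mulr_gt0 s0 sF).
have S0 := kup_nonconst FM sF g2 a4 l0.
have [hK Eh Sh hcov] := hup_spec mu (family_K kF (ltW l0)) s0 S0; have h2 := K_L2 hK.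
have [G [GM GE]] : exists G, Mset F mu sigma eps G /\
    forall u, I01 u -> quantile G u = hup g F mu sigma l u.
  apply: (Mset_quantile s0 hK Eh Sh _ eN) => r er.
  apply: (hup_dist_le FM sF g2 s0 (ltW l0) S0 (cle l l0)).
  by rewrite -lee_fin -er.
rewrite -leeBlDr; last exact: isT.
rewrite -EFinB; apply: (@le_trans _ _ (Hg g G)%:E); last first.
  by apply: ereal_sup_ubound; exists G.
rewrite lee_fin (Hg_eq g GE) (HgQE g2 E1 h2) Eh (hcov _ g2) lerD2l.
have := family_slope kF (ltW l0) S0.
have : slope_c (quantile F) (kup g F) l <= stdD F.
  by rewrite /slope_c (ler_pdivrMr _ _ S0); exact: cov_le (K_L2 qK) (K_L2 (family_K kF (ltW l0))).
have lE : sigma * (l * stdD F) = e.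
  by rewrite mulrCA /l; exact: (divfK (lt0r_neq0 (mulr_gt0 s0 sF))).
move: S0 lE; move: (slope_c (quantile F) _ _) (slope_c (gam g) _ _) (stdU (kup g F l)).
move: (stdD F); clear -l0 s0 => s r t S S0 lE rs H.
have lr : l * r <= l * s by rewrite ler_pM2l.
rewrite -lE -mulrN ler_pM2l//; lra.
Qed.

End main_results.

(** * A supremum that is not attained *)

Section example.
Variable R : realType.
Implicit Types g F G h : R -> R.
Local Notation mu := (@lebesgue_measure R).
Local Notation I01 := (@I01 R).
Local Opaque covU EU stdU.

(** One family covers both the counterexample and the distortion [2 * x - x ^+ 2], which serves to
    compute tails of the uniform law. *)
Definition cubic (a b c x : R) : R := a * x + b * x ^+ 2 + c * x ^+ 3.

Lemma lipschitz_abs_continuous g (M : R) : 0 <= M ->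
  (forall x y, 0 <= x -> x <= y -> y <= 1 -> `|g y - g x| <= M * (y - x)) ->
  abs_continuous01 g.
Proof.
move=> M0 gM e e0; have M1 : 0 < M + 1 by rewrite ltr_wpDl.
exists (e / (M + 1)); first exact: divr_gt0.
move=> n a b Hab _; rewrite ltr_pdivlMr// mulrC => Hs.
apply: le_lt_trans Hs; rewrite mulr_sumr; apply: ler_sum => i _.
have [a0 [ab b1]] := Hab i (ltn_ord i); apply: le_trans (gM _ _ a0 ab b1) _.
by rewrite mulrDl mul1r lerDl subr_ge0.
Qed.

Lemma cubic_abs_continuous a b c : abs_continuous01 (cubic a b c).
Proof.
apply: (@lipschitz_abs_continuous _ (`|a| + 2 * `|b| + 3 * `|c|)).
  by rewrite !addr_ge0// mulr_ge0.
move=> x y x0 xy y1.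
have -> : cubic a b c y - cubic a b c x =
    (a + b * (x + y) + c * (x ^+ 2 + x * y + y ^+ 2)) * (y - x).
  by rewrite /cubic; ring.
rewrite normrM [X in _ * X]ger0_norm ?subr_ge0//; apply: ler_wpM2r.
  by rewrite subr_ge0.
have x1 := le_trans xy y1; have y0 := le_trans x0 xy.
have s1 : `|x + y| <= 2 by rewrite ger0_norm ?addr_ge0//; lra.
have s2 : `|x ^+ 2 + x * y + y ^+ 2| <= 3.
  rewrite ger0_norm; last by rewrite !addr_ge0// ?sqr_ge0// mulr_ge0.
  have : x ^+ 2 <= 1 by rewrite expr_le1.
  have : y ^+ 2 <= 1 by rewrite expr_le1.
  have : x * y <= 1 by rewrite -(mulr1 1); apply: ler_pM.
  by lra.
apply: le_trans (ler_normD _ _) _; apply: lerD.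
  apply: le_trans (ler_normD _ _) _; rewrite lerD2l normrM mulrC.
  exact: ler_wpM2r.
by rewrite normrM mulrC; exact: ler_wpM2r.
Qed.

Lemma gam_cubic a b c (u : R) :
  gam (cubic a b c) u = a + 2 * b * (1 - u) + 3 * c * (1 - u) ^+ 2.
Proof.
rewrite /gam; set x := 1 - u; apply: cvg_lim => //.
pose p (h : R) := (a + 2 * b * x + 3 * c * x ^+ 2) + (- b - 3 * c * x + c * h) * h.
have pc : p h @[h --> 0^'+] --> a + 2 * b * x + 3 * c * x ^+ 2.
  have -> : a + 2 * b * x + 3 * c * x ^+ 2 = p 0 by rewrite /p mulr0 addr0.
  apply: cvg_at_right_filter; rewrite /p.
  apply: cvgD; first exact: cvg_cst.
  apply: cvgM; last exact: cvg_id.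
  by apply: cvgD; [exact: cvg_cst|apply: cvgM; [exact: cvg_cst|exact: cvg_id]].
apply: cvg_trans pc; apply: near_eq_cvg; near=> h.
have h0 : 0 < h by near: h; exact: nbhs_right_gt.
by rewrite /p /cubic; field; rewrite gt_eqF.
Unshelve. all: by end_near. Qed.

Lemma L2_gam_cubic a b c : L2 (gam (cubic a b c)).
Proof.
have x2 : L2 (fun u : R => 1 - u) by apply: (L2B (L2_cst 1)); exact: (K_L2 (K_id R)).
have xx2 : L2 (fun u : R => (1 - u) ^+ 2).
  apply: (@L2_bounded _ _ 1); first by apply: measurable_funX; exact: L2_meas x2.
  move=> u /I01P/andP[u0 u1]; rewrite ger0_norm ?sqr_ge0// expr_le1//; lra.
have := L2D (L2D (L2_cst a) (L2Z (2 * b) x2)) (L2Z (3 * c) xx2).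
by apply: L2_eq => u _; rewrite gam_cubic.
Qed.

Lemma cubic_distortion a b c : a + b + c = 1 ->
  (forall x y, 0 <= x -> x <= y -> y <= 1 ->
     0 <= a + b * (x + y) + c * (x ^+ 2 + x * y + y ^+ 2)) ->
  distortion (cubic a b c).
Proof.
move=> abc pos.
have hm x y : 0 <= x -> x <= y -> y <= 1 -> cubic a b c x <= cubic a b c y.
  move=> x0 xy y1; rewrite -subr_ge0.
  have -> : cubic a b c y - cubic a b c x =
      (a + b * (x + y) + c * (x ^+ 2 + x * y + y ^+ 2)) * (y - x).
    by rewrite /cubic; ring.
  by rewrite mulr_ge0 ?subr_ge0//; exact: pos.
have g0 : cubic a b c 0 = 0 by rewrite /cubic; ring.
have g1 : cubic a b c 1 = 1 by rewrite /cubic !expr1n !mulr1.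
split=> //.
- by move=> x y; rewrite !in_itv/= => /andP[x0 x1] /andP[y0 y1] xy; exact: hm.
- by move=> x /andP[x0 x1]; rewrite -{1}g0 -{1}g1 !hm.
Qed.

Lemma cov_cubic_tail a b c (s : R) : distortion (cubic a b c) -> I01 s ->
  covU (gam (cubic a b c)) (fun u => (s < u)%R%:R) = cubic a b c (1 - s) - (1 - s).
Proof.
move=> gD sI; move/I01P: (sI) => /andP[s0 s1].
have ac := cubic_abs_continuous a b c; have g2 := L2_gam_cubic a b c.
rewrite (covE g2 (K_L2 (K_indic_itv s))) (gam_tail gD ac g2 (ltW s0) s1).
by rewrite (gam_mean gD ac g2) (EU_indic_itv sI) mul1r.
Qed.

(** The identity is half the weight of [2 * x - x ^+ 2], so [gam_tail] replaces a direct
    integration. *)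
Lemma cov_id_tail (s : R) : I01 s ->
  covU (fun u => u) (fun u => (s < u)%R%:R) = s * (1 - s) / 2.
Proof.
move=> sI; have gD : distortion (cubic 2 (-1) 0).
  apply: cubic_distortion; first by ring.
  by move=> x y x0 xy y1; lra.
have := cov_cubic_tail gD sI.
have -> : gam (cubic 2 (-1) 0) = (fun u => 2 * u).
  by apply/funext => u; rewrite gam_cubic; ring.
rewrite (covZl _ (K_L2 (K_id R)) (K_L2 (K_indic_itv s))) /cubic.
by move: (covU _ _); clear => x H; lra.
Qed.

(** Two features matter: [gex x - x = - x ^+ 2 * (1 - x)] is negative inside the interval, so all
    tail covariances are negative; and it is of second order at 0, so any positive multiple of a
    uniform quantile, whose tail covariance is of first order, overcomes it. The second feature
    gives (A4). *)
Definition gex : R -> R := cubic 1 (-1) 1.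

Lemma gex_distortion : distortion gex.
Proof.
apply: cubic_distortion; first by ring.
move=> x y x0 xy y1; have := sqr_ge0 (x + y - 1); have := sqr_ge0 (x - y).
have := sqr_ge0 (x + y); rewrite !expr2; lra.
Qed.

Lemma cov_gex_tail (s : R) : I01 s ->
  covU (gam gex) (fun u => (s < u)%R%:R) = - (s * (1 - s) ^+ 2).
Proof. by move=> sI; rewrite (cov_cubic_tail gex_distortion sI) /cubic; ring. Qed.

Lemma cov_gex_le0 k : Kcone k -> covU (gam gex) k <= 0.
Proof.
move=> kK; have g2 : L2 (gam gex) by exact: L2_gam_cubic.
have : 0 <= covU (fun u => -1 * gam gex u) k.
  apply: cov_ge0_of_tails kK; first exact: L2Z.
  move=> s sI; rewrite (covZl _ g2 (K_L2 (K_indic_itv s))) (cov_gex_tail sI).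
  move/I01P: sI => /andP[s0 s1]; rewrite mulN1r opprK mulr_ge0 ?sqr_ge0//.
  exact: ltW.
rewrite (covZl _ g2 (K_L2 kK)); gen_lra.
Qed.

Lemma not_attained_example : exists (g F : R -> R) (mu sigma : R) (eps : \bar R),
    [/\ M2 F /\ 0 < stdD F, distortion g /\ A1 g /\ A2 g /\ A4 g F,
        0 < sigma /\ (0 <= eps)%E /\
        (((meanD F - mu) ^+ 2 + (stdD F - sigma) ^+ 2)%:E < eps)%E,
        (((meanD F - mu) ^+ 2 + (stdD F - sigma) ^+ 2
           + 2 * sigma * stdD F * (1 - c0 g F))%:E <= eps)%E /\
        constant01 (gamup g F) &
        ~ (exists G, Mset F mu sigma eps G /\ (Hg g G)%:E = supH g F mu sigma eps)].
Proof.
have [F [FM qE]] := K_quantile (K_id R).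
have qK := quantile_K FM; have q2 := K_L2 qK.
have sF : 0 < stdD F.
  apply/(@stdU_gt0 _ (fun _ => quantile F) 0 qK) => -[c qc].
  have I3 : I01 (1 / 3) by apply/I01P; lra.
  have I2 : I01 (1 / 2) by apply/I01P; lra.
  have := qc _ I3; rewrite -(qc _ I2) (qE _ I3) (qE _ I2); lra.
have gD := gex_distortion; have g2 : L2 (gam gex) by exact: L2_gam_cubic.
have gac : abs_continuous01 gex by exact: cubic_abs_continuous.
have E1 := gam_mean gD gac g2; have kF := kup_family FM sF g2.
have [_ _ _ kP] := kF.
have gc : constant01 (gamup gex F).
  apply: (K_var_eq0 (family_K kF (lexx 0))); apply/eqP; rewrite eq_le var_ge0 andbT.
  rewrite -sqr_stdU -(family_self kF (lexx 0)) mul0r addr0.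
  exact: cov_gex_le0 (family_K kF (lexx 0)).
have nc l : 0 < l -> ~ constant01 (kup gex F l).
  (* The covariance of the ray with the tail at [1 - t] is [(1 - t) * t * (l / 2 - t)], positive
     once [t < l / 2]. *)
  move=> l0; pose t := Num.min (1 / 2) (l / 4).
  have t0 : 0 < t by rewrite lt_min; apply/andP; split; lra.
  have t2 : t <= 1 / 2 by rewrite ge_min lexx.
  have tl : t <= l / 4 by rewrite ge_min lexx orbT.
  have sI : I01 (1 - t) by apply/I01P; lra.
  apply: (isoproj_nonconst (L2_ray l g2 qK) (kP l (ltW l0)) (K_indic_itv (1 - t))).
  rewrite (cov_ray l g2 qK (K_L2 (K_indic_itv (1 - t)))) (cov_gex_tail sI).
  have -> : covU (quantile F) (fun u => (1 - t < u)%R%:R) = (1 - t) * t / 2.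
    rewrite (@cov_eq _ _ (fun u => u) _ (fun u => (1 - t < u)%R%:R) qE); last by move=> *; reflexivity.
    by rewrite (cov_id_tail sI) subKr.
  rewrite subKr; have : 0 < (1 - t) * t * (l / 2 - t).
    by rewrite !mulr_gt0//; lra.
  by congr (_ < _); field.
have a4 : A4 gex F.
  split; first by exists 1; split; [exact: ler01|exact: nc].
  set S := [set _ | _].
  have Slb : lbound S 0 by move=> x [].
  apply/eqP; rewrite eq_le; apply/andP; split; last first.
    by apply: lb_le_inf => //; exists 1; split; [exact: ler01|exact: nc].
  apply/ler_addgt0Pr => e e0; rewrite add0r; apply: ge_inf; first by exists 0.
  by split; [exact: ltW|exact: nc].
have a2 : A2 gex.
  (* [gam gex v - 1] factors as [- (3 * v - 1) * (1 - v)], which has no zero between 1/3 and 1. *)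
  move=> ae; have [v [v1 v2 Hv]] : exists v, [/\ 1 / 2 < v, v < 3 / 4 & gam gex v = 1].
    by apply: ae_I01_dense ae; lra.
  move: Hv; rewrite gam_cubic => Hv.
  have : 0 < (3 * v - 1) * (1 - v) by rewrite mulr_gt0; lra.
  by move: Hv; rewrite !expr2; lra.
(* An infinite budget meets both bounds on [eps] whatever the value of [c0]. *)
exists gex, F, 0, 1, +oo%E; split.
- by split; [exact: FM|exact: sF].
- split; [exact: gD|split; [split; [exact: gac|exact: g2]|split; [exact: a2|exact: a4]]].
- by split; [exact: ltr01|split; [exact: leey|exact: ltry]].
- by split; [exact: leey|exact: gc].
move=> [G [GM]]; rewrite (supH_const FM sF g2 E1 a4 ltr01 (leey _) gc) => -[].
have [hK Eh Sh _] := MsetE ltr01 GM; have h2 := K_L2 hK.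
rewrite /Hg (HgQE g2 E1 h2) Eh add0r => c0.
have hn : ~ constant01 (quantile G).
  by apply/(@stdU_gt0 _ (fun _ => quantile G) 0 hK); rewrite Sh; exact: ltr01.
have [s sI hs] := K_nonconst_level hK hn.
(* A maximiser would have zero covariance with the weight, hence so would its level set above the
   mean; but that set is a tail, where the covariance is negative. *)
have := polar_level_gt (EU (quantile G)) g2 cov_gex_le0 hK c0.
rewrite (@cov_eq _ _ (gam gex) _ (fun u => (s < u)%R%:R)); last 2 first.
- by move=> *; reflexivity.
- by move=> u uI; rewrite hs.
rewrite (cov_gex_tail sI); move/I01P: sI => /andP[s0 s1] /eqP.
rewrite oppr_eq0 mulf_eq0 (gt_eqF s0) sqrf_eq0 subr_eq0 => /eqP s1'.
by move: s1; rewrite -s1' ltxx.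
Qed.

End example.

Theorem theorem2 (R : realType) :
  (forall (g F : R -> R) (mu sigma : R) (eps : \bar R),
    M2 F -> 0 < stdD F ->
    distortion g -> A1 g -> A2 g -> A4 g F ->
    0 < sigma -> (0 <= eps)%E ->
    let lo := (meanD F - mu) ^+ 2 + (stdD F - sigma) ^+ 2 in
    let hi := lo + 2 * sigma * stdD F * (1 - c0 g F) in
    (lo%:E < eps)%E ->
    (* Part 1 *)
    ((eps < hi%:E)%E ->
      exists lam : R,
        [/\ 0 < lam,
            dWq (quantile F) (hup g F mu sigma lam) = Num.sqrt (fine eps),
            (forall lam' : R, 0 < lam' ->
               dWq (quantile F) (hup g F mu sigma lam') = Num.sqrt (fine eps) ->
               lam' = lam),
            unique_maximiser g F mu sigma eps (hup g F mu sigma lam) &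
          [/\ supH g F mu sigma eps = (HgQ g (hup g F mu sigma lam))%:E,
            HgQ g (hup g F mu sigma lam)
              = mu + sigma * stdU (gam g) * corrU (gam g) (kup g F lam) &
            {within `]lo, hi[%classic, continuous (fun e : R => fine (supH g F mu sigma e%:E))}]])
    /\
    (* Part 2 *)
    ((hi%:E <= eps)%E ->
      (~ constant01 (gamup g F) ->
        [/\ unique_maximiser g F mu sigma eps (hup g F mu sigma 0),
            supH g F mu sigma eps = (HgQ g (hup g F mu sigma 0))%:E &
            HgQ g (hup g F mu sigma 0)
              = mu + sigma * stdU (gam g) * corrU (gam g) (gamup g F)])
      /\
      (constant01 (gamup g F) -> supH g F mu sigma eps = mu%:E)))
  /\
  (* "this supremum need not be attained": an instance of the constant case
     of part 2 where no G in M_eps(mu,sigma) attains the supremum *)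
  (exists (g F : R -> R) (mu sigma : R) (eps : \bar R),
    [/\ M2 F /\ 0 < stdD F, distortion g /\ A1 g /\ A2 g /\ A4 g F,
        0 < sigma /\ (0 <= eps)%E /\
        (((meanD F - mu) ^+ 2 + (stdD F - sigma) ^+ 2)%:E < eps)%E,
        (((meanD F - mu) ^+ 2 + (stdD F - sigma) ^+ 2
           + 2 * sigma * stdD F * (1 - c0 g F))%:E <= eps)%E /\
        constant01 (gamup g F) &
        ~ (exists G, Mset F mu sigma eps G /\ (Hg g G)%:E = supH g F mu sigma eps)]).
Proof.
split; last exact: not_attained_example.
move=> g F mu sigma eps FM sF gD [gac g2] _ a4 s0 _ lo hi lo_eps.
have E1 := gam_mean gD gac g2; have kF := kup_family FM sF g2.
split=> [eps_hi|hi_eps].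
  have [e epsE] : exists e, eps = e%:E.
    by clear -lo_eps eps_hi; case: eps lo_eps eps_hi => // e _ _; exists e.
  move: lo_eps eps_hi; rewrite epsE !lte_fin => lo_e e_hi.
  have [l [l0 eE cl um sE]] := active_constraint FM sF g2 E1 a4 s0 lo_e e_hi.
  have S0 := kup_nonconst FM sF g2 a4 l0.
  have kK := family_K kF (ltW l0).
  have e0 : 0 <= e := le_trans (eps_lo_ge0 F mu sigma) (ltW lo_e).
  exists l; split; [exact: l0| | |exact: um|].
  - by rewrite (dWq_hup mu FM kK sF s0 S0) -/(eps_lo F mu sigma) -eE.
  - move=> l' l'0; have S'0 := kup_nonconst FM sF g2 a4 l'0.
    rewrite (dWq_hup mu FM (family_K kF (ltW l'0)) sF s0 S'0) -/(eps_lo F mu sigma) /=.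
    have D0 : 0 < 2 * sigma * stdD F := mulr_gt0 (mulr_gt0 (ltr0Sn _ 1) s0) sF.
    have r1 := corr_le1 FM sF g2 (ltW l'0) S'0.
    have x0 : 0 <= eps_lo F mu sigma +
        2 * sigma * stdD F * (1 - corrU (quantile F) (kup g F l')).
      apply: (addr_ge0 (eps_lo_ge0 F mu sigma)); apply: (mulr_ge0 (ltW D0)).
      by rewrite subr_ge0; exact: r1.
    move/eqP; rewrite (eqr_sqrt x0 e0) {1}eE => /eqP /addrI.
    move=> /(mulfI (lt0r_neq0 D0)) /addrI /oppr_inj E.
    exact: esym (multiplier_unique FM sF g2 a4 l0 l'0 cl (esym E)).
  - split; [exact: sE|exact: (HgQ_corr mu g2 E1 kK s0 S0)|].
    exact: (supH_continuous FM sF g2 E1 a4 s0).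
split=> [gn|gc]; last exact: (supH_const FM sF g2 E1 a4 s0 hi_eps gc).
have kK := family_K kF (lexx 0); have S0 := (stdU_gt0 kK).1 gn.
have eN : eps != -oo%E by clear -lo_eps; case: eps lo_eps.
have [um sE] : unique_maximiser g F mu sigma eps (hup g F mu sigma 0) /\
    supH g F mu sigma eps = (HgQ g (hup g F mu sigma 0))%:E.
  apply: (hup_optimal FM sF g2 E1 s0 (lexx 0) S0 eN).
  - move=> r er; apply: (hup_dist_le FM sF g2 s0 (lexx 0) S0).
      exact: (c0_le_corr0 FM sF g2 a4 S0).
    by move: hi_eps; rewrite er lee_fin.
  - by move=> G _; rewrite 2!mul0r; exact: lexx.
split; [exact: um|exact: sE|exact: (HgQ_corr mu g2 E1 kK s0 S0)].
Qed.
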